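(* Let $d=3$, $a=r=0$, $m\ge1$, and $$\omega(x)=c_m\mathbf{1}_{B_2(0)}(x),\qquad c_m:=\frac{3m}{32\pi}.$$ Let $R\in(0,2]$ be the unique solution in $(0,2]$ of $$R^3-12R+\frac{16}{m}=0.$$ Let $U$ be the (continuous) solution of $$\Delta U=\omega\ \text{ in }\mathbb{R}^3\setminus \overline{B_R(0)},\qquad U=0\ \text{ in }B_R(0),\qquad U(x)\to0\ \text{ as }|x|\to\infty .$$ Then the measure $\phi:=\omega-\Delta U$ (in the sense of distributions on $\mathbb{R}^3$) is $$\phi=c_m\mathbf{1}_{B_R(0)}\,dx+c_m\Bigl(\frac2R-\frac R2\Bigr)\mathcal{H}^2\llcorner\partial B_R(0),$$ and $\phi$ is a zero-flux stationary probability measure, i.e. a probability measure with $\phi\,(K_0*\omega-K_0*\phi)=0$.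
   Context: $K_0(x)=\nabla|x|=x/|x|$ for $x\neq0$, $K_0(0)=0$. $\mathcal{H}^2\llcorner\partial B_R(0)$ is the surface measure on the sphere of radius $R$. Zero-flux stationary means $\int_{\mathbb{R}^3}\xi(x)\cdot(K_0*\omega(x)-K_0*\phi(x))\,d\phi(x)=0$ for all $\xi\in C_c^\infty(\mathbb{R}^3;\mathbb{R}^3)$. *)

(* Defs.v *)
From HB Require Import structures.
From mathcomp Require Import all_boot all_order all_algebra.
From mathcomp Require Import all_classical all_reals all_analysis.

Set Implicit Arguments.
Unset Strict Implicit.
Unset Printing Implicit Defensive.

Import Order.TTheory GRing.Theory Num.Theory numFieldNormedType.Exports.

Local Open Scope classical_set_scope.
Local Open Scope ring_scope.

(* R^3 is the iterated product, which has both the product topology and the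
   product (Borel) sigma-algebra. The library norm on a product is the sup
   norm, so the Euclidean norm is introduced separately. *)
Notation R3 R := (R * R * R)%type.

(* R^3 as a measurable space, with the sigma-algebra on each factor on which
   [lebesgue_measure] is defined; the carrier is convertible to [R3 R]. *)
Notation borel3 R :=
  (measurableTypeR R * measurableTypeR R * measurableTypeR R)%type.

Section Euclidean.
Context {R : realType}.
Implicit Types (x y : R3 R) (r : R).

Definition dot x y : R := x.1.1 * y.1.1 + x.1.2 * y.1.2 + x.2 * y.2.

Definition cross x y : R3 R :=
  (x.1.2 * y.2 - x.2 * y.1.2,
   x.2 * y.1.1 - x.1.1 * y.2,
   x.1.1 * y.1.2 - x.1.2 * y.1.1).

Definition enorm x : R := Num.sqrt (dot x x).

Definition oball r : set (R3 R) := [set x | enorm x < r].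
Definition cball r : set (R3 R) := [set x | enorm x <= r].

Definition e1 : R3 R := (1, 0, 0).
Definition e2 : R3 R := (0, 1, 0).
Definition e3 : R3 R := (0, 0, 1).

Definition laplacian (f : R3 R -> R) (x : R3 R) : R :=
  'D_e1 ('D_e1 f) x + 'D_e2 ('D_e2 f) x + 'D_e3 ('D_e3 f) x.

End Euclidean.

Section Measures.
Context {R : realType}.

Definition leb2 : {measure set (measurableTypeR R * measurableTypeR R) -> \bar R} :=
  (@lebesgue_measure R \x @lebesgue_measure R)%E.
Definition leb3 : {measure set (borel3 R) -> \bar R} :=
  (@lebesgue_measure R \x @lebesgue_measure R \x @lebesgue_measure R)%E.

(* Surface measure of a parametrized surface [p] over [D]: the area element is
   the length of the cross product of the two partial derivatives of [p]. *)
Definition surface_measure (p : R * R -> R3 R) (D : set (R * R))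
    (A : set (R3 R)) : \bar R :=
  (\int[leb2]_(t in D)
    (\1_A (p t) * enorm (cross ('D_(1, 0) p t) ('D_(0, 1) p t)))%:E)%E.

Definition spherical (r : R) (t : R * R) : R3 R :=
  (r * sin t.1 * cos t.2, r * sin t.1 * sin t.2, r * cos t.1).

(* The restriction of H^2 to the sphere of radius [r] centred at the origin;
   only the null set of the poles and one meridian is covered more than once. *)
Definition sphere_measure (r : R) : set (R3 R) -> \bar R :=
  surface_measure (spherical r) (`[0, pi] `*` `[0, 2 * pi]).

Definition vintegral (mu : {measure set (borel3 R) -> \bar R}) (f : R3 R -> R3 R) : R3 R :=
  (\int[mu]_x (f x).1.1, \int[mu]_x (f x).1.2, \int[mu]_x (f x).2).

End Measures.

Section Distributions.
Context {R : realType}.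

(* C^oo: all iterated directional derivatives exist and are continuous. *)
Definition iter_derive {V : normedModType R} (vs : seq (R3 R)) (f : R3 R -> V) :
    R3 R -> V :=
  foldr (fun v g => 'D_v g) f vs.

Definition smooth {V : normedModType R} (f : R3 R -> V) : Prop :=
  forall vs, continuous (iter_derive vs f) /\
    forall x v, derivable (iter_derive vs f) x v.

Definition supp {V : normedModType R} (f : R3 R -> V) : set (R3 R) :=
  closure [set x | f x <> 0].

Definition test_function {V : normedModType R} (Omega : set (R3 R))
    (f : R3 R -> V) : Prop :=
  [/\ smooth f, compact (supp f) & supp f `<=` Omega].

(* Distributions are represented by their values on test functions; [distr_eq]
   only compares them on test functions supported in [Omega]. *)
Definition distr : Type := (R3 R -> R) -> R.

Definition distr_fun (f : R3 R -> R) : distr :=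
  fun eta => \int[leb3]_x (f x * eta x).

Definition distr_measure (mu : {measure set (borel3 R) -> \bar R}) : distr :=
  fun eta => \int[mu]_x eta x.

Definition distr_laplacian (T : distr) : distr := fun eta => T (laplacian eta).

Definition distr_sub (S T : distr) : distr := fun eta => S eta - T eta.

Definition distr_eq (Omega : set (R3 R)) (S T : distr) : Prop :=
  forall eta : R3 R -> R, test_function Omega eta -> S eta = T eta.

End Distributions.

Section Model.
Context {R : realType}.

Definition K0 (x : R3 R) : R3 R := if x == 0 then 0 else (enorm x)^-1 *: x.

Definition K0_conv_fun (f : R3 R -> R) (x : R3 R) : R3 R :=
  vintegral leb3 (fun y => f y *: K0 (x - y)).

Definition K0_conv_measure (mu : {measure set (borel3 R) -> \bar R}) (x : R3 R) : R3 R :=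
  vintegral mu (fun y => K0 (x - y)).

Definition zero_flux_stationary (omega : R3 R -> R)
    (phi : {measure set (borel3 R) -> \bar R}) : Prop :=
  forall xi : R3 R -> R3 R, test_function setT xi ->
    \int[phi]_x dot (xi x) (K0_conv_fun omega x - K0_conv_measure phi x) = 0.

Definition c_ (m : R) : R := 3 * m / (32 * pi).

Definition omega_ (m : R) (x : R3 R) : R := c_ m * \1_(oball 2) x.

Definition vanishes_at_infinity (U : R3 R -> R) : Prop :=
  forall eps : R, 0 < eps -> exists M : R, forall x, M < enorm x -> `|U x| < eps.

(* The equation is understood in the sense of distributions, since [omega]
   may be discontinuous. *)
Definition exterior_solution (omega : R3 R -> R) (r : R) (U : R3 R -> R) : Prop :=
  [/\ continuous U,
      distr_eq (~` cball r) (distr_laplacian (distr_fun U)) (distr_fun omega),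
      forall x, oball r x -> U x = 0
    & vanishes_at_infinity U].

End Model.

(* Main.v *)
(** For [s > 0] the shell potential [v_s x = 1 / max(|x|, s)] satisfies
    [int v_s (laplacian eta) = - int_(S^2) eta (s n) dn] for every test function
    [eta], by integration by parts along rays. With [k = 2 / r - r / 2],
    superposing one shell of radius [r] and the shells of radii [r <= s < 2] gives
    [U = c (k r^2 v_r - int_r^2 s^2 v_s ds)], which vanishes on the ball of radius
    [r] because [k r = (4 - r^2) / 2], and whose distributional Laplacian yields the
    formula for [phi]; the equation for [r] says that [phi] has mass 1.

    Uniqueness is a weak maximum principle. If the difference [w] of two solutions
    had a positive maximum, take the maximum point [x0] farthest from the origin and
    test [laplacian w = 0] against [F (1 / sqrt (|y - x0|^2 + d) - 1 / rho)] with
    [F t = t exp (- 1 / t)]: as [d] tends to 0 this forces [w] to equal its maximum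
    near [x0], also at points farther away.

    For the flux, the law of cosines shows that [K0 (x - y)] averages to
    [2 x / (3 s)] over [|y| = s] whenever [|x| <= s]. Hence the shells between [r]
    and [2] and the charge on the sphere of radius [r] produce the same field on the
    closed ball of radius [r], which carries [phi].

    Integrals over spheres are written as integrals over the punctured unit ball
    through [y |-> s y / |y|], so that polar coordinates only need the scaling of
    Lebesgue measure; angles occur only in the comparison with the surface measure
    and in the computation of the field of a shell. *)
Require Import Defs.
From HB Require Import structures.
From mathcomp Require Import all_boot all_order all_algebra.
From mathcomp Require Import all_classical all_reals all_analysis.
From mathcomp Require Import measurable_realfun ring lra.

Set Implicit Arguments.
Unset Strict Implicit.
Unset Printing Implicit Defensive.

Import Order.TTheory GRing.Theory Num.Theory numFieldNormedType.Exports.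

Local Open Scope classical_set_scope.
Local Open Scope ring_scope.

(** * Image measures and change of variables *)

Section Pushforward.
Local Open Scope ereal_scope.
Context d d' (X : measurableType d) (Y : measurableType d') (R : realType).

(** The statement quantifies over every solution U; uniqueness lets U be replaced by the explicit
    superposition, after which every claim is a computation. Integration by parts needs no
    divergence theorem: the integral of a directional derivative vanishes by translation invariance,
    even across the kink of v_s, and the fundamental theorem of calculus along rays does the rest.
    The direction of a uniform point of the unit ball is uniform on the sphere, and the integral of
    s^2 over [0, 1] is 1/3; hence 3 times an integral of f (s y / |y|) over the punctured ball is
    the integral of f (s n) over unit vectors n. This is the origin of the recurring factor 3. The
    profile F is flat at 0, so with V the regularised potential, F (V - 1/rho), extended by 0, is
    smooth and supported in a ball of radius rho. Its Laplacian is F'' |grad V|^2 + F' (laplacian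
    V): the first term is nonnegative, and - laplacian V concentrates at x0 with mass at most 4 pi
    for every d. The mass of phi is (m / 16) (12 r - r^3), so mass 1 is the equation for r. The
    field of a shell is computed only on the vertical axis and carried to other points by flips and
    rotations; the latter preserve volume as products of shears. *)

Lemma ge0_integral_scaled_pushforward (m : {measure set X -> \bar R})
    (m' : {measure set Y -> \bar R}) (T : X -> Y) (k : {nonneg R}) :
  measurable_fun [set: X] T ->
  (forall A, measurable A -> m (T @^-1` A) = k%:num%:E * m' A) ->
  forall f : Y -> \bar R, measurable_fun [set: Y] f -> (forall y, 0 <= f y) ->
  \int[m]_x f (T x) = k%:num%:E * \int[m']_y f y.
Proof.
move=> mT mE g mg g0.
have := @ge0_integral_pushforward _ _ X Y R T mT m setT g measurableT mg (fun y _ => g0 y).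
rewrite preimage_setT => <-.
rewrite -ge0_integral_mscale//.
apply: eq_measure_integral => A mA _.
exact: mE.
Qed.

(** Positive and negative parts are treated separately. The closing case analysis checks that
    multiplication by k > 0 commutes with the extended difference even when one or both parts are
    infinite, so no integrability has to be carried along. *)
Lemma integral_scaled_pushforward (m : {measure set X -> \bar R})
    (m' : {measure set Y -> \bar R}) (T : X -> Y) (k : {nonneg R}) :
  measurable_fun [set: X] T ->
  (forall A, measurable A -> m (T @^-1` A) = k%:num%:E * m' A) ->
  forall f : Y -> \bar R, measurable_fun [set: Y] f ->
  \int[m]_x f (T x) = k%:num%:E * \int[m']_y f y.
Proof.
move=> mT mE f mf.
rewrite integralE [in RHS]integralE.
rewrite (_ : (fun x => f (T x))^\+ = fun x => f^\+ (T x)); last first.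
  by apply/funext => x; rewrite !funeposE.
rewrite (_ : (fun x => f (T x))^\- = fun x => f^\- (T x)); last first.
  by apply/funext => x; rewrite !funenegE.
rewrite !(ge0_integral_scaled_pushforward mT mE)//;
  [|exact: measurable_funeneg|exact: measurable_funepos].
have p0 : 0 <= \int[m']_y f^\+ y by exact: integral_ge0.
have n0 : 0 <= \int[m']_y f^\- y by exact: integral_ge0.
have [->|k0] := eqVneq k%:num%R 0%R; first by rewrite !mul0e sube0.
have kp : 0 < k%:num%:E :> \bar R by rewrite lte_fin lt_def k0/=.
case: (\int[m']_y f^\+ y) p0 => [x _| _ |//];
  case: (\int[m']_y f^\- y) n0 => [y _| _ |//] /=;
  by rewrite ?gt0_muley ?gt0_muleNy//= -?EFinM -?EFinB -?EFinM ?mulrBr// ?gt0_muley ?gt0_muleNy.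
Qed.

Lemma integral_pushforward_preserving (m : {measure set X -> \bar R})
    (m' : {measure set Y -> \bar R}) (T : X -> Y) :
  measurable_fun [set: X] T ->
  (forall A, measurable A -> m (T @^-1` A) = m' A) ->
  forall f : Y -> \bar R, measurable_fun [set: Y] f ->
  \int[m]_x f (T x) = \int[m']_y f y.
Proof.
move=> mT mE f mf; rewrite (@integral_scaled_pushforward m m' T (1%:nng)%R)//= ?mul1e//.
by move=> A mA; rewrite mE// mul1e.
Qed.

End Pushforward.


(** * Product maps and fibrewise maps on product measures *)

Section Prod_measure.
Local Open Scope ereal_scope.
Context d1 d2 (X : measurableType d1) (Y : measurableType d2) (R : realType).
Variables (m1 : {sigma_finite_measure set X -> \bar R}).
Variables (m2 : {sigma_finite_measure set Y -> \bar R}).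

Let push (F : X * Y -> X * Y) (mF : measurable_fun setT F) :=
  measure_function_pushforward__canonical__measure_function_Measure (m1 \x m2)%E mF.

Lemma measurable_prod_map (S : X -> X) (T : Y -> Y) :
  measurable_fun setT S -> measurable_fun setT T ->
  measurable_fun setT (fun p : X * Y => (S p.1, T p.2)).
Proof.
move=> mS mT; apply: measurable_fun_pair.
  exact: (measurableT_comp mS measurable_fst).
exact: (measurableT_comp mT measurable_snd).
Qed.

(** The pushforward divided by k l agrees with the product measure on rectangles, hence everywhere
    by uniqueness of product measures. *)
Lemma prod_scaled_pushforward (S : X -> X) (T : Y -> Y) (k l : {posnum R}) :
  measurable_fun setT S -> measurable_fun setT T ->
  (forall A, measurable A -> m1 (S @^-1` A) = k%:num%:E * m1 A) ->
  (forall A, measurable A -> m2 (T @^-1` A) = l%:num%:E * m2 A) ->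
  forall A, measurable A ->
    (m1 \x m2) ((fun p => (S p.1, T p.2)) @^-1` A) = (k%:num * l%:num)%:E * (m1 \x m2) A.
Proof.
move=> mS mT SE TE A mA.
have c0 : (0 <= (k%:num * l%:num)^-1)%R by [].
pose m' := mscale (NngNum c0) (push (measurable_prod_map mS mT)).
have kl0 : (k%:num * l%:num != 0)%R by [].
have -> : (m1 \x m2) A = m' A.
  apply: product_measure_unique => // B C mB mC.
  rewrite /m' /= /mscale/=.
  have E : (m1 \x m2) ((S @^-1` B) `*` (T @^-1` C)) =
      (k%:num%:E * m1 B) * (l%:num%:E * m2 C).
    rewrite product_measure1E; last 2 first.
      by rewrite -[X in measurable X]setTI; apply: (mS).
      by rewrite -[X in measurable X]setTI; apply: (mT).
    by congr (_ * _); [exact: SE|exact: TE].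
  rewrite [X in _ * X](_ : _ = (k%:num%:E * m1 B) * (l%:num%:E * m2 C)); last exact: E.
  by rewrite muleACA -EFinM !muleA -EFinM mulVf// mul1e.
by rewrite /m' /mscale/= muleA -EFinM divff// mul1e.
Qed.

(** Cavalieri's principle: a map that moves only the second coordinate, by a rule depending on the
    first, acts separately on each section. This is what makes shears measure preserving. *)
Lemma xfiber_pushforward (S : X -> Y -> Y) :
  measurable_fun setT (fun p : X * Y => (p.1, S p.1 p.2)) ->
  (forall x A, measurable A -> m2 (S x @^-1` A) = m2 A) ->
  forall A, measurable A ->
    (m1 \x m2) ((fun p => (p.1, S p.1 p.2)) @^-1` A) = (m1 \x m2) A.
Proof.
move=> mS SE A mA; rewrite /product_measure1; apply: eq_integral => x _ /=.
transitivity (m2 (S x @^-1` xsection A x)); last by apply: SE; exact: measurable_xsection.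
by congr (m2 _); apply/seteqP; split => y /=; rewrite /xsection/= !inE.
Qed.

(** The product measure is built from x-sections; uniqueness identifies it with the one built from
    y-sections, after which the argument is the symmetric one. *)
Lemma yfiber_pushforward (S : Y -> X -> X) :
  measurable_fun setT (fun p : X * Y => (S p.2 p.1, p.2)) ->
  (forall y A, measurable A -> m1 (S y @^-1` A) = m1 A) ->
  forall A, measurable A ->
    (m1 \x m2) ((fun p => (S p.2 p.1, p.2)) @^-1` A) = (m1 \x m2) A.
Proof.
move=> mS SE A mA.
have E B : measurable B -> (m1 \x m2) B = (m1 \x^ m2) B.
  by move=> mB; apply: product_measure_unique => // C D mC mD; exact: product_measure2E.
rewrite !E//; last by rewrite -[X in measurable X]setTI; apply: (mS).
rewrite /product_measure2; apply: eq_integral => y _ /=.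
transitivity (m1 (S y @^-1` ysection A y)); last by apply: SE; exact: measurable_ysection.
by congr (m1 _); apply/seteqP; split => x /=; rewrite /ysection/= !inE.
Qed.

End Prod_measure.

(** * Scaling and translation of Lebesgue measure on the line *)

Section Lebesgue_affine.
Context {R : realType}.
Notation mu := (@lebesgue_measure R).
Local Open Scope ereal_scope.

Lemma lebesgue_measure_scale (k : {posnum R}) (A : set (measurableTypeR R)) : measurable A ->
  mu ((fun x => k%:num * x)%R @^-1` A) = (k%:num^-1)%:E * mu A.
Proof.
move=> mA.
have mk : measurable_fun setT (fun x : measurableTypeR R => (k%:num * x)%R : measurableTypeR R).
  exact: mulrl_measurable.
have c0 : (0 <= k%:num)%R by [].
pose m' := mscale (NngNum c0)
  (measure_function_pushforward__canonical__measure_function_Measure mu mk).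
suff -> : mu A = m' A by rewrite /m' /mscale/= muleA -EFinM mulVf// mul1e.
apply: lebesgue_measure_unique => // _ [[a b]] _ <-.
rewrite /m' /= /mscale/= /pushforward/=.
rewrite (_ : (fun x => k%:num * x)%R @^-1` `]a, b] =
   `](a / k%:num)%R, (b / k%:num)%R]%classic); last first.
  by apply/seteqP; split => x /=; rewrite !in_itv/= ltr_pdivrMr// ler_pdivlMr// mulrC.
rewrite !lebesgue_measure_itv/= !lte_fin ltr_pM2r//.
case: ifPn => _; last by rewrite mule0.
by rewrite -!EFinB -EFinM -mulrBl mulrCA divff// mulr1.
Qed.

Lemma lebesgue_measure_translate (c : R) (A : set (measurableTypeR R)) : measurable A ->
  mu ((fun x => x + c)%R @^-1` A) = mu A.
Proof.
move=> mA.
have mk : measurable_fun setT (fun x : measurableTypeR R => (x + c)%R : measurableTypeR R).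
  by apply: measurable_funD.
pose m' := measure_function_pushforward__canonical__measure_function_Measure mu mk.
apply/esym; rewrite -[RHS]/(m' A).
apply: lebesgue_measure_unique => // _ [[a b]] _ <-.
rewrite /m' /= /pushforward/=.
rewrite (_ : (fun x => x + c)%R @^-1` `]a, b] = `](a - c)%R, (b - c)%R]%classic); last first.
  by apply/seteqP; split => x /=; rewrite !in_itv/= ltrBlDr lerBrDr.
rewrite !lebesgue_measure_itv/= !lte_fin ltrD2r.
case: ifPn => _//.
by rewrite -!EFinB; congr EFin; ring.
Qed.

End Lebesgue_affine.

Ltac meas := repeat match goal with
  | |- measurable_fun _ (fun _ => (_, _)) => apply: measurable_fun_pair
  | |- measurable_fun _ (fun _ => ?c) => exact: measurable_cst
  | |- measurable_fun _ (fun x => x) => exact: measurable_id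
  | |- measurable_fun _ (fun x => fst x) => exact: measurable_fst
  | |- measurable_fun _ (fun x => snd x) => exact: measurable_snd
  | |- measurable_fun _ (fun x => fst (@?g x)) => apply: (measurableT_comp measurable_fst)
  | |- measurable_fun _ (fun x => snd (@?g x)) => apply: (measurableT_comp measurable_snd)
  | |- measurable_fun _ (fun x => ((@?f x) * (@?g x))%R) => apply: measurable_funM
  | |- measurable_fun _ (fun x => ((@?f x) + (- (@?g x)))%R) => apply: measurable_funB
  | |- measurable_fun _ (fun x => ((@?f x) + (@?g x))%R) => apply: measurable_funD
  | |- measurable_fun _ (fun x => (- (@?g x))%R) => apply: measurableT_comp; first exact: oppr_measurable
  | |- measurable_fun _ (fun x => (@?f x ^+ _)%R) => apply: measurable_funX
  end.

(** * Measurability of functions on three-dimensional space *)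

Section Measurability.
Context {R : realType}.
Notation mR := (measurableTypeR R).

(** The sigma-algebra is a product, so openness has to be related to boxes: an open set is the union
    of the countably many cubes with rational centre and radius that it contains. *)
Lemma open_measurable_R3 (U : set (R3 R)) : open U -> measurable (U : set (borel3 R)).
Proof.
move=> oU.
pose box (q : rat * rat * rat * rat) : set (borel3 R) :=
  (ball (ratr q.1.1.1 : R) (ratr q.2) `*` ball (ratr q.1.1.2 : R) (ratr q.2))
  `*` ball (ratr q.1.2 : R) (ratr q.2).
have -> : U = \bigcup_q (if `[< box q `<=` U >] then box q else set0).
  apply/seteqP; split => [x Ux|x [q _]]; last by case: ifPn => // /asboolP bU bx; exact: bU.
  have /nbhs_ballP[e/= e0 xeU] := open_nbhs_nbhs (conj oU Ux).
  (* A cube of radius d < e / 2 whose centre is within d of x lies in the e-ball of x. *)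
  have /rat_in_itvoo[d] : 0 < e / 2 by rewrite divr_gt0.
  rewrite in_itv/= => /andP[d0 de].
  have H (y : R) : exists q : rat, `|ratr q - y| < ratr d.
    have /rat_in_itvoo[q] : y - ratr d < y + ratr d by rewrite ltrD2l gtrN.
    rewrite in_itv/= => /andP[q1 q2]; exists q.
    by rewrite ltr_distlC; apply/andP; split; lra.
  have [q1 h1] := H x.1.1; have [q2 h2] := H x.1.2; have [q3 h3] := H x.2.
  exists (q1, q2, q3, d) => //; case: ifPn => [_|/asboolP nb].
    by split; [split|]; rewrite /ball/=.
  exfalso; apply: nb => y [[/= y1 y2] y3]; apply: xeU.
  move: y1 y2 y3; rewrite /ball/= => y1 y2 y3.
  have T (a b c : R) : `|a - b| < ratr d -> `|a - c| < ratr d :> R -> `|b - c| < e.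
    move=> ab ac; rewrite (_ : b - c = (b - a) + (a - c)); last by ring.
    apply: (le_lt_trans (ler_normD _ _)); rewrite distrC.
    by apply: lt_le_trans (ltrD ab ac) _; lra.
  by split; [split|]; rewrite /ball/=; [exact: (T _ _ _ h1)|exact: (T _ _ _ h2)|exact: (T _ _ _ h3)].
apply: countable_bigcupT_measurable => // q; case: ifP => // _.
by apply: measurableX; [apply: measurableX|]; exact: measurable_ball.
Qed.

Lemma continuous_measurable_R3 (f : R3 R -> R) :
  continuous f -> measurable_fun setT (f : borel3 R -> R).
Proof.
move=> cf; apply: (measurability _ (RGenOInfty.measurableE R)).
move=> /= _ [_ [a ->]] <-; rewrite setTI.
apply: open_measurable_R3; apply: open_comp => // x _; exact: cf.
Qed.

Lemma measurable_sqrt d (X : measurableType d) (f : X -> R) :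
  measurable_fun setT f -> measurable_fun setT (fun x => Num.sqrt (f x) : R).
Proof.
move=> mf; apply: (@measurableT_comp _ _ _ _ _ _ (@Num.sqrt R : mR -> R)) => //.
apply: continuous_measurable_fun; exact: sqrt_continuous.
Qed.

(** The inverse is continuous only off 0; the point 0 is split off as a measurable singleton. *)
Lemma measurable_inv d (X : measurableType d) (f : X -> R) :
  measurable_fun setT f -> measurable_fun setT (fun x => (f x)^-1 : R).
Proof.
move=> mf; apply: (@measurableT_comp _ _ _ _ _ _ (@GRing.inv R : mR -> R)) => //.
have m0 : measurable [set 0 : mR] by exact: measurable_set1.
rewrite -(setvU [set 0]); apply/measurable_funU => //; first exact: measurableC.
split.
  apply: open_continuous_measurable_fun; first by apply/closed_openC; exact: closed_eq.
  by move=> x /[!inE]/= x0; apply: inv_continuous; exact/eqP.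
exact: measurable_fun_set1.
Qed.

Lemma measurable_dot d (X : measurableType d) (f g : X -> borel3 R) :
  measurable_fun setT f -> measurable_fun setT g ->
  measurable_fun setT (fun x => dot (f x) (g x) : R).
Proof.
by move=> mf mg; rewrite /dot; meas.
Qed.

Lemma measurable_enorm d (X : measurableType d) (f : X -> borel3 R) :
  measurable_fun setT f -> measurable_fun setT (fun x => enorm (f x) : R).
Proof. by move=> mf; apply: measurable_sqrt; exact: measurable_dot. Qed.

Lemma measurable_scale3 d (X : measurableType d) (k : X -> R) (f : X -> borel3 R) :
  measurable_fun setT k -> measurable_fun setT f ->
  measurable_fun setT (fun x => k x *: (f x : R3 R) : borel3 R).
Proof.
move=> mk mf.
rewrite (_ : (fun x => _) = fun x => (k x * (f x).1.1, k x * (f x).1.2, k x * (f x).2)).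
  by meas.
by apply/funext => x; case: (f x) => -[].
Qed.

Lemma measurable_add3 d (X : measurableType d) (f g : X -> borel3 R) :
  measurable_fun setT f -> measurable_fun setT g ->
  measurable_fun setT (fun x => (f x : R3 R) + (g x : R3 R) : borel3 R).
Proof.
move=> mf mg.
rewrite (_ : (fun x => _) = fun x => ((f x).1.1 + (g x).1.1, (f x).1.2 + (g x).1.2, (f x).2 + (g x).2)).
  by meas.
by apply/funext => x; case: (f x) => -[] ? ? ?; case: (g x) => -[].
Qed.

End Measurability.

(** * Measure preserving maps and sigma-finiteness of products *)

Section Preserving.
Local Open Scope ereal_scope.
Context d (X : measurableType d) (R : realType) (m : {measure set X -> \bar R}).

Definition preserving (T : X -> X) :=
  measurable_fun setT T /\ forall A, measurable A -> m (T @^-1` A) = m A.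

Lemma preserving_comp S T : preserving S -> preserving T -> preserving (S \o T).
Proof.
move=> [mS SE] [mT TE]; split; first exact: measurableT_comp.
move=> A mA; rewrite comp_preimage TE; first exact: SE.
by rewrite -[X in measurable X]setTI; exact: mS.
Qed.

Lemma preserving_integral T (f : X -> \bar R) : preserving T ->
  measurable_fun setT f -> \int[m]_x f (T x) = \int[m]_x f x.
Proof. by move=> [mT TE] mf; exact: integral_pushforward_preserving. Qed.

End Preserving.

Lemma sigma_finite_product d1 d2 (X : measurableType d1) (Y : measurableType d2)
    (R : realType) (m1 : {sigma_finite_measure set X -> \bar R})
    (m2 : {sigma_finite_measure set Y -> \bar R}) : sigma_finite setT (m1 \x m2)%E.
Proof.
have /sigma_finiteP[F [TF ndF Foo]] := sigma_finiteT m1.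
have /sigma_finiteP[G [TG ndG Goo]] := sigma_finiteT m2.
exists (fun n => F n `*` G n).
  apply/seteqP; split => // -[x y] _.
  have : [set: X] x by [].
  have : [set: Y] y by [].
  rewrite TF TG => -[n _ Gny] [k _ Fkx]; exists (maxn n k) => //; split.
    by move: x Fkx; exact/subsetPset/ndF/leq_maxr.
  by move: y Gny; exact/subsetPset/ndG/leq_maxl.
move=> k; have [mF Fk] := Foo k; have [mG Gk] := Goo k.
split; first exact: measurableX.
by rewrite product_measure1E// lte_mul_pinfty// ge0_fin_numE.
Qed.

Section Sigma_finite.
Context {R : realType}.
Notation mR := (measurableTypeR R).

(* The library's sigma-finite instance for product measures is shadowed by the
   one for subprobabilities, so it is packed again. *)
Definition leb2sf : {sigma_finite_measure set (mR * mR)%type -> \bar R} :=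
  HB.pack_for (SigmaFiniteMeasure.type _ _) (lebesgue_measure \x lebesgue_measure)%E
    (Measure_isSigmaFinite.Build _ _ _ (lebesgue_measure \x lebesgue_measure)%E
      (sigma_finite_product (@lebesgue_measure R) (@lebesgue_measure R))).

Definition leb3sf : {sigma_finite_measure set (borel3 R) -> \bar R} :=
  HB.pack_for (SigmaFiniteMeasure.type _ _) (leb2sf \x lebesgue_measure)%E
    (Measure_isSigmaFinite.Build _ _ _ (leb2sf \x lebesgue_measure)%E
      (sigma_finite_product leb2sf (@lebesgue_measure R))).

End Sigma_finite.

(** * Invariance of volume under translations, reflections and rotations *)

Section Invariance.
Context {R : realType}.
Notation mR := (measurableTypeR R).
Notation mu := (@lebesgue_measure R).
Notation mu2 := (@leb2sf R).
Implicit Types (x : R3 R).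

Lemma mule1E (a : \bar R) : (a = 1%:E * a)%E. Proof. by rewrite mul1e. Qed.

Lemma leb2_prod_map (S T : mR -> mR) : measurable_fun setT S -> measurable_fun setT T ->
  (forall A, measurable A -> mu (S @^-1` A) = mu A) ->
  (forall A, measurable A -> mu (T @^-1` A) = mu A) ->
  preserving leb2 (fun p : mR * mR => (S p.1, T p.2)).
Proof.
move=> mS mT SE TE; split; first exact: measurable_prod_map.
move=> A mA; rewrite [RHS]mule1E.
have := @prod_scaled_pushforward _ _ _ _ _ mu mu S T 1%:pos 1%:pos mS mT _ _ A mA.
by rewrite /= mul1r; apply => B mB; rewrite mul1e; [exact: SE|exact: TE].
Qed.

Lemma leb3_prod_map (S : mR * mR -> mR * mR) (T : mR -> mR) :
  preserving leb2 S -> measurable_fun setT T ->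
  (forall A, measurable A -> mu (T @^-1` A) = mu A) ->
  preserving leb3 (fun p : borel3 R => (S p.1, T p.2)).
Proof.
move=> [mS SE] mT TE; split; first exact: measurable_prod_map.
move=> A mA; rewrite [RHS]mule1E.
have := @prod_scaled_pushforward _ _ _ _ _ mu2 mu S T 1%:pos 1%:pos mS mT _ _ A mA.
by rewrite /= mul1r; apply => B mB; rewrite mul1e; [exact: SE|exact: TE].
Qed.

Lemma measurable_translate1 (c : R) : measurable_fun setT (fun x : mR => x + c : mR).
Proof. by apply: measurable_funD. Qed.

Lemma leb3_translate (c : R3 R) : preserving leb3 (fun x : borel3 R => (x : R3 R) + c : borel3 R).
Proof.
rewrite (_ : (fun x => _) = (fun x : borel3 R =>
  ((x.1.1 + c.1.1, x.1.2 + c.1.2), x.2 + c.2))); last first.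
  by apply/funext => -[[a b] e]; case: c => -[].
apply: (@leb3_prod_map (fun p => (p.1 + c.1.1, p.2 + c.1.2)) (fun z => z + c.2)).
- apply: (@leb2_prod_map (fun u => u + c.1.1) (fun u => u + c.1.2));
    try exact: measurable_translate1; move=> A mA; exact: lebesgue_measure_translate.
- exact: measurable_translate1.
- by move=> A mA; exact: lebesgue_measure_translate.
Qed.

Lemma leb3_flip (a b c : bool) : preserving leb3 (fun x : borel3 R =>
  (((-1) ^+ a * x.1.1, (-1) ^+ b * x.1.2), (-1) ^+ c * x.2)).
Proof.
have ms (s : bool) : measurable_fun setT (fun x : mR => (-1) ^+ s * x : mR).
  exact: mulrl_measurable.
have sE (s : bool) A : measurable A -> mu ((fun x : mR => (-1) ^+ s * x : mR) @^-1` A) = mu A.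
  case: s => mA; last by congr (mu _); apply/seteqP; split => x /=; rewrite expr0 mul1r.
  rewrite -[RHS]lebesgue_measureN//; congr (mu _).
  by apply/seteqP; split => x /=; rewrite expr1 mulN1r.
apply: (@leb3_prod_map (fun p => ((-1) ^+ a * p.1, (-1) ^+ b * p.2)) (fun z => (-1) ^+ c * z)).
- by apply: (@leb2_prod_map (fun u => (-1) ^+ a * u) (fun u => (-1) ^+ b * u)) => // A; exact: sE.
- exact: ms.
- by move=> A; exact: sE.
Qed.

Lemma leb3_scale (k : {posnum R}) A : measurable A ->
  leb3 ((fun x : R3 R => k%:num *: x) @^-1` A) = ((k%:num^-1 ^+ 3)%:E * leb3 A)%E.
Proof.
move=> mA; pose S (x : mR) : mR := k%:num * x.
have mS : measurable_fun setT S by exact: mulrl_measurable.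
have SE B : measurable B -> mu (S @^-1` B) = ((k%:num^-1)%:pos%:num%:E * mu B)%E.
  exact: lebesgue_measure_scale.
have mS2 := measurable_prod_map mS mS.
have S2E B : measurable B -> mu2 ((fun p => (S p.1, S p.2)) @^-1` B) =
    ((k%:num^-1 * k%:num^-1)%:pos%:num%:E * mu2 B)%E.
  exact: (prod_scaled_pushforward mS mS SE SE).
have := prod_scaled_pushforward mS2 mS S2E SE mA; rewrite /=.
rewrite -expr2 -exprSr => H; exact: H.
Qed.

Lemma leb2_shear1 (a : R) : preserving leb2 (fun p : mR * mR => (p.1 + a * p.2, p.2)).
Proof.
have m1 : measurable_fun setT (fun p : mR * mR => (p.1 + a * p.2, p.2) : mR * mR) by meas.
split; first exact: m1.
move=> A mA; apply: (@yfiber_pushforward _ _ _ _ _ mu mu (fun v u => u + a * v) m1 _ A mA) => y B mB.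
exact: lebesgue_measure_translate.
Qed.

Lemma leb2_shear2 (a : R) : preserving leb2 (fun p : mR * mR => (p.1, p.2 + a * p.1)).
Proof.
have m1 : measurable_fun setT (fun p : mR * mR => (p.1, p.2 + a * p.1) : mR * mR) by meas.
split; first exact: m1.
move=> A mA; apply: (@xfiber_pushforward _ _ _ _ _ mu mu (fun v u => u + a * v) m1 _ A mA) => y B mB.
exact: lebesgue_measure_translate.
Qed.

Definition rot12 (c s : R) x : R3 R := (c * x.1.1 - s * x.1.2, s * x.1.1 + c * x.1.2, x.2).
Definition rot23 (c s : R) x : R3 R := (x.1.1, c * x.1.2 - s * x.2, s * x.1.2 + c * x.2).

(* A plane rotation is a product of three shears. *)
Lemma rot_shears (c s a b : R) : c ^+ 2 + s ^+ 2 = 1 -> 1 + c != 0 ->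
  let t := - (s / (1 + c)) in
  c * a - s * b = a + t * b + t * (b + s * (a + t * b)) /\
  s * a + c * b = b + s * (a + t * b).
Proof.
move=> cs c1 t.
have E : s * t = c - 1.
  rewrite /t mulrN mulrA -expr2; apply: (mulIf c1); rewrite mulNr mulfVK//.
  by rewrite (_ : s ^+ 2 = 1 - c ^+ 2); [ring|rewrite -cs; ring].
have tE : t * (1 + c) = - s by rewrite /t mulNr mulfVK//.
clearbody t; split.
  rewrite (_ : _ + _ + _ = a * (1 + s * t) + b * (t * (1 + c) + t * (s * t - (c - 1)))); last by ring.
  by rewrite tE E; ring.
by rewrite (_ : b + _ = s * a + b * (1 + s * t)); [rewrite E; ring|ring].
Qed.

(** The shear coefficient - s / (1 + c) is minus the tangent of half the angle, which is why the
    half-turn c = -1 is excluded. *)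
Lemma preserving_rot12 (c s : R) : c ^+ 2 + s ^+ 2 = 1 -> 1 + c != 0 ->
  preserving leb3 (rot12 c s : borel3 R -> borel3 R).
Proof.
move=> cs c1; set t := - (s / (1 + c)).
pose S := (fun p : mR * mR => (p.1 + t * p.2, p.2)) \o
  ((fun p : mR * mR => (p.1, p.2 + s * p.1)) \o (fun p : mR * mR => (p.1 + t * p.2, p.2))).
rewrite (_ : rot12 c s = fun p : borel3 R => (S p.1, p.2)); last first.
  apply/funext => -[[x y] z]; rewrite /rot12 /S/=.
  by have [<- <-] := rot_shears x y cs c1.
apply: (@leb3_prod_map S id) => //.
apply: preserving_comp; first exact: leb2_shear1.
by apply: preserving_comp; [exact: leb2_shear2|exact: leb2_shear1].
Qed.

(** The second and third coordinates sit at different levels of the iterated product, so these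
    shears are not products of maps: [S1] translates each horizontal plane by an amount depending on
    its height, [S2] translates each vertical line. *)
Lemma preserving_rot23 (c s : R) : c ^+ 2 + s ^+ 2 = 1 -> 1 + c != 0 ->
  preserving leb3 (rot23 c s : borel3 R -> borel3 R).
Proof.
move=> cs c1; set t := - (s / (1 + c)).
pose S1 a (p : borel3 R) : borel3 R := ((p.1.1, p.1.2 + a * p.2), p.2).
pose S2 a (p : borel3 R) : borel3 R := (p.1, p.2 + a * p.1.2).
have P1 a : preserving leb3 (S1 a).
  have m1 : measurable_fun setT (S1 a) by rewrite /S1; meas.
  split; first exact: m1.
  move=> A mA; apply: (@yfiber_pushforward _ _ _ _ _ mu2 mu
    (fun z p => (p.1, p.2 + a * z)) m1 _ A mA) => z B mB.
  have [_] := @leb2_prod_map id (fun u => u + a * z) (@measurable_id _ _ _) (measurable_translate1 _)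
    (fun A mA => erefl) (fun A mA => lebesgue_measure_translate _ mA).
  by move=> /(_ B mB).
have P2 a : preserving leb3 (S2 a).
  have m1 : measurable_fun setT (S2 a) by rewrite /S2; meas.
  split; first exact: m1.
  move=> A mA; apply: (@xfiber_pushforward _ _ _ _ _ mu2 mu
    (fun p z => z + a * p.2) m1 _ A mA) => z B mB.
  exact: lebesgue_measure_translate.
rewrite (_ : rot23 c s = S1 t \o (S2 s \o S1 t)); last first.
  apply/funext => -[[x y] z]; rewrite /rot23 /S1 /S2/=.
  by have [-> ->] := rot_shears y z cs c1.
apply: preserving_comp; first exact: P1.
by apply: preserving_comp; [exact: P2|exact: P1].
Qed.

End Invariance.

(** * Euclidean geometry and comparison with the sup norm *)

Section Geometry.
Context {R : realType}.
Implicit Types x y : R3 R.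

Let sqr_normr (a : R) : `|a| ^+ 2 = a ^+ 2.
Proof. by rewrite real_normK ?num_real. Qed.

Lemma dotC x y : dot x y = dot y x. Proof. by rewrite /dot; ring. Qed.

Lemma dotDl x y z : dot (x + y) z = dot x z + dot y z.
Proof. by case: x y z => -[? ?] ? [[? ?] ?] [[? ?] ?]; rewrite /dot/=; ring. Qed.

Lemma dotZl k x y : dot (k *: x) y = k * dot x y.
Proof.
case: x y => -[x1 x2] x3 [[y1 y2] y3]; rewrite /dot/=.
by rewrite /GRing.scale/=; ring.
Qed.

Lemma dot_ge0 x : 0 <= dot x x.
Proof. by rewrite /dot -!expr2 !addr_ge0// sqr_ge0. Qed.

Lemma enorm_ge0 x : 0 <= enorm x. Proof. exact: sqrtr_ge0. Qed.

Lemma sqr_enorm x : enorm x ^+ 2 = dot x x.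
Proof. by rewrite /enorm sqr_sqrtr// dot_ge0. Qed.

Lemma enormZ k x : enorm (k *: x) = `|k| * enorm x.
Proof.
by rewrite /enorm dotZl dotC dotZl mulrA -expr2 sqrtrM ?sqr_ge0// sqrtr_sqr.
Qed.

Lemma enormN x : enorm (- x) = enorm x.
Proof. by rewrite -scaleN1r enormZ normrN1 mul1r. Qed.

Lemma enorm0 : enorm (0 : R3 R) = 0.
Proof. by rewrite -(scale0r (0 : R3 R)) enormZ normr0 mul0r. Qed.

Lemma enorm_eq0 x : (enorm x == 0) = (x == 0).
Proof.
apply/idP/idP => [|/eqP->]; last by rewrite enorm0.
rewrite -sqrf_eq0 sqr_enorm /dot -!expr2 !paddr_eq0 ?addr_ge0 ?sqr_ge0// !sqrf_eq0.
by case: x => -[a b] c /= /andP[/andP[/eqP-> /eqP->] /eqP->].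
Qed.

Lemma enorm_gt0 x : (0 < enorm x) = (x != 0).
Proof. by rewrite lt_def enorm_eq0 enorm_ge0 andbT. Qed.

(** Lagrange's identity: |x|^2 |y|^2 - (x . y)^2 is the squared length of the cross product. *)
Lemma cauchy_schwarz x y : `|dot x y| <= enorm x * enorm y.
Proof.
rewrite -[leRHS]ger0_norm ?mulr_ge0 ?enorm_ge0//.
rewrite -ler_sqr ?nnegrE// !sqr_normr exprMn !sqr_enorm -subr_ge0.
rewrite (_ : _ - _ = dot (cross x y) (cross x y)) ?dot_ge0//.
by rewrite /dot /cross/=; ring.
Qed.

Lemma enormD x y : enorm (x + y) <= enorm x + enorm y.
Proof.
rewrite -ler_sqr ?nnegrE ?addr_ge0 ?enorm_ge0// sqr_enorm sqrrD !sqr_enorm.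
rewrite dotDl dotC dotDl (dotC y (x + y)) dotDl (dotC y x).
have := le_trans (ler_norm _) (cauchy_schwarz x y).
by rewrite -mulr_natr; lra.
Qed.

Lemma enormB x y : enorm (x - y) = enorm (y - x).
Proof. by rewrite -enormN opprB. Qed.

Lemma dist_enorm x y : `|enorm x - enorm y| <= enorm (x - y).
Proof.
have H (u v : R3 R) : enorm u - enorm v <= enorm (u - v).
  by rewrite lerBlDr -[X in enorm X <= _](subrK v) enormD.
by rewrite ler_norml H andbT lerNl opprB enormB H.
Qed.

Lemma coord_le_enorm x : [/\ `|x.1.1| <= enorm x, `|x.1.2| <= enorm x & `|x.2| <= enorm x].
Proof.
have H (a b : R) : 0 <= b -> a ^+ 2 <= b ^+ 2 -> `|a| <= b.
  by move=> b0 ab; rewrite -(ger0_norm b0) -ler_sqr ?nnegrE// !sqr_normr.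
split; apply: H; rewrite ?enorm_ge0// sqr_enorm /dot -!expr2;
  have := sqr_ge0 x.1.1; have := sqr_ge0 x.1.2; have := sqr_ge0 x.2; lra.
Qed.

Lemma norm_le_enorm x : `|x| <= enorm x.
Proof.
have [a b c] := coord_le_enorm x.
by rewrite !prod_normE/= !ge_max a b c.
Qed.

Lemma enorm_le_norm x : enorm x <= 3 * `|x|.
Proof.
have [a b c] : [/\ `|x.1.1| <= `|x|, `|x.1.2| <= `|x| & `|x.2| <= `|x|].
  by rewrite !prod_normE/= !le_max !lexx !orbT.
have H (u : R) : `|u| <= `|x| -> u * u <= `|x| ^+ 2.
  by move=> ux; rewrite -expr2 -sqr_normr ler_sqr ?nnegrE.
rewrite -[leRHS]ger0_norm ?mulr_ge0// -ler_sqr ?nnegrE ?enorm_ge0//.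
rewrite sqr_normr sqr_enorm exprMn /dot.
have := H _ a; have := H _ b; have := H _ c; have := sqr_ge0 `|x|; lra.
Qed.

Lemma continuous_enorm : continuous (@enorm R).
Proof.
move=> x; apply/cvgrPdist_lt => e e0.
have /cvgrPdist_lt/(_ _ (divr_gt0 e0 (ltr0n _ 3))) := @cvg_id _ (nbhs x).
apply: filterS => y xy; apply: le_lt_trans (dist_enorm x y) _.
apply: le_lt_trans (enorm_le_norm _) _.
by rewrite mulrC -ltr_pdivlMr.
Qed.

End Geometry.

Lemma measurable_lt d (X : measurableType d) (R : realType) (f g : X -> R) :
  measurable_fun setT f -> measurable_fun setT g -> measurable [set x | f x < g x].
Proof.
move=> mf mg; have m1 : measurable [set true] by [].
have := measurable_fun_ltr mf mg measurableT m1.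
by rewrite setTI; congr measurable; apply/seteqP; split => x /=.
Qed.

Lemma measurable_lt_indic d (X : measurableType d) (R : realType)
    (f g : X -> R) :
  measurable_fun setT f -> measurable_fun setT g ->
  measurable_fun setT (fun x => (f x < g x)%R%:R : R).
Proof.
move=> mf mg; rewrite (_ : (fun x => _) = \1_[set x | f x < g x]).
  by apply: measurable_indic; exact: measurable_lt.
by apply/funext => x; rewrite indicE; congr (nat_of_bool _)%:R;
  apply/idP/idP; rewrite inE.
Qed.

Ltac meas3 := repeat first [ progress meas | match goal with
  | |- measurable_fun _ (fun x => (_ *+ nat_of_bool _)%R) => apply: measurable_lt_indic
  | |- measurable_fun _ (fun x => enorm _) => apply: measurable_enorm
  | |- measurable_fun _ (@enorm _) => apply: measurable_enorm
  | |- measurable_fun _ (fun x => (_ ^-1)%R) => apply: measurable_inv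
  | |- measurable_fun _ (fun x => Num.sqrt _) => apply: measurable_sqrt
  | |- measurable_fun _ (fun x => (_ *: _)%R) => apply: measurable_scale3
  end ].

(** * Polar coordinates for nonnegative functions *)

Section Polar.
Context {R : realType}.
Notation mR := (measurableTypeR R).
Notation mu := (@lebesgue_measure R).
Implicit Types y : R3 R.

Lemma measurable_oball r : measurable (oball r : set (borel3 R)).
Proof. by apply: (@measurable_lt _ _ _ (@enorm R) (cst r)) => //; exact: measurable_enorm. Qed.

(** The origin is removed so that y / |y| is always a unit vector. *)
Definition pball : set (R3 R) := [set y | 0 < enorm y < 1].

Lemma measurable_pball : measurable (pball : set (borel3 R)).
Proof.
rewrite (_ : pball = [set y : borel3 R | 0 < enorm y] `&` oball 1).
  apply: measurableI; last exact: measurable_oball.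
  by apply: (@measurable_lt _ _ _ (cst 0) (@enorm R)) => //; exact: measurable_enorm.
by apply/seteqP; split => y /=; rewrite /pball/oball/= => /andP.
Qed.

Local Open Scope ereal_scope.

Lemma integral_indic_mul d (X : measurableType d) (m : {measure set X -> \bar R})
    (D : set X) (f : X -> \bar R) :
  \int[m]_(x in D) f x = \int[m]_x ((\1_D x)%:E * f x).
Proof.
rewrite integral_mkcond; apply: eq_integral => x _.
by rewrite /patch indicE; case: ifPn => _; rewrite ?mul1e ?mul0e.
Qed.

Lemma integral_scale1 (k : {posnum R}) (h : mR -> \bar R) : measurable_fun setT h ->
  \int[mu]_x h (k%:num * x)%R = (k%:num^-1)%:E * \int[mu]_x h x.
Proof.
move=> mh; apply: (@integral_scaled_pushforward _ _ _ _ _ mu mu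
  (fun x => k%:num * x)%R (k%:num^-1)%:nng%R) => //.
  exact: mulrl_measurable.
exact: lebesgue_measure_scale.
Qed.

Lemma integral_scale3 (k : {posnum R}) (h : borel3 R -> \bar R) : measurable_fun setT h ->
  \int[leb3]_x h (k%:num *: (x : R3 R)) = (k%:num^-1 ^+ 3)%:E * \int[leb3]_x h x.
Proof.
move=> mh; apply: (@integral_scaled_pushforward _ _ _ _ _ leb3 leb3
  (fun x : R3 R => k%:num *: x) (k%:num^-1 ^+ 3)%:nng%R) => //.
  exact: measurable_scale3.
exact: leb3_scale.
Qed.

Lemma R3_set1E (a : R3 R) : [set a] = ([set a.1.1] `*` [set a.1.2]) `*` [set a.2].
Proof.
apply/seteqP; split => [_ ->//|]; case: a => -[a1 a2] a3.
by move=> [[x y] z] [[/= -> ->] ->].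
Qed.

Lemma measurable_set1_R3 (a : R3 R) : measurable ([set a] : set (borel3 R)).
Proof.
by rewrite R3_set1E; apply: measurableX; first apply: measurableX; exact: measurable_set1.
Qed.

Lemma leb3_set1 (a : R3 R) : leb3 [set a] = 0.
Proof.
rewrite R3_set1E [LHS](@product_measure1E _ _ _ _ _ (@leb2sf R) mu)//.
  by rewrite [X in _ * X](_ : _ = 0) ?mule0//; exact: lebesgue_measure_set1.
by apply: measurableX; exact: measurable_set1.
Qed.

Lemma tonelli_leb3 (H : borel3 R * mR -> \bar R) :
  measurable_fun setT H -> (forall p, 0 <= H p) ->
  \int[leb3]_y \int[mu]_t H (y, t) = \int[mu]_t \int[leb3]_y H (y, t).
Proof. move=> mH H0; exact: (@fubini_tonelli _ _ _ _ _ (@leb3sf R) mu H mH H0). Qed.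

(** Supplies the normalisation of polar coordinates: |x|^3 times this tail at a = |x| is 1/3, which
    cancels the factor 3 there. *)
Lemma integral_tail4 (a : R) : (0 < a)%R ->
  \int[mu]_t ((a < t)%R%:R * t ^- 4)%:E = (a ^- 3 / 3)%:E.
Proof.
move=> a0.
have ge0 (x : R) : (a <= x)%R -> (0 < x)%R by exact: lt_le_trans.
have dF (x : R) : (a <= x)%R -> is_derive x 1%R (fun t : R => - (t ^- 3 / 3))%R (x ^- 4).
  move=> /ge0 x0; have xn0 : x != 0%R by rewrite gt_eqF.
  have x3 : (x ^+ 3 != 0)%R by rewrite expf_neq0.
  by apply: is_derive_eq; rewrite /GRing.scale/=; field.
transitivity (\int[mu]_(t in `[a, +oo[) (t ^- 4)%:E).
  rewrite -integral_itv_obnd_cbnd; last first.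
    apply/measurable_EFinP; apply: measurable_funTS.
    by apply: measurable_inv; exact: measurable_funX.
  rewrite [RHS]integral_indic_mul; apply: eq_integral => t _.
  rewrite EFinM; congr (_%:E * _); rewrite indicE; congr (nat_of_bool _)%:R.
  by apply/idP/idP; rewrite inE/= in_itv/= andbT.
have cf (x : R) : (a <= x)%R -> {for x, continuous (fun t : R => t ^- 4)%R}.
  move=> /ge0 x0; have xn0 : x != 0%R by rewrite gt_eqF.
  apply: (@continuous_comp _ _ _ (fun t : R => t ^+ 4)%R (@GRing.inv R)).
    exact: exprn_continuous.
  by apply: inv_continuous; rewrite expf_neq0.
rewrite (@ge0_continuous_FTC2y _ (fun t : R => t ^- 4)%R (fun t : R => - (t ^- 3 / 3))%R a 0%R).
- by rewrite sub0e -EFinN opprK.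
- by move=> x /ge0 x0; rewrite invr_ge0 exprn_ge0// ltW.
- apply: continuous_in_subspaceT => x; rewrite inE/= in_itv/= andbT; exact: cf.
- rewrite -[X in _ --> X]oppr0; apply: cvgN.
  rewrite -[X in _ --> X](mul0r 3^-1%R); apply: cvgMl.
  apply/gtr0_cvgV0; first by near=> x; rewrite exprn_gt0//; near: x; exact: nbhs_pinfty_gt.
  apply/cvgryPge => A; near=> x.
  have x1 : (1 <= x)%R by near: x; apply: nbhs_pinfty_ge; rewrite num_real.
  apply: (@le_trans _ _ x); first by near: x; apply: nbhs_pinfty_ge; rewrite num_real.
  by rewrite ler_eXnr// ler_wpDl.
- by move=> x /ltW /dF [].
- have /dF[+ _] := lexx a.
  by move=> /derivable1_diffP/differentiable_continuous/cvg_at_right_filter.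
- by move=> x; rewrite in_itv/= andbT => /ltW /dF d; rewrite derive1E derive_val.
Unshelve. all: by end_near. Qed.

(* Polar coordinates without angles: the direction of integration is that of a
   uniformly distributed point of the unit ball. *)
Theorem ge0_polar (f : borel3 R -> \bar R) :
  measurable_fun setT f -> (forall x, 0 <= f x) ->
  \int[leb3]_x f x = 3%:E * \int[leb3]_(y in pball)
    \int[mu]_(s in `]0%R, +oo[) ((s ^+ 2)%:E * f ((s / enorm y) *: (y : R3 R))%R).
Proof.
move=> mf f0.
(* Result of substituting s = |y| t in the radial integral: s^2 ds becomes |y|^3 t^2 dt, and the
   point (s / |y|) y becomes t y. *)
pose G (p : borel3 R * mR) : \bar R :=
  (((0 < enorm p.1)%R%:R * (enorm p.1 < 1)%R%:R * enorm p.1 ^+ 3 *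
     ((0 < p.2)%R%:R * p.2 ^+ 2))%R)%:E * f (p.2 *: (p.1 : R3 R))%R.
have mG : measurable_fun setT G.
  apply: emeasurable_funM; last first.
    by apply: measurableT_comp => //; meas3.
  by apply/measurable_EFinP; meas3.
have G0 p : 0 <= G p.
  apply: mule_ge0 => //; rewrite lee_fin.
  apply: mulr_ge0; apply: mulr_ge0; rewrite ?ler0n ?sqr_ge0//.
  by rewrite exprn_ge0 ?enorm_ge0.
have rhsE : \int[leb3]_(y in pball)
    \int[mu]_(s in `]0%R, +oo[) ((s ^+ 2)%:E * f ((s / enorm y) *: (y : R3 R))%R) =
    \int[leb3]_y \int[mu]_t G (y, t).
  rewrite integral_indic_mul; apply: eq_integral => y _.
  have [/[!inE]/= /andP[y0 y1]|yD] := boolP (y \in pball); last first.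
    rewrite indicE (negbTE yD) mul0e integral0_eq// => t _.
    rewrite /G/=; case: ltP => [y0|_]; last by rewrite !mul0r mul0e.
    case: ltP => [y1|_]; last by rewrite mulr0 !mul0r mul0e.
    by move: yD; rewrite notin_setE/= /pball/= y0 y1.
  rewrite indicE mem_set ?mul1e; last by rewrite /pball/= y0 y1.
  have yn0 : (enorm y != 0)%R by rewrite gt_eqF.
  pose h (s : mR) : \bar R := ((0 < s)%R%:R * s ^+ 2)%:E * f ((s / enorm y) *: (y : R3 R))%R.
  have mh : measurable_fun setT h.
    apply: emeasurable_funM.
      by apply/measurable_EFinP; meas3.
    by apply: measurableT_comp => //; meas3.
  transitivity (\int[mu]_s h s).
    rewrite [LHS]integral_indic_mul; apply: eq_integral => s _.
    rewrite /h (EFinM (0 < s)%R%:R) -[RHS]muleA; congr (_%:E * _); rewrite indicE; congr (nat_of_bool _)%:R.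
    by apply/idP/idP; rewrite inE/= in_itv/= andbT.
  have := @integral_scale1 (PosNum y0) h mh; rewrite /= => E.
  have -> : \int[mu]_s h s = (enorm y)%:E * \int[mu]_s h (enorm y * s)%R.
    by rewrite E muleA -EFinM divff// mul1e.
  rewrite -ge0_integralZl//; last 3 first.
  - by apply: (measurableT_comp mh); exact: mulrl_measurable.
  - by move=> s _; rewrite mule_ge0// lee_fin mulr_ge0// sqr_ge0.
  - by rewrite lee_fin ltW.
  apply: eq_integral => t _; rewrite /h /G/= y0 y1 muleA -EFinM pmulr_rgt0// ?mulr1n !mul1r.
  by congr ((_ : R)%:E * f (_ *: _)%R); [ring|field].
rewrite rhsE (tonelli_leb3 mG G0).
(* Result of substituting x = t y in space for fixed t > 0: the condition |y| < 1 becomes |x| < t,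
   and |y|^3 t^2 times the Jacobian t^-3 is |x|^3 t^-4. What remains to integrate in t is the tail
   of t^-4. *)
pose K (p : borel3 R * mR) : \bar R :=
  (((0 < enorm p.1)%R%:R * enorm p.1 ^+ 3)%R%:E * f p.1) *
  ((enorm p.1 < p.2)%R%:R * p.2 ^- 4)%R%:E.
have mK : measurable_fun setT K.
  apply: emeasurable_funM; last by apply/measurable_EFinP; meas3.
  apply: emeasurable_funM; first by apply/measurable_EFinP; meas3.
  by apply: measurableT_comp => //; meas.
have K0 p : 0 <= K p.
  rewrite /K; apply: mule_ge0; last first.
    rewrite lee_fin; apply: mulr_ge0; first exact: ler0n.
    by rewrite invr_ge0; exact: exprn_even_ge0.
  apply: mule_ge0; last exact: f0.
  rewrite lee_fin; apply: mulr_ge0; first exact: ler0n.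
  by apply: exprn_ge0; exact: enorm_ge0.
have -> : \int[mu]_t \int[leb3]_y G (y, t) = \int[mu]_t \int[leb3]_y K (y, t).
  apply: eq_integral => t _.
  have [t0|t0] := ltP 0%R t; last first.
    transitivity (0 : \bar R); first rewrite integral0_eq; last rewrite integral0_eq.
    - by [].
    - by move=> y _; rewrite /G/= (le_gtF t0) mul0r mulr0 mul0e.
    - by [].
    - by move=> y _; rewrite /K/= (le_gtF (le_trans t0 (enorm_ge0 _))) mul0r mule0.
  have tn0 : (t != 0)%R by rewrite gt_eqF.
  pose h (x : borel3 R) := (t ^+ 3)%:E * K (x, t).
  have mKt : measurable_fun setT (fun x => K (x, t)).
    by apply: (measurableT_comp mK); apply: measurable_fun_pair;
      [exact: measurable_id|exact: measurable_cst].
  have mh : measurable_fun setT h.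
    by apply: emeasurable_funM; [exact: measurable_cst|exact: mKt].
  have E := @integral_scale3 (PosNum t0) h mh.
  transitivity (\int[leb3]_x h (t *: (x : R3 R))%R).
    apply: eq_integral => y _; rewrite /h /G /K/=.
    rewrite enormZ (gtr0_norm t0) (pmulr_rgt0 _ t0) t0 (gtr_pMr _ t0) exprMn.
    rewrite [X in _ = _ * X]muleC !muleA -!EFinM.
    by congr ((_ : R)%:E * _); rewrite /= mulr1n; field.
  rewrite E ge0_integralZl.
  - have t3 : (t^-1 ^+ 3 * t ^+ 3 = 1)%R.
    rewrite -exprMn.
    rewrite (mulVf tn0).
    exact: expr1n.
    rewrite muleA.
    rewrite -EFinM.
    rewrite [X in X%:E * _]t3.
    rewrite mul1e.
    reflexivity.
  - exact: measurableT.
  - exact: mKt.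
  - by move=> y _; exact: K0.
  - by rewrite lee_fin; apply: exprn_ge0; exact: ltW.
rewrite -(tonelli_leb3 mK K0) -ge0_integralZl; last 4 first.
- exact: measurableT.
- exact: (measurable_fun_fubini_tonelli_F (m2 := mu) K mK K0).
- by move=> y _; apply: integral_ge0 => t _; exact: K0.
- by rewrite lee_fin.
(* The t-integral of K returns a third of f at every point except the origin, which is a null
   set. *)
apply: ae_eq_integral.
- exact: measurableT.
- exact: mf.
- apply: emeasurable_funM; first exact: measurable_cst.
  exact: (measurable_fun_fubini_tonelli_F (m2 := mu) K mK K0).
exists [set 0%R]; split; [exact: measurable_set1_R3|exact: leb3_set1|].
move=> x /= /not_implyP[_] H; apply: contrapT => x0; apply: H.
have xp : (0 < enorm x)%R by rewrite enorm_gt0; apply/eqP.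
have xn : (enorm x != 0)%R by rewrite gt_eqF.
rewrite /K/= xp ge0_integralZl; last 4 first.
- exact: measurableT.
- by apply/measurable_EFinP; meas3.
- move=> t _; rewrite lee_fin; apply: mulr_ge0; first exact: ler0n.
  by rewrite invr_ge0; exact: exprn_even_ge0.
- apply: mule_ge0; last exact: f0.
  rewrite lee_fin; apply: mulr_ge0; first by rewrite ?mulr1n ler01.
  by apply: exprn_ge0; exact: enorm_ge0.
rewrite (integral_tail4 xp) [X in _ = _ * X]muleC !muleA -!EFinM.
rewrite [X in X%:E * _](_ : _ = 1)%R; first by rewrite mul1e.
by rewrite mulr1n; field.
Qed.

End Polar.

(** * Polar coordinates for integrable functions *)

Section Signed_polar.
Context {R : realType}.
Notation mR := (measurableTypeR R).
Notation mu := (@lebesgue_measure R).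
Implicit Types y : R3 R.

(** Together with [polar_point] this writes polar coordinates as one integral over the product of
    directions and radii, so that Fubini's theorem gives both orders of integration, [polar12] and
    [polar21]. *)
Definition polar_weight (p : borel3 R * mR) : R := \1_pball p.1 * ((0 < p.2)%R%:R * p.2 ^+ 2).

Definition polar_point (p : borel3 R * mR) : borel3 R := (p.2 / enorm p.1) *: (p.1 : R3 R).

Lemma measurable_polar_weight : measurable_fun setT polar_weight.
Proof.
apply: measurable_funM; last by meas3.
apply: measurableT_comp; last by meas.
by apply: measurable_indic; exact: measurable_pball.
Qed.

Lemma measurable_polar_point : measurable_fun setT polar_point.
Proof. by rewrite /polar_point; meas3. Qed.

Lemma polar_weight_ge0 p : 0 <= polar_weight p.
Proof.
rewrite /polar_weight; apply: mulr_ge0; first exact: ler0n.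
by apply: mulr_ge0; [exact: ler0n|exact: sqr_ge0].
Qed.

Local Open Scope ereal_scope.

Lemma polar_innerE (f : borel3 R -> \bar R) y :
  \int[mu]_t ((polar_weight (y, t))%:E * f (polar_point (y, t))) =
  (\1_pball y)%:E * \int[mu]_(s in `]0%R, +oo[)
    ((s ^+ 2)%:E * f ((s / enorm y) *: (y : R3 R))%R).
Proof.
have [yp|yp] := boolP (y \in pball).
  rewrite indicE yp mul1e [RHS]integral_indic_mul; apply: eq_integral => t _.
  rewrite /polar_weight /= indicE yp mul1r (EFinM (0 < t)%R%:R) -[LHS]muleA.
  congr (_%:E * _); rewrite indicE; congr (nat_of_bool _)%:R.
  by apply/idP/idP; rewrite inE/= in_itv/= andbT.
rewrite indicE (negbTE yp) mul0e integral0_eq; first by [].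
by move=> t _; rewrite /polar_weight/= indicE (negbTE yp) mul0r mul0e.
Qed.

Lemma measurable_polar_fun (f : borel3 R -> \bar R) : measurable_fun setT f ->
  measurable_fun setT (fun p => (polar_weight p)%:E * f (polar_point p)).
Proof.
move=> mf; apply: emeasurable_funM.
  by apply/measurable_EFinP; exact: measurable_polar_weight.
by apply: (measurableT_comp mf); exact: measurable_polar_point.
Qed.

Lemma ge0_polar_prod (f : borel3 R -> \bar R) :
  measurable_fun setT f -> (forall x, 0 <= f x) ->
  \int[leb3]_x f x =
  3%:E * \int[leb3sf \x mu]_p ((polar_weight p)%:E * f (polar_point p)).
Proof.
move=> mf f0; rewrite (ge0_polar mf f0); congr (_ * _).
have H0 p : 0 <= (polar_weight p)%:E * f (polar_point p).
  by apply: mule_ge0; [rewrite lee_fin; exact: polar_weight_ge0|exact: f0].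
rewrite (fubini_tonelli1 (m1 := leb3sf) (m2 := mu) _ (measurable_polar_fun mf) H0).
rewrite [LHS]integral_indic_mul; apply: eq_integral => y _.
by rewrite /fubini_F polar_innerE.
Qed.

Lemma integrable_polar (g : borel3 R -> R) :
  leb3.-integrable setT (EFin \o g) ->
  (leb3sf \x mu).-integrable setT
    (fun p => (polar_weight p * g (polar_point p))%:E).
Proof.
move=> /integrableP[mg ig].
have E p : (polar_weight p * g (polar_point p))%:E =
    (polar_weight p)%:E * (EFin \o g) (polar_point p) by [].
apply/integrableP; split.
  by under eq_fun do rewrite E; exact: measurable_polar_fun.
have := @ge0_polar_prod (abse \o (EFin \o g)) (measurableT_comp (@abse_measurable R setT) mg)
   (fun x => abse_ge0 _).
move=> H; move: ig; rewrite [X in X < _]H.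
set J := (X in _ * X); rewrite (_ : \int[_]_p _ = J); last first.
  apply: eq_integral => p _; rewrite EFinM abseM; congr (_ * _).
  by rewrite gee0_abs// lee_fin; exact: polar_weight_ge0.
have : 0 <= J.
  apply: integral_ge0 => p _; apply: mule_ge0; last exact: abse_ge0.
  by rewrite lee_fin; exact: polar_weight_ge0.
by case: J => [r _ _|_|//]; [exact: ltry|rewrite gt0_muley].
Qed.

Lemma polar_prod (g : borel3 R -> R) :
  leb3.-integrable setT (EFin \o g) ->
  \int[leb3]_x (g x)%:E =
  3%:E * \int[leb3sf \x mu]_p (polar_weight p * g (polar_point p))%:E.
Proof.
move=> ig; have ip := integrable_polar ig.
move/integrableP : (ig) => [mg _].
rewrite [LHS]integralE [in RHS]integralE.
have pE p : (fun p => (polar_weight p * g (polar_point p))%:E)^\+ p =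
    (polar_weight p)%:E * (EFin \o g)^\+ (polar_point p).
  rewrite !funeposE /= EFinM; have := polar_weight_ge0 p; rewrite -lee_fin.
  by move=> w0; rewrite maxe_pMr// mule0.
have nE p : (fun p => (polar_weight p * g (polar_point p))%:E)^\- p =
    (polar_weight p)%:E * (EFin \o g)^\- (polar_point p).
  rewrite !funenegE /= -mulrN (EFinM (polar_weight p)); have := polar_weight_ge0 p; rewrite -lee_fin.
  by move=> w0; rewrite maxe_pMr// mule0.
under [X in 3%:E * (X - _)]eq_integral do rewrite pE.
under [X in 3%:E * (_ - X)]eq_integral do rewrite nE.
rewrite -/((EFin \o g)^\+) -/((EFin \o g)^\-).
rewrite [X in X - _ = _](ge0_polar_prod (measurable_funepos mg) (funepos_ge0 _)).
rewrite [X in _ - X = _](ge0_polar_prod (measurable_funeneg mg) (funeneg_ge0 _)).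
rewrite [RHS]muleBr; [by []|by []|].
have := integrable_pos_fin_num measurableT ip.
under eq_integral do rewrite pE.
move=> fp; exact: fin_num_adde_defr.
Qed.

Lemma polar12 (g : borel3 R -> R) :
  leb3.-integrable setT (EFin \o g) ->
  \int[leb3]_x (g x)%:E = 3%:E * \int[leb3]_(y in pball)
    \int[mu]_(s in `]0%R, +oo[) (s ^+ 2 * g ((s / enorm y) *: (y : R3 R)))%:E.
Proof.
move=> ig; rewrite polar_prod//; congr (_ * _).
rewrite -[LHS](integral12_prod_meas1 (integrable_polar ig)).
rewrite [RHS]integral_indic_mul; apply: eq_integral => y _.
by rewrite /fubini_F -(polar_innerE (EFin \o g)).
Qed.

Lemma polar21 (g : borel3 R -> R) :
  leb3.-integrable setT (EFin \o g) ->
  \int[leb3]_x (g x)%:E = 3%:E * \int[mu]_(s in `]0%R, +oo[)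
    \int[leb3]_(y in pball) (s ^+ 2 * g ((s / enorm y) *: (y : R3 R)))%:E.
Proof.
move=> ig; rewrite polar_prod//; congr (_ * _).
rewrite -[LHS](integral21_prod_meas1 (integrable_polar ig)).
rewrite [RHS]integral_indic_mul; apply: eq_integral => s _.
have [s0|s0] := boolP (s \in (`]0%R, +oo[%classic : set R)); rewrite indicE.
  rewrite s0 mul1e [RHS]integral_indic_mul; apply: eq_integral => y _.
  move: s0; rewrite inE/= in_itv/= andbT => s0.
  by rewrite /polar_weight /= s0 mulr1n mul1r -mulrA EFinM.
rewrite (negbTE s0) mul0e; apply: integral0_eq => y _.
move: s0; rewrite notin_setE/= in_itv/= andbT => /negP/negbTE s0.
by rewrite /polar_weight /= s0 mul0r mulr0 mul0r.
Qed.

End Signed_polar.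

(** * Null spheres and integrability of bounded functions with bounded support *)

Section Bounded_support.
Context {R : realType}.
Notation mR := (measurableTypeR R).
Notation mu := (@lebesgue_measure R).
Implicit Types x y : R3 R.
Local Open Scope ereal_scope.

(** In polar coordinates every ray meets the sphere in at most one point of positive radius. *)
Lemma leb3_sphere0 (r : R) : leb3 [set x | enorm x = r] = 0.
Proof.
have mS : measurable ([set x | enorm x = r] : set (borel3 R)).
  have := @measurable_enorm R _ (borel3 R) id (@measurable_id _ _ _).
  by move=> /(_ measurableT [set r]); rewrite setTI; apply; exact: measurable_set1.
rewrite -(setIT [set x | _]) -integral_indic//.
rewrite ge0_polar; last 2 first.
- by apply/measurable_EFinP; exact: measurable_indic.
- by move=> x; rewrite lee_fin.
rewrite integral0_eq ?mule0// => y /andP[y0 y1].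
transitivity (\int[mu]_(s in [set r]) ((0 < s)%R%:R * s ^+ 2)%:E); last exact: integral_set1.
rewrite [LHS]integral_indic_mul [RHS]integral_indic_mul; apply: eq_integral => s _.
rewrite !indicE.
have [s0|s0] := boolP (s \in `]0%R, +oo[%classic); last first.
  move: s0; rewrite notin_setE/= in_itv/= andbT => /negP/negbTE ->.
  by rewrite mul0e mul0r mule0.
move: s0; rewrite inE/= in_itv/= andbT => s0; rewrite s0 mul1e mulr1n mul1r muleC.
congr (_%:E * _); congr (nat_of_bool _)%:R.
have E : enorm ((s / enorm y) *: y)%R = s.
  rewrite enormZ ger0_norm ?divr_ge0 ?ltW//.
  by rewrite divfK// gt_eqF.
by apply/idP/idP; rewrite !inE/= E.
Qed.

Lemma leb3_oball_lty (r : R) : leb3 (oball r) < +oo.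
Proof.
have [r0|r0] := leP r 0%R.
  rewrite (_ : oball r = set0) ?measure0 ?ltry//.
  apply/seteqP; split => x //=; rewrite /oball/=.
  by move=> /lt_le_trans /(_ r0); rewrite ltNge enorm_ge0.
pose I : set mR := `[(- r)%R, r]%classic.
have mI : measurable I by exact: measurable_itv.
apply: (@le_lt_trans _ _ (leb3 ((I `*` I) `*` I))).
  apply: le_measure; rewrite ?inE; [exact: measurable_oball| |].
    by apply: measurableX => //; exact: measurableX.
  move=> x; rewrite /oball/= => /ltW xr; have [a b c] := coord_le_enorm x.
  have H (u : R) : (`|u| <= enorm x)%R -> I u.
    by move=> ux; rewrite /I/= in_itv/= -ler_norml (le_trans ux).
  by split; [split|]; exact: H.
rewrite [X in X < _](@product_measure1E _ _ _ _ _ (@leb2sf R) mu)//; last exact: measurableX.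
rewrite [X in X * _ < _](@product_measure1E _ _ _ _ _ mu mu)//.
have muI : mu I = (r *+ 2)%:E.
  by rewrite /I lebesgue_measure_itv/= lte_fin gtrN// -EFinB opprK -mulr2n.
apply: (@le_lt_trans _ _ ((r *+ 2)%:E * (r *+ 2)%:E * (r *+ 2)%:E)).
  by rewrite le_eqVlt; apply/orP; left; apply/eqP; congr (_ * _ * _); exact: muI.
by rewrite -!EFinM ltry.
Qed.

Lemma integrable_bounded_support (f : borel3 R -> R) (C M : R) :
  measurable_fun setT f -> (forall x, (`|f x| <= C)%R) ->
  (forall x, (M <= enorm x)%R -> f x = 0%R) ->
  leb3.-integrable setT (EFin \o f).
Proof.
move=> mf fC fM.
have iI : leb3.-integrable setT (fun x => C%:E * (\1_(oball M) x)%:E).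
  apply: integrableZl => //.
  apply/integrableP; split.
    by apply/measurable_EFinP; apply: measurable_indic; exact: measurable_oball.
  under eq_integral do rewrite gee0_abs ?lee_fin//.
  by rewrite integral_indic ?setIT; [exact: leb3_oball_lty| |exact: measurable_oball].
apply: (le_integrable measurableT _ _ iI).
  exact/measurable_EFinP.
move=> x _; rewrite -EFinM !abse_EFin lee_fin indicE.
  have [xM|xM] := boolP (x \in oball M).
    by rewrite mulr1 (le_trans (fC x))// ler_norm.
  rewrite mulr0 normr0 fM ?normr0//.
  by move: xM; rewrite notin_setE/= /oball/= => /negP; rewrite -leNgt.
Qed.

Lemma ae_off_null (N : set (borel3 R)) (P : R3 R -> Prop) :
  measurable N -> leb3 N = 0 -> (forall x, ~ N x -> P x) -> {ae leb3, forall x, P x}.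
Proof.
move=> mN N0 NP; exists N; split => // x /= nP; apply: contrapT => nN.
by apply: nP; exact: NP.
Qed.

End Bounded_support.

(** * Directional derivatives along lines *)

Section Lines.
Context {R : realType}.
Implicit Types x v : R3 R.

Lemma is_derive_line {V : normedModType R} (f : R3 R -> V) x v (t : R) (df : V) :
  is_derive (x + t *: v) v f df -> is_derive t (1 : R) (fun t => f (x + t *: v)) df.
Proof.
move=> [dv <-].
have E : (fun h : R => h^-1 *: ((fun t => f (x + t *: v)) (h *: (1 : R) + t) - f (x + t *: v))) =
         (fun h => h^-1 *: (f (h *: v + (x + t *: v)) - f (x + t *: v))).
  apply/funext => h; congr (_ *: (f _ - _)).
  by rewrite [h *: 1]mulr1 scalerDl addrCA.
split; first by rewrite /derivable E.
by rewrite /derive E.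
Qed.

Lemma derivable_line_continuous (f : R3 R -> R) x v (t : R) :
  derivable f (x + t *: v) v -> {for t, continuous (fun s : R => f (x + s *: v))}.
Proof.
move=> /derivableP/is_derive_line[d _].
by apply/differentiable_continuous/derivable1_diffP.
Qed.

Lemma line_MVT (f : R3 R -> R) x v (t : R) : 0 <= t ->
  (forall y, derivable f y v) ->
  exists2 s, 0 <= s <= t & f (x + t *: v) - f x = 'D_v f (x + s *: v) * t.
Proof.
move=> t0 df.
have d (s : R) : is_derive s (1:R) (fun t => f (x + t *: v)) ('D_v f (x + s *: v)).
  by apply: is_derive_line; exact: derivableP.
have [|s] := @MVT_segment R (fun t => f (x + t *: v)) (fun s => 'D_v f (x + s *: v)) 0 t t0 (fun s _ => d s).
  apply: continuous_subspaceT => s; exact: derivable_line_continuous.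
by rewrite in_itv/= scale0r addr0 subr0 => st E; exists s.
Qed.

Lemma line_MVT_abs (f : R3 R -> R) x v (t : R) :
  (forall y, derivable f y v) ->
  exists2 s, `|s| <= `|t| & f (x + t *: v) - f x = 'D_v f (x + s *: v) * t.
Proof.
move=> df; have [t0|t0] := leP 0 t.
  have [s /andP[s0 st] E] := line_MVT x t0 df.
  by exists s => //; rewrite !ger0_norm.
have t0' : 0 <= - t by rewrite oppr_ge0 ltW.
have [s /andP[s0 st] E] := line_MVT (x + t *: v) t0' df.
exists (t + s).
  rewrite (ltr0_norm t0) ler_norml; apply/andP; split; lra.
move: E; rewrite scaleNr addrK -addrA -scalerDl => E.
by rewrite -opprB E mulrN opprK.
Qed.

Lemma R3_ext x v : x.1.1 = v.1.1 -> x.1.2 = v.1.2 -> x.2 = v.2 -> x = v.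
Proof. by case: x v => -[? ?] ? [[? ?] ?] /= -> -> ->. Qed.

(** Smoothness is phrased through directional derivatives, so linearity in the direction has to be
    derived. The increment along v is split into three increments along the axes; each is handled by
    the mean value theorem and the continuity of one partial derivative. *)
Lemma derive_dot (f : R3 R -> R) x v :
  (forall y w, derivable f y w) -> (forall w, continuous ('D_w f)) ->
  'D_v f x = v.1.1 * 'D_e1 f x + v.1.2 * 'D_e2 f x + v.2 * 'D_e3 f x.
Proof.
move=> df cf.
(* The base point p h of the increment is allowed to move, since the second and third increments do
   not start at x. *)
have step (w : R3 R) (a : R) (p : R -> R3 R) : p t @[t --> (0:R)] --> x ->
    (fun h : R => h^-1 * (f (p h + (h * a) *: w) - f (p h))) @ (0:R)^' --> a * 'D_w f x.
  move=> px; apply/cvgrPdist_lt => e e0.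
  have ae : 0 < e / (`|a| + 1) by rewrite divr_gt0// ltr_wpDl.
  have /cvgrPdist_lt/(_ _ ae) := cf w x.
  rewrite near_simpl => /nbhs_ballP[d/= d0 dB].
  have d2 : 0 < d / 2 by rewrite divr_gt0.
  have H1 : \forall h \near (0:R)^', ball x (d / 2) (p h).
    by apply: nbhs_dnbhs; apply: px; exact: nbhsx_ballx.
  have H2 : \forall h \near (0:R)^', `|h : R| < d / 2 / (`|a| * `|w| + 1).
    apply: nbhs_dnbhs; have : 0 < d / 2 / (`|a| * `|w| + 1).
      by rewrite divr_gt0// ltr_wpDl// mulr_ge0.
    by move=> /(@nbhsx_ballx _ _ (0:R)); apply: filterS => h; rewrite -ball_normE/= sub0r normrN.
  have H3 : \forall h \near (0:R)^', h != 0 by exact: nbhs_dnbhs_neq.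
  near=> h.
  have h0 : h != 0 by near: h.
  have h1 : `|x - p h| < d / 2 by near: h; move: H1; apply: filterS => h; rewrite -ball_normE.
  have h2 : `|h| < d / 2 / (`|a| * `|w| + 1) by near: h.
  have [s sh ->] := line_MVT_abs (p h) (h * a) (fun y => df y w).
  rewrite mulrCA mulKf// mulrC -mulrBl normrM.
  have xs : ball x d (p h + s *: w).
    rewrite -ball_normE/= opprD addrA; apply: (le_lt_trans (ler_normB _ _)).
    rewrite (splitr d) ltrD// normrZ (le_lt_trans (ler_wpM2r _ sh))// normrM -mulrA.
    rewrite ltr_pdivlMr in h2; last by rewrite ltr_wpDl// mulr_ge0.
    by apply: le_lt_trans h2; rewrite mulrDr lerDl mulr1.
  have := dB _ xs => /= H.
  apply: (@le_lt_trans _ _ (e / (`|a| + 1) * `|a|)); first by rewrite ler_wpM2r// ltW.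
  by rewrite mulrAC ltr_pdivrMr ?ltr_wpDl// ltr_pM2l// ltrDl.
have cvg0 (g : R -> R3 R) : {for 0, continuous g} -> g 0 = 0 -> x + g t @[t --> (0:R)] --> x.
  move=> cg g0; rewrite -[X in _ --> X](addr0 x) -g0; apply: cvgD; [exact: cvg_cst|exact: cg].
have cl (a : R) (w : R3 R) : {for (0:R), continuous (fun h : R => (h * a) *: w)}.
  by apply: cvgZl; apply: cvgMl; exact: cvg_id.
have s1 : h^-1 * (f (x + (h * v.1.1) *: e1) - f x) @[h --> (0:R)^'] --> v.1.1 * 'D_e1 f x.
  by apply: (step e1 v.1.1 (fun=> x)); exact: cvg_cst.
have z (a : R) (w : R3 R) : (0 * a) *: w = 0 by rewrite mul0r scale0r.
have s2 := step e2 v.1.2 (fun h => x + (h * v.1.1) *: e1) (cvg0 _ (cl _ _) (z _ _)).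
have s3 : h^-1 *
    (f (x + ((h * v.1.1) *: e1 + (h * v.1.2) *: e2) + (h * v.2) *: e3) -
     f (x + ((h * v.1.1) *: e1 + (h * v.1.2) *: e2))) @[h --> (0:R)^'] --> v.2 * 'D_e3 f x.
  apply: step; apply: cvg0; last by rewrite !z addr0.
  by apply: cvgD; exact: cl.
have S := cvgD (cvgD s1 s2) s3.
have [d _] := derivableP (df x v).
apply: (@cvg_unique _ _ ((fun h : R => h^-1 *: (f (h *: v + x) - f x)) @ 0^')).
- exact: norm_hausdorff.
- exact: d.
rewrite (_ : (fun h : R => _) = (fun h : R => h^-1 * (f (x + (h * v.1.1) *: e1) - f x) +
   h^-1 * (f (x + (h * v.1.1) *: e1 + (h * v.1.2) *: e2) - f (x + (h * v.1.1) *: e1)) +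
   h^-1 * (f (x + ((h * v.1.1) *: e1 + (h * v.1.2) *: e2) + (h * v.2) *: e3) -
     f (x + ((h * v.1.1) *: e1 + (h * v.1.2) *: e2))))).
  exact: S.
apply/funext => h; rewrite -!mulrDr !(addrA x).
have A (a b c e : R) : (a - e) + (b - a) + (c - b) = c - e by ring.
rewrite A -!addrA; congr (_ * (f _ - f x)).
rewrite addrC; congr (_ + _).
apply: R3_ext.
- rewrite -[LHS]/(h * v.1.1) -[RHS]/(h * v.1.1 * 1 + (h * v.1.2 * 0 + h * v.2 * 0)); ring.
- rewrite -[LHS]/(h * v.1.2) -[RHS]/(h * v.1.1 * 0 + (h * v.1.2 * 1 + h * v.2 * 0)); ring.
- rewrite -[LHS]/(h * v.2) -[RHS]/(h * v.1.1 * 0 + (h * v.1.2 * 0 + h * v.2 * 1)); ring.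
Unshelve. all: by end_near. Qed.

End Lines.

(** * Integrals of directional derivatives *)

Section Vanishing_derivative.
Context {R : realType}.
Notation mR := (measurableTypeR R).
Implicit Types x y v : R3 R.

Definition vanish (M : R) (f : R3 R -> R) := forall x, M <= enorm x -> f x = 0.

(** A point with |x| = M may have points nearby where f is nonzero; enlarging the radius by 1 leaves
    a whole neighbourhood on which f is 0. *)
Lemma vanish_derive M v (f : R3 R -> R) : vanish M f -> vanish (M + 1) ('D_v f).
Proof.
move=> fM x xM; rewrite (@near_eq_derive _ _ _ f (cst 0) x v).
- exact: derive_cst.
- near=> z; apply: fM.
  have : enorm (x - z) < 1.
    apply: (le_lt_trans (enorm_le_norm _)).
    suff : `|x - z| < 3^-1 by rewrite -(ltr_pM2l (ltr0n _ 3)) mulfV.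
    near: z; apply: cvgr_dist_lt => //; exact: cvg_id.
  have := dist_enorm x z; have := ler_norm (enorm x - enorm z); lra.
Unshelve. all: by end_near. Qed.

Lemma vanish_bounded M f : continuous f -> vanish M f ->
  exists2 C, 0 <= C & forall x, `|f x| <= C.
Proof.
move=> cf fM; pose K : set (R3 R) := (`[- M, M] `*` `[- M, M]) `*` `[- M, M].
have cK : compact K.
  by apply: compact_setX; first apply: compact_setX; exact: segment_compact.
have [K0|/set0P K0] := eqVneq K set0.
  exists 0 => // x; rewrite fM ?normr0//.
  rewrite leNgt; apply/negP => xM.
  suff : K x by rewrite K0.
  have [a b c] := coord_le_enorm x.
  by split; [split|]; rewrite /= in_itv/= -ler_norml; apply: le_trans (ltW xM).
have [|x0 _ H] := @compact_EVT_max _ R (fun x => `|f x|) K K0 cK.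
  by apply: continuous_subspaceT => x; apply: cvg_norm; exact: cf.
exists `|f x0| => // x; have [xM|xM] := leP M (enorm x).
  by rewrite fM// normr0.
apply: H; rewrite inE.
have [a b c] := coord_le_enorm x.
by split; [split|]; rewrite /= in_itv/= -ler_norml; apply: le_trans (ltW xM).
Qed.

Lemma continuous_vanish_integrable M f : continuous f -> vanish M f ->
  leb3.-integrable setT (fun x : borel3 R => (f x)%:E).
Proof.
move=> cf fM; have [C _ fC] := vanish_bounded cf fM.
apply: (@integrable_bounded_support _ f C M) => //.
exact: continuous_measurable_R3.
Qed.

(** By translation invariance every difference quotient of G along e has integral 0, and dominated
    convergence along the steps 1 / (n + 1) passes to the derivative. The Lipschitz bound provides
    the dominating function, and the null set N leaves room for the kink of the shell potential. *)
Lemma integral_derive_eq0 (G g : R3 R -> R) (e : R3 R) (L M : R) (N : set (borel3 R)) :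
  continuous G -> vanish M G -> 0 <= L ->
  (forall x t, 0 <= t <= 1 -> `|G (x + t *: e) - G x| <= L * t) ->
  measurable N -> leb3 N = 0%E -> (forall x, ~ N x -> is_derive x e G (g x)) ->
  measurable_fun setT (g : borel3 R -> R) ->
  leb3.-integrable setT (fun x : borel3 R => (g x)%:E) /\
  (\int[leb3]_x (g x)%:E = 0)%E.
Proof.
move=> cG GM L0 GL mN N0 dG mg.
pose t n : R := n.+1%:R^-1.
have t0 n : 0 < t n by rewrite invr_gt0.
have t1 n : t n <= 1 by rewrite invf_le1// ler1n.
pose T n (x : borel3 R) : borel3 R := (x : R3 R) + t n *: e.
have PT n : preserving leb3 (T n) by exact: leb3_translate.
have iG := continuous_vanish_integrable cG GM.
have mG : measurable_fun setT (G : borel3 R -> R) by exact: continuous_measurable_R3.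
have vT n : vanish (M + enorm e) (fun x => G (T n x)).
  move=> x xM; apply: GM; rewrite /T.
  have : enorm x <= enorm (x + t n *: e) + enorm (t n *: e).
    by rewrite -[X in enorm X <= _](addrK (t n *: e)) -(enormN (t n *: e)) enormD.
  rewrite enormZ gtr0_norm//.
  have : t n * enorm e <= enorm e by rewrite ler_piMl// enorm_ge0.
  lra.
have cT n : continuous (fun x : R3 R => G (T n x)).
  move=> x; apply: (@continuous_comp _ _ _ (fun x => x + t n *: e) G); last exact: cG.
  by apply: cvgD; [exact: cvg_id|exact: cvg_cst].
have iGT n := continuous_vanish_integrable (cT n) (vT n).
pose f n (x : borel3 R) : \bar R := ((n.+1%:R) * (G (T n x) - G x))%:E.
have mf n : measurable_fun setT (f n).
  apply/measurable_EFinP; apply: measurable_funM => //; apply: measurable_funB => //.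
  exact: (continuous_measurable_R3 (cT n)).
have f0 n : (\int[leb3]_x f n x = 0)%E.
  rewrite (_ : f n = fun x => ((n.+1%:R)%:E * ((G (T n x))%:E - (G x)%:E))%E) //.
  rewrite integralZl//; last exact: integrableB.
  rewrite integralB//.
  have := @preserving_integral _ _ _ _ (T n) (fun x => (G x)%:E) (PT n).
  move=> /(_ ((measurable_EFinP _ _).2 mG)) E.
  by rewrite E subee ?mule0// integrable_fin_num.
pose h (x : borel3 R) : \bar R := (L%:E * (\1_(oball (M + enorm e)) x)%:E)%E.
have ih : leb3.-integrable setT h.
  apply: integrableZl => //; apply: (@integrable_bounded_support _ _ 1 (M + enorm e)).
  - by apply: measurable_indic; exact: measurable_oball.
  - by move=> x; rewrite indicE; case: (_ \in _); rewrite ?normr1 ?normr0.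
  - move=> x xM; rewrite indicE memNset// /oball/=; apply/negP; rewrite -leNgt//.
have cvgf : {ae leb3, forall x, setT x -> f ^~ x @ \oo --> (g x)%:E}.
  apply: (ae_off_null mN N0) => x /dG[dx gx] _.
  apply/fine_cvgP; split; first by near=> n.
  rewrite -gx; have := (cvgr_dnbhsP _ _ _).1 dx t.
  have tcvg : t n @[n --> \oo] --> (0:R) by exact: cvg_harmonic.
  move=> /(_ (conj (fun n => lt0r_neq0 (t0 n)) tcvg)).
  rewrite (_ : (fun n => _) = fine \o f ^~ x)//.
  by apply/funext => n; rewrite /f /T/= /shift/= (addrC (t n *: e)) /t invrK.
have domf : {ae leb3, forall x n, setT x -> (`|f n x| <= h x)%E}.
  apply: aeW => x n _; rewrite /h /f -EFinM abse_EFin lee_fin indicE.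
  have [xM|xM] := boolP (x \in oball (M + enorm e)).
    rewrite mulr1 normrM ger0_norm// -ler_pdivlMl//.
    by rewrite mulrC; apply: GL; rewrite t1 ltW.
  have {}xM : M + enorm e <= enorm x.
    by move: xM; rewrite notin_setE/= /oball/= => /negP; rewrite -leNgt.
  rewrite (vT n)// GM ?subr0 ?mulr0 ?normr0//.
  by apply: le_trans xM; rewrite lerDl enorm_ge0.
have [ig _ cvg] := dominated_convergence measurableT mf
   ((measurable_EFinP _ _).2 mg) cvgf ih domf.
split; first exact: ig.
have c0 : [sequence (\int[leb3]_x f n x)%E]_n = cst 0%E.
  by apply/funext => n; exact: f0.
rewrite c0 in cvg.
apply: (@cvg_unique _ _ (cst (0%E : \bar R) x @[x --> \oo])).
- exact: ereal_hausdorff.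
- exact: cvg.
- exact: cvg_cst.
Unshelve. all: by end_near. Qed.

End Vanishing_derivative.

(** * Smooth functions and their Laplacians *)

Section Smooth.
Context {R : realType}.
Implicit Types x v : R3 R.

Lemma smooth_derive (f : R3 R -> R) v : smooth f -> smooth ('D_v f).
Proof.
move=> sf vs; have := sf (rcons vs v).
by rewrite /iter_derive foldr_rcons.
Qed.

Lemma smooth_continuous (f : R3 R -> R) : smooth f -> continuous f.
Proof. by move=> sf; have [] := sf [::]. Qed.

Lemma smooth_derivable (f : R3 R -> R) : smooth f -> forall x v, derivable f x v.
Proof. by move=> sf; have [] := sf [::]. Qed.

Lemma smooth_derive_dot (f : R3 R -> R) x v : smooth f ->
  'D_v f x = v.1.1 * 'D_e1 f x + v.1.2 * 'D_e2 f x + v.2 * 'D_e3 f x.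
Proof.
move=> sf; apply: derive_dot; first exact: smooth_derivable.
by move=> w; apply: smooth_continuous; exact: smooth_derive.
Qed.

Lemma smooth_deriveZ (f : R3 R -> R) x v (t : R) : smooth f ->
  'D_(t *: v) f x = t * 'D_v f x.
Proof.
move=> sf; rewrite (smooth_derive_dot x (t *: v) sf) (smooth_derive_dot x v sf).
move: ('D_e1 f x) ('D_e2 f x) ('D_e3 f x) => a b c.
rewrite -[LHS]/(t * v.1.1 * a + t * v.1.2 * b + t * v.2 * c); ring.
Qed.

Lemma continuous_laplacian (f : R3 R -> R) : smooth f -> continuous (laplacian f).
Proof.
move=> sf x.
have c2 v : continuous ('D_v ('D_v f)).
  exact: (smooth_continuous (smooth_derive v (smooth_derive v sf))).
exact: (cvgD (cvgD (c2 e1 x) (c2 e2 x)) (c2 e3 x)).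
Qed.

Lemma vanish_laplacian M (f : R3 R -> R) : vanish M f -> vanish (M + 1 + 1) (laplacian f).
Proof.
move=> fM x xM; rewrite /laplacian.
have H v : 'D_v ('D_v f) x = 0.
  exact: (vanish_derive v (vanish_derive v fM) xM).
have Z (a b c : R) : a = 0 -> b = 0 -> c = 0 -> a + b + c = 0.
  by move=> -> -> ->; rewrite !addr0.
exact: (Z _ _ _ (H e1) (H e2) (H e3)).
Qed.

Lemma compact_supp_vanish (f : R3 R -> R) : compact (supp f) -> exists2 M, 0 < M & vanish M f.
Proof.
move=> /compact_bounded[M [_ HM]].
have := HM (`|M| + 1); rewrite (le_lt_trans (ler_norm M)) ?ltrDl// => /(_ isT) H.
exists (3 * (`|M| + 1) + 1); first by rewrite ltr_wpDl// mulr_ge0// addr_ge0.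
move=> x xM; apply: contrapT => fx.
have /= : `|x| <= `|M| + 1 := H x (subset_closure fx); have := enorm_le_norm x; lra.
Qed.

End Smooth.

(** * The Laplacian of the potential of one shell *)

Section Shell_potential.
Context {R : realType}.
Notation mR := (measurableTypeR R).
Notation mu := (@lebesgue_measure R).
Implicit Types x y v : R3 R.
Variables (s : R) (s0 : 0 < s).

Definition shell_pot (s : R) x : R := (Num.max (enorm x) s)^-1.

Let max_gt0 x : 0 < Num.max (enorm x) s.
Proof. by rewrite lt_max s0 orbT. Qed.

Lemma shell_pot_ge0 x : 0 <= shell_pot s x.
Proof. by rewrite invr_ge0 ltW. Qed.

Lemma shell_pot_le x : shell_pot s x <= s^-1.
Proof. by rewrite lef_pV2 ?posrE// le_max lexx orbT. Qed.

Lemma max_lip (a b k : R) : `|Num.max a k - Num.max b k| <= `|a - b|.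
Proof.
have h1 := ler_norm (a - b); have h2 : b - a <= `|a - b| by rewrite distrC ler_norm.
rewrite !maxEle; case: (leP a k) => ?; case: (leP b k) => ?; rewrite ler_norml;
  apply/andP; split; lra.
Qed.

Lemma shell_pot_lip x y : `|shell_pot s x - shell_pot s y| <= s ^- 2 * enorm (x - y).
Proof.
have xn : Num.max (enorm x) s != 0 by rewrite gt_eqF.
have yn : Num.max (enorm y) s != 0 by rewrite gt_eqF.
have -> : shell_pot s x - shell_pot s y =
    (Num.max (enorm y) s - Num.max (enorm x) s) * shell_pot s x * shell_pot s y.
  by rewrite /shell_pot; field; rewrite xn yn.
rewrite !normrM !(ger0_norm (shell_pot_ge0 _)) -mulrA mulrC.
apply: ler_pM; rewrite ?mulr_ge0 ?shell_pot_ge0//.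
  rewrite -exprVn expr2; apply: ler_pM; rewrite ?shell_pot_ge0 ?shell_pot_le//.
apply: le_trans (dist_enorm x y); rewrite distrC.
exact: max_lip.
Qed.

Lemma continuous_shell_pot : continuous (shell_pot s).
Proof.
move=> x; apply: (@continuous_comp _ _ _ (fun x => Num.max (enorm x) s) GRing.inv).
  by apply: continuous_max; [exact: continuous_enorm|exact: cvg_cst].
by apply: inv_continuous; rewrite gt_eqF.
Qed.

Lemma line_is_derive {U V : normedModType R} (f : U -> V) (x v : U) (df : V) :
  is_derive (0 : R) (1 : R) (fun t => f (x + t *: v)) df -> is_derive x v f df.
Proof.
have E : (fun h : R => h^-1 *: ((fun t => f (x + t *: v)) (h *: (1 : R) + 0) - f (x + 0 *: v))) =
         (fun h => h^-1 *: (f (h *: v + x) - f x)).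
  apply/funext => h; congr (_ *: (f _ - f _)).
    by rewrite addr0 [h *: 1]mulr1 addrC.
  by rewrite scale0r addr0.
move=> [d <-]; split; first by move: d; rewrite /derivable E.
by rewrite /derive E.
Qed.

Lemma dot_line x v (t : R) :
  dot (x + t *: v) (x + t *: v) = dot x x + 2 * dot v x * t + dot v v * (t * t).
Proof.
rewrite -[LHS]/((x.1.1 + t * v.1.1) * (x.1.1 + t * v.1.1) +
  (x.1.2 + t * v.1.2) * (x.1.2 + t * v.1.2) + (x.2 + t * v.2) * (x.2 + t * v.2)).
by rewrite /dot; ring.
Qed.

Lemma is_derive_inv_enorm x v : x != 0 ->
  is_derive x v (fun x => (enorm x)^-1) (- dot v x / enorm x ^+ 3).
Proof.
rewrite -enorm_gt0 => x0; apply: line_is_derive.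
have xn : enorm x != 0 by rewrite gt_eqF.
pose q (t : R) := dot x x + 2 * dot v x * t + dot v v * (t * t).
rewrite (_ : (fun t => _) = (fun t => (Num.sqrt (q t))^-1)); last first.
  by apply/funext => t; rewrite /enorm dot_line.
have q0 : 0 < q 0 by rewrite /q !mulr0 !addr0 -sqr_enorm exprn_gt0.
have sq0 : Num.sqrt (q 0) = enorm x by rewrite /q !mulr0 !addr0.
have dq : is_derive (0:R) (1:R) q (2 * dot v x).
  by apply: is_derive_eq; rewrite /GRing.scale/=; ring.
have ds : is_derive (0:R) (1:R) (fun t => Num.sqrt (q t)) (dot v x / enorm x).
  have := @is_derive1_comp R Num.sqrt q 0 _ _ (is_derive1_sqrt q0) dq.
  rewrite sq0 => ds; apply: (is_derive_eq ds).
  by field.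
have sn : Num.sqrt (q 0) != 0 by rewrite sq0.
have dV := @is_deriveV R (fun t => Num.sqrt (q t)) 0 _ 1 sn ds; apply: (is_derive_eq dV).
by rewrite sq0 /GRing.scale/=; field.
Qed.

Lemma is_derive_shell_pot x v : enorm x != s ->
  is_derive x v (shell_pot s) ((s < enorm x)%R%:R * (- dot v x / enorm x ^+ 3)).
Proof.
move=> xs; have [sx|xs'] := ltP s (enorm x).
  rewrite mul1r; apply: (@near_eq_is_derive _ _ _ (fun x => (enorm x)^-1)).
    near=> y; have sy : s < enorm y.
      near: y; have := @continuous_enorm R x; move=> /cvgr_gt; exact.
    by rewrite /shell_pot max_l// ltW.
  by apply: is_derive_inv_enorm; rewrite -enorm_gt0 (lt_trans s0).
have {xs xs'} xs : enorm x < s by rewrite lt_neqAle xs.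
have d0 : is_derive x v (fun=> s^-1 : R) (0 : R) by exact: is_derive_cst.
have d1 : is_derive x v (shell_pot s) 0.
  apply: (near_eq_is_derive _ d0); near=> y; have sy : enorm y < s.
    near: y; have := @continuous_enorm R x; move=> /cvgr_lt; exact.
  by rewrite /shell_pot max_r// ltW.
by apply: (is_derive_eq d1); rewrite mulr0n mul0r.
Unshelve. all: by end_near. Qed.

(** The product rule for [shell_pot s] times h along e; it is the derivative only off the sphere |x|
    = s. *)
Definition shell_pot_derive (e : R3 R) (h : R3 R -> R) x : R :=
  shell_pot s x * 'D_e h x +
  (s < enorm x)%R%:R * (- dot e x / enorm x ^+ 3) * h x.

(** Integration by parts without boundary term: the product is Lipschitz along e across the kink,
    and the kink lies on a null sphere. *)
Lemma shell_pot_derive0 (h : R3 R -> R) (M : R) (e : R3 R) : smooth h -> vanish M h ->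
  leb3.-integrable setT (fun x : borel3 R => (shell_pot_derive e h x)%:E) /\
  (\int[leb3]_x (shell_pot_derive e h x)%:E = 0)%E.
Proof.
move=> sh hM; pose g := shell_pot_derive e h.
have ch := smooth_continuous sh; have cDh := smooth_continuous (smooth_derive e sh).
have [C C0 hC] := vanish_bounded ch hM.
have [D D0 DC] := vanish_bounded cDh (vanish_derive e hM).
pose G x := shell_pot s x * h x.
have cG : continuous G.
  by move=> x; apply: cvgM; [exact: continuous_shell_pot|exact: ch].
have := @integral_derive_eq0 R G g e (s^-1 * D + C * (s ^- 2 * enorm e)) M
  [set x | enorm x = s] cG _ _ _ _ (leb3_sphere0 s).
apply.
- by move=> x xM; rewrite /G hM// mulr0.
- by rewrite addr_ge0// ?mulr_ge0// ?invr_ge0 ?enorm_ge0// ?exprn_ge0// ltW.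
- move=> x t /andP[t0 t1].
  have -> : G (x + t *: e) - G x = shell_pot s (x + t *: e) * (h (x + t *: e) - h x)
     + h x * (shell_pot s (x + t *: e) - shell_pot s x) by rewrite /G; ring.
  apply: (le_trans (ler_normD _ _)); rewrite mulrDl !normrM; apply: lerD.
    rewrite (ger0_norm (shell_pot_ge0 _)) -mulrA; apply: ler_pM.
    + exact: shell_pot_ge0. + exact: normr_ge0. + exact: shell_pot_le.
    have [u _ ->] := line_MVT x t0 (fun y => @smooth_derivable R h sh y e).
    by rewrite normrM (ger0_norm t0) ler_wpM2r.
  rewrite -mulrA; apply: ler_pM; rewrite ?normr_ge0//.
  apply: (le_trans (shell_pot_lip _ _)).
  rewrite addrAC subrr add0r enormZ (ger0_norm t0) le_eqVlt.
  by apply/orP; left; apply/eqP; ring.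
- have := @measurable_enorm R _ (borel3 R) id (@measurable_id _ _ _).
  by move=> /(_ measurableT [set s]); rewrite setTI; apply; exact: measurable_set1.
- move=> x xs; have xs' : enorm x != s by apply/eqP.
  have d1 := is_derive_shell_pot e xs'.
  have d2 := derivableP (@smooth_derivable R h sh x e).
  have d3 := is_deriveM d1 d2; apply: (is_derive_eq d3).
  by rewrite /g /shell_pot_derive /GRing.scale/=; ring.
- apply: measurable_funD; apply: measurable_funM.
  + exact: (continuous_measurable_R3 continuous_shell_pot).
  + exact: (continuous_measurable_R3 cDh).
  + apply: measurable_funM; first by meas3.
    apply: measurable_funM; last by meas3.
    apply: measurableT_comp; first exact: oppr_measurable.
    by apply: measurable_dot; meas.
  + exact: (continuous_measurable_R3 ch).
Qed.


Lemma ray_integral (phi dphi : R -> R) (M : R) : continuous dphi ->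
  (forall t, is_derive t (1:R) phi (dphi t)) ->
  (forall t, M <= t -> phi t = 0 /\ dphi t = 0) ->
  (\int[mu]_(t in `]0%R, +oo[) ((s < t)%R%:R * dphi t)%:E = (- phi s)%:E)%E.
Proof.
(* The bound s + 1 keeps the interval nondegenerate even when the support ends before s. *)
move=> cd dphiE phi0; pose N := Num.max M (s + 1).
have sN : s < N by rewrite lt_max ltrDl ltr01 orbT.
transitivity (\int[mu]_(t in `]s, N]) (dphi t)%:E)%E.
  rewrite [LHS]integral_indic_mul [RHS]integral_indic_mul; apply: eq_integral => t _.
  rewrite -!EFinM !indicE; congr EFin.
  have -> : (t \in (`]0, +oo[%classic : set R)) = (0 < t).
    by apply/idP/idP; rewrite inE/= in_itv/= andbT.
  have -> : (t \in (`]s, N]%classic : set R)) = (s < t) && (t <= N).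
    by apply/idP/idP; rewrite inE/= in_itv/=.
  have [st|st] := ltP s t; last by rewrite !mul0r mulr0.
  rewrite (lt_trans s0 st) /= !mul1r; have [//|Nt] := leP t N; first by rewrite mul1r.
  by rewrite mul0r (phi0 _ _).2// (le_trans _ (ltW Nt))// le_max lexx.
rewrite integral_itv_obnd_cbnd; last first.
  by apply/measurable_EFinP; apply: measurable_funTS; exact: continuous_measurable_fun.
have cphi : continuous phi.
  by move=> t; have [d _] := dphiE t; exact/differentiable_continuous/derivable1_diffP.
rewrite (@continuous_FTC2 _ dphi phi s N sN).
- by rewrite (phi0 N _).1 ?sub0e// le_max lexx.
- exact: continuous_subspaceT.
- split=> [t _||]; first by have [] := dphiE t.
    exact: cvg_at_right_filter (cphi s).
  exact: cvg_at_left_filter (cphi N).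
- by move=> t _; rewrite derive1E; have [_] := dphiE t.
Qed.

(** Integrating by parts in the three axis directions leaves the integral of - grad v_s . grad eta.
    Outside the sphere this is |x|^-2 times the radial derivative of eta, so in polar coordinates
    the factor t^2 cancels and each ray contributes - eta at radius s. *)
Theorem integral_shell_pot_laplacian (eta : R3 R -> R) (M : R) :
  smooth eta -> vanish M eta ->
  (\int[leb3]_x (shell_pot s x * laplacian eta x)%:E =
   3%:E * \int[leb3]_(y in pball) (- eta ((s / enorm y) *: (y : R3 R)))%:E)%E.
Proof.
move=> se eM.
have [i1 z1] := shell_pot_derive0 e1 (smooth_derive e1 se) (vanish_derive e1 eM).
have [i2 z2] := shell_pot_derive0 e2 (smooth_derive e2 se) (vanish_derive e2 eM).
have [i3 z3] := shell_pot_derive0 e3 (smooth_derive e3 se) (vanish_derive e3 eM).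
pose g1 := shell_pot_derive e1 ('D_e1 eta); pose g2 := shell_pot_derive e2 ('D_e2 eta).
pose g3 := shell_pot_derive e3 ('D_e3 eta).
(* This is - grad v_s . grad eta off the sphere |x| = s; the derivative of eta at x in the direction
   x itself is |x| times the radial derivative. *)
pose psi x := (s < enorm x)%R%:R / enorm x ^+ 3 * 'D_x eta x.
have psiE x : shell_pot s x * laplacian eta x = g1 x + g2 x + g3 x + psi x.
  rewrite /g1 /g2 /g3 /psi /shell_pot_derive (smooth_derive_dot x x se) /laplacian.
  have d1 : dot e1 x = x.1.1 by rewrite /dot/= !mul0r mul1r !addr0.
  have d2 : dot e2 x = x.1.2 by rewrite /dot/= !mul0r mul1r addr0 add0r.
  have d3 : dot e3 x = x.2 by rewrite /dot/= !mul0r mul1r !add0r.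
  have key (v l1 l2 l3 b n a1 a2 a3 x1 x2 x3 : R) : v * (l1 + l2 + l3) =
      v * l1 + b * (- x1 / n) * a1 + (v * l2 + b * (- x2 / n) * a2) +
      (v * l3 + b * (- x3 / n) * a3) + b / n * (x1 * a1 + x2 * a2 + x3 * a3) by ring.
  move: (dot e1 x) (dot e2 x) (dot e3 x) d1 d2 d3 => ? ? ? -> -> ->; exact: key.
rewrite -/g1 in i1 z1; rewrite -/g2 in i2 z2; rewrite -/g3 in i3 z3.
clearbody g1 g2 g3.
have iL : leb3.-integrable setT (fun x : borel3 R => (shell_pot s x * laplacian eta x)%:E).
  apply: (@continuous_vanish_integrable R (M + 1 + 1) (fun x => shell_pot s x * laplacian eta x)).
    by move=> x; apply: cvgM; [exact: continuous_shell_pot|exact: continuous_laplacian].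
  by move=> x xM; rewrite (vanish_laplacian eM xM) mulr0.
have ig : leb3.-integrable setT (fun x : borel3 R => (g1 x + g2 x + g3 x)%:E).
  exact: integrableD (integrableD measurableT i1 i2) i3.
have ipsi : leb3.-integrable setT (EFin \o (psi : borel3 R -> R)).
  have := integrableB measurableT iL ig.
  by apply: eq_integrable => // x _ /=; rewrite -EFinB psiE addrC addKr.
have -> : (\int[leb3]_x (shell_pot s x * laplacian eta x)%:E =
    \int[leb3]_x (psi x)%:E)%E.
  under eq_integral do rewrite psiE EFinD.
  rewrite integralD//.
  have -> : (\int[leb3]_x (g1 x + g2 x + g3 x)%:E = 0)%E.
    have := integralD measurableT (integrableD measurableT i1 i2) i3.
    by rewrite (integralD measurableT i1 i2) z1 z2 z3 !adde0.
  by rewrite add0e.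
rewrite polar12//; congr (_ * _)%E.
apply: eq_integral => y /[!inE] /andP[y0 _].
have yn : enorm y != 0 by rewrite gt_eqF.
pose u := (enorm y)^-1 *: y.
have u1 : enorm u = 1 by rewrite enormZ ger0_norm ?mulVf// invr_ge0 ltW.
have tuE (t : R) : (t / enorm y) *: y = 0 + t *: u by rewrite add0r scalerA.
pose phi (t : R) := eta (0 + t *: u).
pose dphi (t : R) := 'D_u eta (0 + t *: u).
rewrite [in RHS]tuE -/(phi s).
transitivity (\int[mu]_(t in `]0%R, +oo[) ((s < t)%R%:R * dphi t)%:E)%E;
  last apply: (@ray_integral phi dphi (M + 1)).
- apply: eq_integral => t; rewrite inE/= in_itv/= andbT => t0.
  congr EFin; rewrite tuE /psi.
  have tu : enorm (0 + t *: u) = t by rewrite add0r enormZ u1 mulr1 gtr0_norm.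
  rewrite tu; case: (s < t); last by rewrite !mul0r mulr0.
  have Dt : 'D_(0 + t *: u) eta (0 + t *: u) = t * dphi t.
    by rewrite /dphi add0r smooth_deriveZ.
  rewrite Dt !mulr1n !mul1r; have tn : t != 0 by rewrite gt_eqF.
  by field.
- move=> t; apply: (@continuous_comp _ _ _ (fun t : R => 0 + t *: u) ('D_u eta)).
    by apply: cvgD; [exact: cvg_cst|apply: cvgZl; exact: cvg_id].
  exact: smooth_continuous (smooth_derive u se) _.
- by move=> t; apply: is_derive_line; apply: derivableP; exact: smooth_derivable.
- move=> t Mt; have M1 : M + 1 <= enorm (0 + t *: u).
    by rewrite add0r enormZ u1 mulr1 (le_trans Mt)// ler_norm.
  split; last exact: (vanish_derive u eM M1).
  by apply: eM; apply: le_trans M1; rewrite lerDl.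
Qed.

End Shell_potential.

(** * Functions of class C^n *)

Section Differentiability_class.
Context {R : realType}.
Implicit Types (x v : R3 R) (f g : R3 R -> R).

(** The partial derivatives are witnesses rather than iterated limits, and linearity of the
    derivative in v is built in. Closure under sums and products is then an induction on n, which
    the definition of [smooth] would not give directly. *)
Fixpoint Cn (n : nat) f : Prop :=
  continuous f /\
  if n is n'.+1 then
    exists f1 f2 f3, [/\ Cn n' f1, Cn n' f2, Cn n' f3 &
      forall x v, is_derive x v f (v.1.1 * f1 x + v.1.2 * f2 x + v.2 * f3 x)]
  else True.

Lemma Cn_continuous n f : Cn n f -> continuous f.
Proof. by case: n => [|n] []. Qed.

Lemma CnW n f : Cn n.+1 f -> Cn n f.
Proof.
elim: n f => [|n IH] f; first by move=> [].
move=> [cf [f1 [f2 [f3 [c1 c2 c3 d]]]]]; split=> //.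
by exists f1, f2, f3; split=> //; exact: IH.
Qed.

Lemma Cn_cst n (c : R) : Cn n (fun=> c).
Proof.
elim: n c => [|n IH] c; split; try exact: cst_continuous; first by [].
exists (fun=> 0), (fun=> 0), (fun=> 0); split; try exact: IH.
by move=> x v; have d := is_derive_cst c x v; apply: (is_derive_eq d); ring.
Qed.

Lemma Cn_add n f g : Cn n f -> Cn n g -> Cn n (fun x => f x + g x).
Proof.
have cD (h k : R3 R -> R) : continuous h -> continuous k -> continuous (fun x => h x + k x).
  by move=> ch ck x; apply: cvgD; [exact: ch|exact: ck].
elim: n f g => [|n IH] f g; first by move=> [cf _] [cg _]; split=> //; exact: cD.
move=> [cf [f1 [f2 [f3 [a1 a2 a3 da]]]]] [cg [g1 [g2 [g3 [b1 b2 b3 db]]]]].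
split; first exact: cD.
exists (fun x => f1 x + g1 x), (fun x => f2 x + g2 x), (fun x => f3 x + g3 x).
split; try exact: IH.
by move=> x v; have d := is_deriveD (da x v) (db x v); apply: (is_derive_eq d); ring.
Qed.

Lemma Cn_mul n f g : Cn n f -> Cn n g -> Cn n (fun x => f x * g x).
Proof.
have cM (h k : R3 R -> R) : continuous h -> continuous k -> continuous (fun x => h x * k x).
  by move=> ch ck x; apply: cvgM; [exact: ch|exact: ck].
elim: n f g => [|n IH] f g; first by move=> [cf _] [cg _]; split=> //; exact: cM.
move=> Hf Hg; have Hf' := CnW Hf; have Hg' := CnW Hg; move: Hf Hg.
move=> [cf [f1 [f2 [f3 [a1 a2 a3 da]]]]] [cg [g1 [g2 [g3 [b1 b2 b3 db]]]]].
split; first exact: cM.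
exists (fun x => f x * g1 x + f1 x * g x), (fun x => f x * g2 x + f2 x * g x),
  (fun x => f x * g3 x + f3 x * g x).
split; try by apply: Cn_add; exact: IH.
move=> x v; have d := is_deriveM (da x v) (db x v); apply: (is_derive_eq d).
by rewrite /GRing.scale/=; ring.
Qed.

Lemma Cn_coord n (c : R3 R) :
  [/\ Cn n (fun x => x.1.1 - c.1.1), Cn n (fun x => x.1.2 - c.1.2) & Cn n (fun x => x.2 - c.2)].
Proof.
have H (p : R3 R -> R) (w : R3 R) : continuous p ->
    (forall x v, is_derive x v p (v.1.1 * w.1.1 + v.1.2 * w.1.2 + v.2 * w.2)) -> Cn n p.
  move=> cp dp; case: n => [|n]; split=> //.
  exists (fun=> w.1.1), (fun=> w.1.2), (fun=> w.2); split; try exact: Cn_cst.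
  exact: dp.
have L (p : R3 R -> R) (a : R) x v (d : R) : (forall t, p (x + t *: v) = a + t * d) ->
    is_derive x v p d.
  move=> E; apply: line_is_derive; rewrite (_ : (fun t => _) = fun t => a + t * d).
    by apply: is_derive_eq; rewrite /GRing.scale/=; ring.
  exact/funext.
split.
- apply: (H _ e1) => [x|x v].
    by apply: cvgB; [apply: (cvg_comp _ _ cvg_fst cvg_fst)|exact: cvg_cst].
  apply: (L _ (x.1.1 - c.1.1)) => t.
  by rewrite -[LHS]/(x.1.1 + t * v.1.1 - c.1.1) /e1/=; ring.
- apply: (H _ e2) => [x|x v].
    by apply: cvgB; [apply: (cvg_comp _ _ cvg_fst cvg_snd)|exact: cvg_cst].
  apply: (L _ (x.1.2 - c.1.2)) => t.
  by rewrite -[LHS]/(x.1.2 + t * v.1.2 - c.1.2) /e2/=; ring.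
- apply: (H _ e3) => [x|x v].
    by apply: cvgB; [exact: cvg_snd|exact: cvg_cst].
  apply: (L _ (x.2 - c.2)) => t.
  by rewrite -[LHS]/(x.2 + t * v.2 - c.2) /e3/=; ring.
Qed.

Lemma Cn_derive n f v : Cn n.+1 f -> Cn n ('D_v f) /\ forall x, derivable f x v.
Proof.
move=> [cf [f1 [f2 [f3 [c1 c2 c3 d]]]]]; split; last by move=> x; have [] := d x v.
rewrite (_ : 'D_v f = fun x => v.1.1 * f1 x + v.1.2 * f2 x + v.2 * f3 x).
  by apply: Cn_add; [apply: Cn_add|]; apply: Cn_mul => //; exact: Cn_cst.
by apply/funext => x; have [_] := d x v.
Qed.

Lemma Cn_smooth f : (forall n, Cn n f) -> smooth f.
Proof.
move=> Cf vs; have : forall n, Cn n (iter_derive vs f).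
  by elim: vs => [//|v vs IH] n /=; exact: (Cn_derive v (IH n.+1)).1.
move=> Cv; split; first exact: (Cn_continuous (Cv 0%N)).
by move=> x v; exact: (Cn_derive v (Cv 1%N)).2.
Qed.

End Differentiability_class.

(** * Functions flat at the origin *)

Section Flat_exponential.
Context {R : realType}.

(** A whole family is used because its span is closed under differentiation: writing F_k for
    [flat_exp k], one has F_k' = F_(k+2) - k F_(k+1). *)
Definition flat_exp (k : nat) (t : R) : R :=
  if 0 < t then t^-1 ^+ k * expR (- t^-1) else 0.

Lemma flat_exp_ge0 k t : 0 <= flat_exp k t.
Proof.
rewrite /flat_exp; case: ltP => [t0|_]; last exact: lexx.
apply: mulr_ge0; last exact: expR_ge0.
by apply: exprn_ge0; rewrite invr_ge0 ltW.
Qed.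

Lemma flat_expS k t : t * flat_exp k.+1 t = flat_exp k t.
Proof.
rewrite /flat_exp; case: ltP => [t0|_]; last by rewrite mulr0.
by rewrite mulrA exprS mulrA divff ?mul1r// gt_eqF.
Qed.

Lemma expR_pow_le (n : nat) (x : R) : 0 < x -> (x / n.+1%:R) ^+ n.+1 <= expR x.
Proof.
move=> x0; have n0 : (0 : R) < n.+1%:R by rewrite ltr0n.
have -> : expR x = expR (x / n.+1%:R) ^+ n.+1 by rewrite -expRM_natr divfK// gt_eqF.
have xn : 0 <= x / n.+1%:R by rewrite ltW// divr_gt0.
rewrite lerXn2r ?nnegrE ?expR_ge0//.
by apply: le_trans (expR_ge1Dx _); rewrite lerDr.
Qed.

(** From exp x >= (x / (k + 2))^(k + 2) at x = 1 / t. A quadratic bound is exactly what gives the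
    derivative 0 at the origin. *)
Lemma flat_exp_le k (t : R) : flat_exp k t <= k.+2%:R ^+ k.+2 * t ^+ 2.
Proof.
rewrite /flat_exp; case: ltP => [t0|_]; last first.
  by apply: mulr_ge0; [apply: exprn_ge0; exact: ler0n|exact: sqr_ge0].
have ti0 : 0 < t^-1 by rewrite invr_gt0.
have k0 : (0 : R) < k.+2%:R by rewrite ltr0n.
have := expR_pow_le k.+1 ti0.
rewrite expRN => H.
have H2 : (expR t^-1)^-1 <= ((t^-1 / k.+2%:R) ^+ k.+2)^-1.
  by rewrite lef_pV2// posrE ?expR_gt0// exprn_gt0// divr_gt0.
apply: (le_trans (ler_wpM2l _ H2)); first by rewrite exprn_ge0// ltW.
rewrite exprMn invfM -[(k.+2%:R^-1 ^+ _)^-1]exprVn invrK -[X in _ * (X * _)]exprVn invrK.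
rewrite mulrA mulrC; apply: ler_wpM2l; first by apply: exprn_ge0; exact: ler0n.
rewrite -[k.+2]addn2 exprD mulrA -exprMn mulVf ?gt_eqF// expr1n mul1r.
exact: lexx.
Qed.

Lemma is_derive_flat_exp k (t : R) :
  is_derive t (1 : R) (flat_exp k) (flat_exp k.+2 t - k%:R * flat_exp k.+1 t).
Proof.
have [t0|t0|t0] := ltgtP 0 t.
- apply: (@near_eq_is_derive _ _ _ (fun t : R => t^-1 ^+ k * expR (- t^-1))).
    by near=> u; rewrite /flat_exp ifT//; near: u; exact: lt_nbhsr.
  have tn : t != 0 by rewrite gt_eqF.
  have dV : is_derive t (1:R) (fun t : R => t^-1) (- t ^- 2 *: (1:R)).
    exact: (@is_deriveV R id t 1 1 tn (is_derive_id t 1)).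
  have dP : is_derive t^-1 (1:R) (fun u : R => u ^+ k) (k%:R *: t^-1 ^+ k.-1 *: (1:R)).
    by apply: DeriveDef; [exact: exprn_derivable|exact: exp_derive].
  have dX := @is_derive1_comp R _ _ t _ _ dP dV.
  have dE := @is_derive1_comp R expR (fun t => - t^-1) t _ _ (is_derive_expR _) (is_deriveN dV).
  have d := is_deriveM dX dE; apply: (is_derive_eq d).
  rewrite /flat_exp t0 /GRing.scale/=.
  case: k {dX d dP} => [|k]; first by rewrite !expr0 !mul0r; field.
  by rewrite /= !exprS; move: (t^-1 ^+ k) => ?; field.
- rewrite (_ : _ - _ = 0); last by rewrite /flat_exp (lt_gtF t0) mulr0 subr0.
  apply: (near_eq_is_derive _ (is_derive_cst (0:R) t 1)).
  near=> u; rewrite /flat_exp ifF//; apply/negbTE; rewrite -leNgt.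
  by near: u; apply: lt_le_nbhsl.
- rewrite -t0 {t t0} (_ : _ - _ = 0); last by rewrite /flat_exp ltxx mulr0 subr0.
  pose C : R := k.+2%:R ^+ k.+2.
  have C0 : 0 < C + 1 by rewrite ltr_wpDl// exprn_ge0.
  have cv : (fun h : R => h^-1 *: (flat_exp k (h *: 1 + 0) - flat_exp k 0)) @ 0^' --> (0:R).
    apply/cvgrPdist_lt => e e0; near=> h.
    have h0 : h != 0 by near: h; exact: nbhs_dnbhs_neq.
    have he : `|h| < e / (C + 1).
      near: h; apply: nbhs_dnbhs; have := @nbhsx_ballx _ _ (0 : R) _ (divr_gt0 e0 C0).
      by apply: filterS => u; rewrite -ball_normE/= sub0r normrN.
    rewrite addr0 [h *: 1]mulr1 {2}/flat_exp ltxx subr0 sub0r normrN /GRing.scale/= normrM.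
    rewrite (ger0_norm (flat_exp_ge0 _ _)).
    apply: (le_lt_trans (ler_wpM2l _ (flat_exp_le k h))) => //.
    rewrite -/C normfV mulrCA -(real_normK (num_real h)) expr2 mulKf ?normr_eq0//.
    rewrite ltr_pdivlMr// in he; apply: le_lt_trans he.
    by rewrite mulrDr mulr1 mulrC lerDl.
  split; first by apply/cvg_ex; exists 0.
  exact: cvg_lim cv.
Unshelve. all: by end_near. Qed.

End Flat_exponential.

(** * The test function concentrated near a point *)

Section Bump.
Context {R : realType}.
Implicit Types (x v y : R3 R) (g : R3 R -> R).

Lemma is_derive_comp3 (F : R -> R) g x v (a b : R) :
  is_derive (g x) (1 : R) F a -> is_derive x v g b ->
  is_derive x v (fun y => F (g y)) (a * b).
Proof.
move=> dF dg; apply: line_is_derive.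
have E : x + 0 *: v = x by rewrite scale0r addr0.
have dg' : is_derive (0 : R) (1 : R) (fun t => g (x + t *: v)) b.
  by apply: is_derive_line; rewrite E.
by apply: (@is_derive1_comp R F (fun t => g (x + t *: v))); rewrite ?E.
Qed.

Lemma continuous_flat_exp k : continuous (@flat_exp R k).
Proof.
by move=> t; have [d _] := is_derive_flat_exp k t; exact/differentiable_continuous/derivable1_diffP.
Qed.

Variables (x0 : R3 R) (a d : R).
Hypothesis d0 : 0 < d.

Definition bump_pot y : R := (Num.sqrt (dot (y - x0) (y - x0) + d))^-1.

Let rad_gt0 y : 0 < dot (y - x0) (y - x0) + d.
Proof. by rewrite ltr_wpDl// dot_ge0. Qed.

Lemma bump_pot_gt0 y : 0 < bump_pot y.
Proof. by rewrite invr_gt0 sqrtr_gt0. Qed.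

Lemma bump_pot_sqr y : (dot (y - x0) (y - x0) + d) * bump_pot y ^+ 2 = 1.
Proof. by rewrite exprVn sqr_sqrtr ?divff// ?gt_eqF ?ltW. Qed.

Lemma continuous_bump_pot : continuous bump_pot.
Proof.
move=> y; rewrite /bump_pot.
apply: (@continuous_comp _ _ _ (fun y => Num.sqrt (dot (y - x0) (y - x0) + d)) GRing.inv).
  apply: (@continuous_comp _ _ _ (fun y => dot (y - x0) (y - x0) + d) Num.sqrt).
    rewrite (_ : (fun y => _) = fun y => enorm (y - x0) ^+ 2 + d); last first.
      by apply/funext => z; rewrite sqr_enorm.
    apply: cvgD; last exact: cvg_cst.
    apply: (@continuous_comp _ _ _ (fun y => enorm (y - x0)) (fun t : R => t ^+ 2)); last exact: exprn_continuous.
    apply: (@continuous_comp _ _ _ (fun y => y - x0) (@enorm R)); last exact: continuous_enorm.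
    by apply: cvgB; [exact: cvg_id|exact: cvg_cst].
  exact: sqrt_continuous.
by apply: inv_continuous; rewrite gt_eqF// sqrtr_gt0.
Qed.

Lemma is_derive_bump_pot y v :
  is_derive y v bump_pot (- dot v (y - x0) * bump_pot y ^+ 3).
Proof.
apply: line_is_derive; set z := y - x0.
pose q (t : R) := (dot z z + d) + 2 * dot v z * t + dot v v * (t * t).
rewrite (_ : (fun t => _) = (fun t => (Num.sqrt (q t))^-1)); last first.
  apply/funext => t; rewrite /bump_pot /q (_ : y + t *: v - x0 = z + t *: v); last first.
    by rewrite /z addrAC.
  rewrite dot_line; congr (Num.sqrt _)^-1.
  by move: (dot z z) (dot v z) (dot v v) => ? ? ?; ring.
have qE : q 0 = dot z z + d by rewrite /q !mulr0 !addr0.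
have q0 : 0 < q 0 by rewrite qE; exact: rad_gt0.
have sn : Num.sqrt (q 0) != 0 by rewrite gt_eqF// sqrtr_gt0.
have dq : is_derive (0:R) (1:R) q (2 * dot v z).
  by apply: is_derive_eq; rewrite /GRing.scale/=; ring.
have ds := @is_derive1_comp R Num.sqrt q 0 _ _ (is_derive1_sqrt q0) dq.
have dV := @is_deriveV R (Num.sqrt \o q) 0 _ 1 sn ds; apply: (is_derive_eq dV).
rewrite /bump_pot -/z -qE /GRing.scale/=; move: (Num.sqrt (q 0)) sn => u un.
by field.
Qed.

Lemma Cn_bump_pot n : Cn n bump_pot.
Proof.
elim: n => [|n IH]; split=> //; try exact: continuous_bump_pot.
have [c1 c2 c3] := Cn_coord n x0.
have C3 : Cn n (fun y => (-1) * (bump_pot y * (bump_pot y * bump_pot y))).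
  by apply: Cn_mul; [exact: Cn_cst|do 2 (apply: Cn_mul => //)].
exists (fun y => (y.1.1 - x0.1.1) * ((-1) * (bump_pot y * (bump_pot y * bump_pot y)))),
       (fun y => (y.1.2 - x0.1.2) * ((-1) * (bump_pot y * (bump_pot y * bump_pot y)))),
       (fun y => (y.2 - x0.2) * ((-1) * (bump_pot y * (bump_pot y * bump_pot y)))).
split; try exact: Cn_mul.
move=> y v; apply: (is_derive_eq (is_derive_bump_pot y v)).
rewrite -[dot v (y - x0)]/(v.1.1 * (y.1.1 - x0.1.1) + v.1.2 * (y.1.2 - x0.1.2) + v.2 * (y.2 - x0.2)).
by ring.
Qed.

Lemma is_derive_flat_bump k y v :
  is_derive y v (fun y => flat_exp k (bump_pot y - a))
    ((flat_exp k.+2 (bump_pot y - a) - k%:R * flat_exp k.+1 (bump_pot y - a)) *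
     (- dot v (y - x0) * bump_pot y ^+ 3)).
Proof.
apply: (@is_derive_comp3 (flat_exp k) (fun y => bump_pot y - a)).
  exact: is_derive_flat_exp.
have := is_deriveB (is_derive_bump_pot y v) (is_derive_cst a y v).
by move=> D; apply: (is_derive_eq D); rewrite subr0.
Qed.

Lemma Cn_flat_bump n k : Cn n (fun y => flat_exp k (bump_pot y - a)).
Proof.
have cf j : continuous (fun y => flat_exp j (bump_pot y - a)).
  move=> y; apply: (@continuous_comp _ _ _ (fun y => bump_pot y - a) (flat_exp j)).
    by apply: cvgB; [exact: continuous_bump_pot|exact: cvg_cst].
  exact: continuous_flat_exp.
elim: n k => [|n IH] k; split=> //.
have [c1 c2 c3] := Cn_coord n x0; have CV := Cn_bump_pot n.
pose G y := (flat_exp k.+2 (bump_pot y - a) + (- k%:R) * flat_exp k.+1 (bump_pot y - a)) *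
  ((-1) * (bump_pot y * (bump_pot y * bump_pot y))).
have CG : Cn n G.
  apply: Cn_mul; first by apply: Cn_add; [exact: IH|apply: Cn_mul; [exact: Cn_cst|exact: IH]].
  by apply: Cn_mul; [exact: Cn_cst|do 2 (apply: Cn_mul => //)].
exists (fun y => (y.1.1 - x0.1.1) * G y), (fun y => (y.1.2 - x0.1.2) * G y),
  (fun y => (y.2 - x0.2) * G y).
split; try exact: Cn_mul.
move=> y v; apply: (is_derive_eq (is_derive_flat_bump k y v)).
rewrite -[dot v (y - x0)]/(v.1.1 * (y.1.1 - x0.1.1) + v.1.2 * (y.1.2 - x0.1.2) + v.2 * (y.2 - x0.2)).
by rewrite /G; ring.
Qed.

(* The profile t exp(-1/t) is smooth, convex, and linear at infinity. *)
Definition exp_bump y : R := (bump_pot y - a) * flat_exp 0 (bump_pot y - a).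

(** This is F' (V - a) for F t = t exp (- 1 / t) and V = [bump_pot]. The second derivative of F is
    [flat_exp 3]. *)
Definition bump_slope y : R := flat_exp 0 (bump_pot y - a) + flat_exp 1 (bump_pot y - a).

Lemma smooth_bump : smooth exp_bump.
Proof.
apply: Cn_smooth => n; apply: Cn_mul; last exact: Cn_flat_bump.
by apply: (@Cn_add _ n bump_pot (fun=> - a)); [exact: Cn_bump_pot|exact: Cn_cst].
Qed.

Lemma is_derive_bump y v :
  is_derive y v exp_bump (- dot v (y - x0) * (bump_pot y ^+ 3 * bump_slope y)).
Proof.
have D1 := is_deriveB (is_derive_bump_pot y v) (is_derive_cst a y v).
have D := is_deriveM D1 (is_derive_flat_bump 0 y v); apply: (is_derive_eq D).
rewrite /bump_slope -(flat_expS 1 (bump_pot y - a)) subr0 /GRing.scale/=.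
rewrite -[(_ - cst a) y]/(bump_pot y - a).
by move: (flat_exp 2 _) (flat_exp 0 _) => ? ?; ring.
Qed.

Lemma is_derive_bump_slope y v :
  is_derive y v bump_slope (flat_exp 3 (bump_pot y - a) * (- dot v (y - x0) * bump_pot y ^+ 3)).
Proof.
have D := is_deriveD (is_derive_flat_bump 0 y v) (is_derive_flat_bump 1 y v).
apply: (is_derive_eq D).
by move: (flat_exp 3 _) (flat_exp 2 _) (flat_exp 1 _) => ? ? ?; ring.
Qed.

Lemma derive2_bump y v : 'D_v ('D_v exp_bump) y =
  - dot v v * (bump_pot y ^+ 3 * bump_slope y) +
  dot v (y - x0) ^+ 2 * (3 * bump_pot y ^+ 5 * bump_slope y +
    bump_pot y ^+ 6 * flat_exp 3 (bump_pot y - a)).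
Proof.
have E : 'D_v exp_bump = fun y => - dot v (y - x0) * (bump_pot y ^+ 3 * bump_slope y).
  by apply/funext => z; have [_] := is_derive_bump z v.
have dd : is_derive y v (fun y => - dot v (y - x0)) (- dot v v).
  apply: line_is_derive; rewrite (_ : (fun t => _) = fun t => - dot v (y - x0) - t * dot v v).
    by apply: is_derive_eq; rewrite /GRing.scale/=; ring.
  apply/funext => t; rewrite (_ : y + t *: v - x0 = (y - x0) + t *: v); last by rewrite addrAC.
  by rewrite dotC dotDl dotZl (dotC (y - x0)) opprD.
have d3 : is_derive y v (fun y => bump_pot y ^+ 3)
   (3 * bump_pot y ^+ 2 * (- dot v (y - x0) * bump_pot y ^+ 3)).
  have D := is_deriveM (is_derive_bump_pot y v)
    (is_deriveM (is_derive_bump_pot y v) (is_derive_bump_pot y v)).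
  rewrite (_ : (fun y => _) = bump_pot * (bump_pot * bump_pot)).
    by apply: (is_derive_eq D); rewrite /GRing.scale/= -[(_ * _) y]/(bump_pot y * bump_pot y); ring.
  by apply/funext => z; rewrite exprS expr2.
have D := is_deriveM dd (is_deriveM d3 (is_derive_bump_slope y v)).
rewrite E; have [_ DE] := D; apply: (etrans DE).
rewrite -[(_ * bump_slope) y]/(bump_pot y ^+ 3 * bump_slope y) /GRing.scale/=.
by ring.
Qed.

(** The chain rule F'' |grad V|^2 + F' (laplacian V) with |grad V|^2 = |y - x0|^2 V^6 and laplacian
    V = - 3 d V^5. The latter uses (|y - x0|^2 + d) V^2 = 1 to bring V^3 and V^5 to a common
    power. *)
Lemma laplacian_bump y : laplacian exp_bump y =
  flat_exp 3 (bump_pot y - a) * (dot (y - x0) (y - x0) * bump_pot y ^+ 6) -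
  bump_slope y * (3 * d * bump_pot y ^+ 5).
Proof.
have Z (A B C A' B' C' : R) : A = A' -> B = B' -> C = C' -> A + B + C = A' + B' + C'.
  by move=> -> -> ->.
apply: (etrans (Z _ _ _ _ _ _ (derive2_bump y e1) (derive2_bump y e2) (derive2_bump y e3))).
have V2 := bump_pot_sqr y; move: V2.
set z := y - x0.
have -> : dot e1 z = z.1.1 by rewrite /dot/= !mul0r mul1r !addr0.
have -> : dot e2 z = z.1.2 by rewrite /dot/= !mul0r mul1r addr0 add0r.
have -> : dot e3 z = z.2 by rewrite /dot/= !mul0r mul1r !add0r.
have -> : dot e1 (e1 : R3 R) = 1 by rewrite /dot/= !mulr0 mulr1 !addr0.
have -> : dot e2 (e2 : R3 R) = 1 by rewrite /dot/= !mulr0 mulr1 addr0 add0r.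
have -> : dot e3 (e3 : R3 R) = 1 by rewrite /dot/= !mulr0 mulr1 !add0r.
rewrite -[dot z z]/(z.1.1 * z.1.1 + z.1.2 * z.1.2 + z.2 * z.2).
clearbody z; set F := flat_exp 3 _; set S := bump_slope y; set V := bump_pot y.
clearbody F S V; move: z.1.1 z.1.2 z.2 => A B C V2.
have E3 : V ^+ 3 = (A * A + B * B + C * C + d) * V ^+ 5.
  by rewrite -[LHS]mul1r -V2; ring.
by rewrite E3; ring.
Qed.

Lemma bump_slope_ge0 y : 0 <= bump_slope y.
Proof. by rewrite addr_ge0// flat_exp_ge0. Qed.

Lemma bump_slope_le1 y : bump_slope y <= 1.
Proof.
rewrite /bump_slope /flat_exp; case: ltP => [t0|_]; last by rewrite addr0 ler01.
set u := (_ - _)^-1; rewrite expr0 expr1 -mulrDl expRN ler_pdivrMr ?expR_gt0// mul1r.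
exact: expR_ge1Dx.
Qed.

Lemma bump_slope_eq0 y : bump_pot y <= a -> bump_slope y = 0.
Proof. by move=> Va; rewrite /bump_slope /flat_exp ltNge subr_le0 Va/= addr0. Qed.

Lemma bump_eq0 y : bump_pot y <= a -> exp_bump y = 0.
Proof. by move=> Va; rewrite /exp_bump /flat_exp ltNge subr_le0 Va/= mulr0. Qed.

Lemma bump_pot_le y (t : R) : 0 < t -> t <= enorm (y - x0) -> bump_pot y <= t^-1.
Proof.
move=> t0 ty; rewrite lef_pV2 ?posrE ?sqrtr_gt0//; apply: (le_trans ty).
by rewrite /enorm ler_wsqrtr// lerDl ltW.
Qed.

Lemma bump_pot_ge y (t : R) : 0 < t -> enorm (y - x0) ^+ 2 + d <= t ^+ 2 -> t^-1 <= bump_pot y.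
Proof.
move=> t0; rewrite sqr_enorm => ty; rewrite lef_pV2 ?posrE ?sqrtr_gt0//.
by rewrite -(ger0_norm (ltW t0)) -sqrtr_sqr ler_wsqrtr.
Qed.

End Bump.

(** * Mass of the regularised Newtonian kernel *)

Section Kernel_mass.
Context {R : realType}.
Notation mR := (measurableTypeR R).
Notation mu := (@lebesgue_measure R).
Implicit Types (y : R3 R).

(** The integrand is the derivative of (t / sqrt (t^2 + d))^3, which vanishes at 0 and never exceeds
    1. *)
Lemma radial_kernel_mass (rho d : R) : 0 < rho -> 0 < d ->
  (\int[mu]_(t in `[0%R, rho]) (3 * d * t ^+ 2 * (Num.sqrt (t ^+ 2 + d))^-1 ^+ 5)%:E <= 1)%E.
Proof.
move=> r0 d0; pose S (t : R) := Num.sqrt (t ^+ 2 + d).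
have q0 t : 0 < t ^+ 2 + d by rewrite ltr_wpDl// sqr_ge0.
have S0 t : 0 < S t by rewrite sqrtr_gt0.
have SE t : S t ^+ 2 = t ^+ 2 + d by rewrite sqr_sqrtr// ltW.
have dS (t : R) : is_derive t (1:R) (fun t => (S t)^-1) (- t * (S t)^-1 ^+ 3).
  have dq : is_derive t (1:R) (fun t : R => t ^+ 2 + d) (2 * t).
    by apply: is_derive_eq; rewrite /GRing.scale/=; ring.
  have ds := @is_derive1_comp R Num.sqrt (fun t : R => t ^+ 2 + d) t _ _ (is_derive1_sqrt (q0 t)) dq.
  have sn : S t != 0 by rewrite gt_eqF.
  have D := @is_deriveV R S t _ 1 sn ds; apply: (is_derive_eq D).
  by rewrite /GRing.scale/= -/(S t); field.
pose P (t : R) := (t * (t * t)) * ((S t)^-1 * ((S t)^-1 * (S t)^-1)).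
have dP (t : R) : is_derive t (1:R) P (3 * d * t ^+ 2 * (S t)^-1 ^+ 5).
  have D1 : is_derive t (1:R) (fun t : R => t * (t * t)) (3 * t ^+ 2).
    by apply: is_derive_eq; rewrite /GRing.scale/=; ring.
  have D := is_deriveM D1 (is_deriveM (dS t) (is_deriveM (dS t) (dS t))); apply: (is_derive_eq D).
  have un : S t != 0 by rewrite gt_eqF.
  rewrite -[((fun t => (S t)^-1) * (fun t => (S t)^-1)) t]/((S t)^-1 * (S t)^-1).
  rewrite -[((fun t => (S t)^-1) * _) t]/((S t)^-1 * ((S t)^-1 * (S t)^-1)) /GRing.scale/=.
  rewrite (_ : d = S t ^+ 2 - t ^+ 2); last by rewrite SE addrAC subrr add0r.
  by move: (S t) un => u un; field.
have cP : continuous P.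
  by move=> t; have [D _] := dP t; exact/differentiable_continuous/derivable1_diffP.
have cS : continuous (fun t => (S t)^-1).
  by move=> t; have [D _] := dS t; exact/differentiable_continuous/derivable1_diffP.
rewrite (@continuous_FTC2 _ (fun t => 3 * d * t ^+ 2 * (S t)^-1 ^+ 5) P 0 rho r0).
- rewrite [P 0](_ : _ = 0) ?sube0; last by rewrite /P !mul0r.
  rewrite lee_fin; have -> : P rho = (rho * (S rho)^-1) ^+ 3 by rewrite /P; ring.
  apply: exprn_ile1; first by rewrite mulr_ge0 ?invr_ge0 ?ltW.
  rewrite ler_pdivrMr// mul1r -[leLHS](ger0_norm (ltW r0)) -sqrtr_sqr.
  by rewrite /S ler_wsqrtr// lerDl ltW.
- apply: continuous_subspaceT => t; apply: cvgM.
    by apply: cvgMr; exact: exprn_continuous.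
  apply: (@continuous_comp _ _ _ (fun t => (S t)^-1) (fun t : R => t ^+ 5)); first exact: cS.
  exact: exprn_continuous.
- split=> [t _||]; first by have [] := dP t.
    exact: cvg_at_right_filter (cP 0).
  exact: cvg_at_left_filter (cP rho).
- by move=> t _; rewrite derive1E; have [_] := dP t.
Qed.

Lemma leb3_pball_lty : (leb3 (@pball R) < +oo)%E.
Proof.
apply: le_lt_trans (leb3_oball_lty 1); apply: le_measure; rewrite ?inE.
- exact: measurable_pball.
- exact: measurable_oball.
by move=> y /andP[].
Qed.

(** The kernel is - laplacian V; the point of the bound is that it does not depend on d. Translation
    to the origin and polar coordinates reduce it to the radial integral. *)
Lemma kernel_mass (x0 : R3 R) (rho d : R) : 0 < rho -> 0 < d ->
  (\int[leb3]_(y in [set y : borel3 R | (enorm ((y : R3 R) - x0)%R < rho)%R])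
    (3 * d * bump_pot x0 d y ^+ 5)%:E <= 3%:E * leb3 (@pball R))%E.
Proof.
move=> r0 d0.
pose f (z : borel3 R) : \bar R := ((enorm z < rho)%R%:R * (3 * d * (Num.sqrt (dot z z + d))^-1 ^+ 5))%:E.
have mf : measurable_fun setT f.
  apply/measurable_EFinP; apply: measurable_funM; first by meas3.
  apply: measurable_funM; first exact: measurable_cst.
  apply: measurable_funX; apply: measurable_inv; apply: measurable_sqrt.
  by apply: measurable_funD; [apply: measurable_dot; exact: measurable_id|exact: measurable_cst].
have f0 z : (0 <= f z)%E.
  rewrite lee_fin; apply: mulr_ge0; first exact: ler0n.
  apply: mulr_ge0; first by rewrite mulr_ge0// ltW.
  by apply: exprn_ge0; rewrite invr_ge0 sqrtr_ge0.
rewrite integral_indic_mul.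
rewrite (_ : (fun x => _) = fun y : borel3 R => f ((y : R3 R) + (- x0))%R); last first.
  apply/funext => y; rewrite /f -EFinM; congr EFin; congr (_ * _).
  by rewrite indicE; congr (nat_of_bool _)%:R; apply/idP/idP; rewrite inE.
rewrite (preserving_integral (leb3_translate (- x0)) mf) ge0_polar//.
apply: lee_wpmul2l; first by rewrite lee_fin.
rewrite -[leRHS]mul1e -(@integral_cst _ _ _ leb3 _ measurable_pball 1%E).
have w0 p : (0 <= (polar_weight p)%:E * f (polar_point p))%E.
  by apply: mule_ge0; [rewrite lee_fin; exact: polar_weight_ge0|exact: f0].
have mw := measurable_fun_fubini_tonelli_F (m2 := mu) _ (measurable_polar_fun mf) w0.
apply: ge0_le_integral.
- exact: measurable_pball.
- move=> y _; apply: integral_ge0 => s _; apply: mule_ge0; last exact: f0.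
  by rewrite lee_fin sqr_ge0.
- apply: (eq_measurable_fun (fun y => \int[mu]_t ((polar_weight (y, t))%:E * f (polar_point (y, t))))%E).
    by move=> y yp; rewrite polar_innerE indicE yp mul1e.
  by apply: measurable_funTS; exact: mw.
- exact: measurable_cst.
- move=> y /andP[y0 _]; apply: le_trans (radial_kernel_mass r0 d0).
  pose h (t : R) := 3 * d * t ^+ 2 * (Num.sqrt (t ^+ 2 + d))^-1 ^+ 5.
  have h0 t : 0 <= h t.
    apply: mulr_ge0; first by apply: mulr_ge0; [rewrite mulr_ge0// ltW|exact: sqr_ge0].
    by apply: exprn_ge0; rewrite invr_ge0 sqrtr_ge0.
  have mh : measurable_fun setT (EFin \o h).
    apply/measurable_EFinP; apply: measurable_funM.
      by apply: measurable_funM; [exact: measurable_cst|exact: measurable_funX].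
    apply: measurable_funX; apply: measurable_inv; apply: measurable_sqrt.
    by apply: measurable_funD; [exact: measurable_funX|exact: measurable_cst].
  apply: (@le_trans _ _ (\int[mu]_(t in `]0%R, rho[) (h t)%:E)%E).
    rewrite le_eqVlt; apply/orP; left; apply/eqP.
    rewrite [LHS]integral_indic_mul [RHS]integral_indic_mul; apply: eq_integral => t _.
    rewrite !indicE.
    have -> : (t \in (`]0, +oo[%classic : set R)) = (0 < t).
      by apply/idP/idP; rewrite inE/= in_itv/= andbT.
    have -> : (t \in (`]0, rho[%classic : set R)) = (0 < t) && (t < rho).
      by apply/idP/idP; rewrite inE/= in_itv/=.
    have [t0|_] := ltP 0 t; last by rewrite !mul0e.
    rewrite /f -sqr_enorm.
    have -> : enorm ((t / enorm y) *: (y : R3 R)) = t.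
      by rewrite enormZ ger0_norm ?divr_ge0 ?ltW// divfK// gt_eqF.
    rewrite -!EFinM /h; congr EFin; rewrite mulr1n mul1r; case: (t < rho); rewrite ?mul0r ?mulr0//=.
    by rewrite mulr1n; ring.
  apply: ge0_subset_integral => //.
  - by apply: measurable_funTS; exact: mh.
  - by move=> t _; rewrite lee_fin.
  - by move=> t; rewrite /= !in_itv/= => /andP[/ltW-> /ltW->].
Qed.

End Kernel_mass.

(** * Propagation of an interior zero of a nonnegative harmonic function *)

Section Harmonic_zero.
Context {R : realType}.
Notation mR := (measurableTypeR R).
Implicit Types (x y : R3 R).

(** Multiplication by a continuous cutoff that is at least 1 on the ball reduces the claim to
    functions of bounded support. *)
Lemma continuous_ball_bounded (f : R3 R -> R) (M : R) : continuous f ->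
  exists2 C, 0 <= C & forall x, enorm x <= M -> `|f x| <= C.
Proof.
move=> cf; pose h x := f x * Num.max 0 (M + 1 - enorm x).
have ch : continuous h.
  move=> x; apply: cvgM; first exact: cf.
  apply: (@continuous_max _ _ (fun=> 0) (fun x => M + 1 - enorm x)); first exact: cvg_cst.
  by apply: cvgB; [exact: cvg_cst|exact: continuous_enorm].
have hM : vanish (M + 1) h.
  by move=> x xM; rewrite /h max_l ?mulr0// subr_le0.
have [C C0 hC] := vanish_bounded ch hM.
exists C => // x xM; apply: le_trans (hC x); rewrite /h normrM.
have x1 : 1 <= M + 1 - enorm x by lra.
have x0 : 0 <= M + 1 - enorm x by apply: le_trans x1.
by rewrite max_r// (ger0_norm x0) ler_peMr.
Qed.

Lemma continuous_enorm_ball (f : R3 R -> R) x (e : R) : continuous f -> 0 < e ->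
  exists2 d, 0 < d & forall y, enorm (y - x) < d -> `|f y - f x| < e.
Proof.
move=> cf e0; have /cvgrPdist_lt/(_ _ e0) := cf x.
move=> /nbhs_ballP[d/= d0 dB]; exists d => // y yx; rewrite distrC; apply: dB.
rewrite -ball_normE/= distrC; apply: le_lt_trans yx; exact: norm_le_enorm.
Qed.

Definition ball_at x (r : R) : set (borel3 R) := [set y : borel3 R | enorm ((y : R3 R) - x) < r].

Lemma measurable_ball_at x r : measurable (ball_at x r).
Proof.
apply: (@measurable_lt _ _ R (fun y : borel3 R => enorm ((y : R3 R) - x)) (cst r)) => //.
by apply: measurable_enorm; apply: measurable_add3.
Qed.

Lemma leb3_ball_at x r : leb3 (ball_at x r) = leb3 (oball r).
Proof. by have [_ /(_ _ (measurable_oball r)) <-] := leb3_translate (- x). Qed.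

Lemma leb3_oball_gt0 (r : R) : 0 < r -> (0 < leb3 (oball r))%E.
Proof.
(* Half-side r / 4: every point of the cube has Euclidean norm at most 3 r / 4. *)
move=> r0; pose h := r / 4; have h0 : 0 < h by rewrite divr_gt0.
pose I : set mR := `[- h, h]%classic.
have mI : measurable I by exact: measurable_itv.
have muI : (@lebesgue_measure R I = (h *+ 2)%:E)%E.
  by rewrite /I lebesgue_measure_itv/= lte_fin gtrN// -EFinB opprK -mulr2n.
apply: (@lt_le_trans _ _ (leb3 ((I `*` I) `*` I))).
  rewrite [X in (_ < X)%E](@product_measure1E _ _ _ _ _ (@leb2sf R) lebesgue_measure)//; last exact: measurableX.
  rewrite [X in (_ < X * _)%E](@product_measure1E _ _ _ _ _ lebesgue_measure lebesgue_measure)//.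
  apply: (@lt_le_trans _ _ ((h *+ 2)%:E * (h *+ 2)%:E * (h *+ 2)%:E)%E).
    by rewrite -!EFinM lte_fin !mulr_gt0// mulrn_wgt0.
  by rewrite le_eqVlt; apply/orP; left; apply/eqP; congr (_ * _ * _)%E; exact/esym/muI.
apply: le_measure; rewrite ?inE.
- by apply: measurableX => //; exact: measurableX.
- exact: measurable_oball.
move=> x [[/= a b] c]; rewrite /oball/=.
apply: (le_lt_trans (enorm_le_norm x)).
have : `|x| <= h.
  rewrite !prod_normE/= !ge_max; move: a b c; rewrite /I/= !in_itv/= -!ler_norml.
  by move=> -> -> ->.
by move=> xh; apply: (@le_lt_trans _ _ (3 * h)); [rewrite ler_wpM2l|rewrite /h; lra].
Qed.

Lemma quarter_bound (p k : R) : 0 <= p -> 0 <= k -> p / (4 * (k + 1)) * k <= p / 4.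
Proof.
by move=> p0 k0; rewrite mulrAC ler_pdivrMr ?mulr_gt0 ?ltr_wpDl//; nra.
Qed.

(** Testing against the bump gives equality of the integrals of g F'' |grad V|^2 and g F' 3 d V^5.
    If g were positive at y1, the first would stay above a constant independent of d. The second is
    small for small d, because its kernel concentrates at x0, where g vanishes. *)
Lemma superharmonic_zero (g : R3 R -> R) x0 (rho : R) : 0 < rho -> continuous g ->
  (forall y, 0 <= g y) -> g x0 = 0 ->
  (forall zeta : R3 R -> R, smooth zeta ->
    (forall y, rho <= enorm (y - x0) -> zeta y = 0) ->
    (\int[leb3]_y (g y * laplacian zeta y)%:E = 0)%E) ->
  forall y1, enorm (y1 - x0) < rho -> g y1 = 0.
Proof.
move=> r0 cg g0 gx0 Hg y1 y1r; apply: contrapT => /eqP gy1n.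
have gy1 : 0 < g y1 by rewrite lt_def gy1n g0.
pose b := enorm (y1 - x0).
have b0 : 0 < b.
  rewrite enorm_gt0 subr_eq0; apply/eqP => E; move: gy1; rewrite E gx0 ltxx//.
have br : b < rho by [].
have [eta1 eta10 Heta1] := continuous_enorm_ball y1 cg (divr_gt0 gy1 (ltr0n _ 2)).
(* The ball of radius eta around y1 keeps g at least g y1 / 2, stays at distance at least b / 2 from
   x0, and lies within distance rho1 < rho of x0. *)
pose eta : R := Num.min eta1 (Num.min (b / 2) ((rho - b) / 2)).
have eta0 : 0 < eta by rewrite !lt_min eta10 !divr_gt0// subr_gt0.
have etab : eta <= b / 2 by rewrite !ge_min lexx !orbT.
have etar : eta <= (rho - b) / 2 by rewrite !ge_min lexx !orbT.
pose gam := g y1 / 2; have gam0 : 0 < gam by rewrite divr_gt0.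
have Heta y : ball_at y1 eta y -> gam <= g y.
  rewrite /ball_at/= lt_min => /andP[/Heta1 + _]; rewrite ltr_distl => /andP[+ _].
  rewrite /gam; lra.
pose rho1 := (b + rho) / 2; pose rho2 := (rho1 + rho) / 2; pose tau := b / 2.
have tau0 : 0 < tau by rewrite divr_gt0.
have rho10 : 0 < rho1 by rewrite divr_gt0// addr_gt0.
have rho12 : rho1 < rho2 by rewrite /rho2 /rho1; lra.
have rho2r : rho2 < rho by rewrite /rho2 /rho1; lra.
have rho20 : 0 < rho2 by rewrite (lt_trans rho10).
have Hball y : ball_at y1 eta y -> tau <= enorm (y - x0) <= rho1.
  rewrite /ball_at/= => yy; have := dist_enorm (y - x0) (y1 - x0).
  rewrite opprB addrA subrK -/b ler_distl => /andP[h1 h2].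
  by apply/andP; split; rewrite /tau /rho1; lra.
(* For d <= d0 and |y - x0| <= rho1 one has |y - x0|^2 + d <= rho2^2, hence V >= 1 / rho2 and V - a
   >= t0. *)
pose d0 := rho2 ^+ 2 - rho1 ^+ 2.
have d00 : 0 < d0 by rewrite subr_gt0 ltr_pXn2r// ?nnegrE ltW.
pose t0 := rho2^-1 - rho^-1.
have t00 : 0 < t0 by rewrite subr_gt0 ltf_pV2.
(* Pointwise lower bound of g F'' |grad V|^2 on the ball around y1, uniform in d <= d0: it combines
   t0 <= V - a <= 1 / tau, |y - x0| >= tau and V >= 1 / rho. *)
pose kap := gam * ((tau ^+ 3 * expR (- t0^-1)) * (tau ^+ 2 * (rho^-1) ^+ 6)).
have kap0 : 0 < kap by rewrite !mulr_gt0 ?expR_gt0 ?exprn_gt0 ?invr_gt0.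
have [L LE L0] : exists2 L, leb3 (ball_at y1 eta) = L%:E & 0 < L.
  have := leb3_oball_gt0 eta0; have := leb3_oball_lty eta; rewrite -(leb3_ball_at y1).
  by case: (leb3 _) => [l _|//|//]; rewrite lte_fin => l0; exists l.
have [L2 L2E L20] : exists2 L, leb3 (ball_at x0 rho) = L%:E & 0 < L.
  have := leb3_oball_gt0 r0; have := leb3_oball_lty rho; rewrite -(leb3_ball_at x0).
  by case: (leb3 _) => [l _|//|//]; rewrite lte_fin => l0; exists l.
have [K KE K0] : exists2 K, (3%:E * leb3 (@pball R) = K%:E)%E & 0 <= K.
  have := @leb3_pball_lty R; have : (0 <= leb3 (@pball R))%E by exact: measure_ge0.
  by case: (leb3 _) => [l l0 _|//|//]; exists (3 * l); rewrite // mulr_ge0.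
have [G G0 HG] := continuous_ball_bounded (enorm x0 + rho) cg.
(* P is the lower bound of the first integral. The second is split at distance del from x0: eps
   bounds g on the inner part and a small d bounds the kernel on the outer part, each contributing
   at most P / 4. *)
pose P := kap * L; have P0 : 0 < P by rewrite mulr_gt0.
pose eps := P / (4 * (K + 1)).
have eps0 : 0 < eps by rewrite divr_gt0// mulr_gt0// ltr_wpDl.
have epsK : eps * K <= P / 4.
  by apply: quarter_bound; [exact: ltW|exact: K0].
have [del del0 Hdel] := continuous_enorm_ball x0 cg eps0.
(* On the outer part V <= 1 / del, so the contribution is at most d times this constant. *)
pose cc := G * 3 * (del^-1) ^+ 5 * L2.
have di : 0 <= del^-1 ^+ 5 by apply: exprn_ge0; rewrite invr_ge0 ltW.
have g3 : 0 <= G * 3 by rewrite mulr_ge0.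
have cc0 : 0 <= cc.
  by apply: mulr_ge0; [apply: mulr_ge0; [exact: g3|exact: di]|exact: ltW].
pose d : R := Num.min d0 (P / (4 * (cc + 1))).
have dp : 0 < d by rewrite lt_min d00 divr_gt0// mulr_gt0// ltr_wpDl.
have dd0 : d <= d0 by rewrite ge_min lexx.
have dcc : cc * d <= P / 4.
  apply: (@le_trans _ _ (cc * (P / (4 * (cc + 1))))); first by rewrite ler_wpM2l// ge_min lexx orbT.
  by rewrite mulrC; apply: quarter_bound; [exact: ltW|exact: cc0].
pose a := rho^-1; pose V := bump_pot x0 d; pose zeta := exp_bump x0 a d.
have Vout y : rho <= enorm (y - x0) -> V y <= a by exact: bump_pot_le.
have vM : forall y, enorm x0 + rho <= enorm y -> rho <= enorm (y - x0).
  move=> y yM; have := enormD (y - x0) x0; rewrite subrK => H.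
  by rewrite -(lerD2r (enorm x0)) addrC (le_trans yM).
pose Bf y := g y * (bump_slope x0 a d y * (3 * d * V y ^+ 5)).
pose Af y := g y * (flat_exp 3 (V y - a) * (dot (y - x0) (y - x0) * V y ^+ 6)).
have sz := smooth_bump x0 a dp.
have cV : continuous V by exact: continuous_bump_pot.
have cB : continuous Bf.
  move=> y; apply: cvgM; first exact: cg.
  apply: cvgM.
    by apply: cvgD; apply: (Cn_continuous (Cn_flat_bump x0 a dp 0 _)).
  apply: cvgMr; apply: (@continuous_comp _ _ _ V (fun t : R => t ^+ 5)); first exact: cV.
  exact: exprn_continuous.
have vB : vanish (enorm x0 + rho) Bf.
  by move=> y /vM/Vout Vy; rewrite /Bf bump_slope_eq0// mul0r mulr0.
have iB := continuous_vanish_integrable cB vB.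
have cL : continuous (fun y => g y * laplacian zeta y).
  by move=> y; apply: cvgM; [exact: cg|exact: (continuous_laplacian sz)].
have lapE y : g y * laplacian zeta y = Af y - Bf y.
  by rewrite (laplacian_bump x0 a dp) mulrBr.
have vL : vanish (enorm x0 + rho) (fun y => g y * laplacian zeta y).
  move=> y /[dup] yM /vM/Vout Vy; rewrite lapE vB// subr0 /Af /flat_exp ltNge subr_le0 Vy/=.
  by rewrite mul0r mulr0.
have iL := continuous_vanish_integrable cL vL.
have AE y : (Af y)%:E = ((g y * laplacian zeta y)%:E + (Bf y)%:E)%E.
  by rewrite -EFinD lapE subrK.
have zL : (\int[leb3]_y (g y * laplacian zeta y)%:E = 0)%E.
  by apply: Hg => // y /Vout; exact: bump_eq0.
have AB : (\int[leb3]_y (Af y)%:E = \int[leb3]_y (Bf y)%:E)%E.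
  transitivity (\int[leb3]_y ((g y * laplacian zeta y)%:E + (Bf y)%:E))%E.
    by apply: eq_integral => y _; exact: AE.
  by rewrite (integralD measurableT iL iB) zL add0e.
have A0 y : 0 <= Af y.
  apply: mulr_ge0; first exact: g0.
  apply: mulr_ge0; first exact: flat_exp_ge0.
  apply: mulr_ge0; first exact: dot_ge0.
  by apply: exprn_ge0; rewrite ltW// bump_pot_gt0.
have cA : continuous Af.
  move=> y; rewrite (_ : Af = fun y => g y * laplacian zeta y + Bf y).
    by apply: cvgD; [exact: cL|exact: cB].
  by apply/funext => z; rewrite lapE subrK.
have lower : ((kap * L)%:E <= \int[leb3]_y (Af y)%:E)%E.
  rewrite EFinM -LE -(@integral_cst _ _ _ leb3 _ (measurable_ball_at y1 eta) kap%:E).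
  apply: (@le_trans _ _ (\int[leb3]_(y in ball_at y1 eta) (Af y)%:E)%E); last first.
    apply: ge0_subset_integral => //; first exact: measurable_ball_at.
      by apply/measurable_EFinP; exact: continuous_measurable_R3.
    by move=> y _; rewrite lee_fin.
  apply: ge0_le_integral.
  - exact: measurable_ball_at.
  - by move=> y _; rewrite /= lee_fin ltW.
  - exact: measurable_cst.
  - by apply/measurable_EFinP; apply: measurable_funTS; exact: continuous_measurable_R3.
  move=> y yS; have /andP[ty yr1] := Hball _ yS; have gy := Heta _ yS.
  rewrite /= lee_fin /kap /Af.
  have Vge : rho2^-1 <= V y.
    apply: bump_pot_ge => //.
    have : enorm (y - x0) ^+ 2 <= rho1 ^+ 2.
      by rewrite ler_pXn2r// nnegrE ?enorm_ge0 ?ltW.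
    by move: dd0; rewrite /d0 => h1 h2; rewrite -lerBrDl (le_trans h1)// lerB.
  have Vle : V y <= tau^-1 by exact: bump_pot_le.
  have Vr : rho^-1 <= V y by apply: le_trans Vge; rewrite lef_pV2 ?posrE// ltW.
  have t0V : t0 <= V y - a by rewrite /t0 /a lerB.
  have Vp : 0 < V y - a by rewrite (lt_le_trans t00).
  have Vt : V y - a <= tau^-1.
    by apply: le_trans Vle; rewrite gerBl invr_ge0 ltW.
  have tV : tau <= (V y - a)^-1.
    by rewrite -(invrK tau) lef_pV2 ?posrE// invr_gt0.
  apply: ler_pM.
  - exact: ltW.
  - apply: mulr_ge0; first by apply: mulr_ge0; [apply: exprn_ge0; exact: ltW|exact: expR_ge0].
    by apply: mulr_ge0; apply: exprn_ge0; rewrite ?invr_ge0 ltW.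
  - exact: gy.
  apply: ler_pM.
  - by apply: mulr_ge0; [apply: exprn_ge0; exact: ltW|exact: expR_ge0].
  - by apply: mulr_ge0; apply: exprn_ge0; rewrite ?invr_ge0 ltW.
  - rewrite /flat_exp Vp; apply: ler_pM.
    + by apply: exprn_ge0; exact: ltW.
    + exact: expR_ge0.
    + by rewrite ler_pXn2r// nnegrE ltW// invr_gt0.
    + by rewrite ler_expR lerN2 lef_pV2 ?posrE.
  apply: ler_pM.
  - by apply: exprn_ge0; exact: ltW.
  - by apply: exprn_ge0; rewrite invr_ge0 ltW.
  - by rewrite -sqr_enorm ler_pXn2r// nnegrE ?enorm_ge0// ltW.
  - have V0 : 0 <= V y by rewrite ltW// bump_pot_gt0.
    by rewrite ler_pXn2r// nnegrE invr_ge0 ltW.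
have upper : (\int[leb3]_y (Bf y)%:E <= (eps * K + cc * d)%:E)%E.
  have -> : (\int[leb3]_y (Bf y)%:E = \int[leb3]_(y in ball_at x0 rho) (Bf y)%:E)%E.
    rewrite [RHS]integral_indic_mul; apply: eq_integral => y _.
    have [yB|yB] := boolP (y \in ball_at x0 rho); rewrite indicE.
      by rewrite yB mul1e.
    rewrite (negbTE yB) mul0e; congr EFin.
    move: yB; rewrite notin_setE/= /ball_at/= => /negP; rewrite -leNgt => /Vout Vy.
    by rewrite /Bf bump_slope_eq0// mul0r mulr0.
  pose k y := 3 * d * V y ^+ 5.
  have k0 y : 0 <= k y.
    by apply: mulr_ge0; [rewrite mulr_ge0// ltW|apply: exprn_ge0; rewrite ltW// bump_pot_gt0].
  have mk : measurable_fun (ball_at x0 rho) (fun y => (k y)%:E).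
    apply/measurable_EFinP; apply: measurable_funTS; apply: continuous_measurable_R3 => y.
    apply: cvgMr; apply: (@continuous_comp _ _ _ V (fun t : R => t ^+ 5)); first exact: cV.
    exact: exprn_continuous.
  pose c := d * (G * 3 * (del^-1) ^+ 5).
  have c0 : 0 <= c by apply: mulr_ge0; [exact: ltW|apply: mulr_ge0; [exact: g3|exact: di]].
  have mE := measurable_ball_at x0 rho.
  apply: (@le_trans _ _ (\int[leb3]_(y in ball_at x0 rho) (eps%:E * (k y)%:E + cst c%:E y))%E).
    apply: ge0_le_integral => //.
    - move=> y _; rewrite lee_fin; apply: mulr_ge0; first exact: g0.
      by apply: mulr_ge0; [exact: bump_slope_ge0|exact: k0].
    - by apply/measurable_EFinP; apply: measurable_funTS; exact: continuous_measurable_R3.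
    - by apply: emeasurable_funD; [apply: emeasurable_funM => //|].
    move=> y yB; rewrite /= -EFinM -EFinD lee_fin /Bf -/(k y).
    have s1 : bump_slope x0 a d y * k y <= k y by rewrite ler_piMl// bump_slope_le1.
    apply: (@le_trans _ _ (g y * k y)); first by rewrite ler_wpM2l.
    have [yd|dy] := ltP (enorm (y - x0)) del.
      have := Hdel _ yd; rewrite gx0 subr0 ger0_norm// => /ltW ge.
      by apply: (@le_trans _ _ (eps * k y)); [rewrite ler_wpM2r|rewrite lerDl].
    have gG : g y <= G.
      rewrite -(ger0_norm (g0 y)); apply: HG.
      move: yB; rewrite /ball_at/= => /ltW yB; have := enormD (y - x0) x0; rewrite subrK => h.
      by rewrite addrC; apply: le_trans h _; rewrite lerD2r.
    have kd : k y <= 3 * d * del^-1 ^+ 5.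
      have Vd : V y <= del^-1 by exact: bump_pot_le.
      have V0 : 0 <= V y by rewrite ltW// bump_pot_gt0.
      have del0' : 0 <= del^-1 by rewrite invr_ge0 ltW.
      have V5 : V y ^+ 5 <= del^-1 ^+ 5 by rewrite ler_pXn2r.
      by apply: ler_wpM2l V5; apply: mulr_ge0; [exact: ler0n|exact: ltW].
    apply: (@le_trans _ _ c); last by rewrite lerDr mulr_ge0// ltW.
    apply: le_trans (ler_pM (g0 y) (k0 y) gG kd) _.
    by rewrite le_eqVlt; apply/orP; left; apply/eqP; rewrite /c; ring.
  rewrite ge0_integralD//; last 2 first.
  - by move=> y _; apply: mule_ge0; rewrite lee_fin// ltW.
  - by apply: emeasurable_funM.
  rewrite ge0_integralZl//; last 2 first.
  - by move=> y _; rewrite lee_fin.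
  - by rewrite lee_fin ltW.
  rewrite integral_cst// L2E EFinD; apply: leeD.
    have hK : (\int[leb3]_(y in ball_at x0 rho) (k y)%:E <= K%:E)%E.
      by rewrite -KE; exact: kernel_mass.
    have e0 : (0 <= eps%:E)%E by rewrite lee_fin ltW.
    exact: (lee_wpmul2l e0 hK).
  by rewrite -EFinM lee_fin le_eqVlt; apply/orP; left; apply/eqP; rewrite /c /cc; ring.
have : P <= eps * K + cc * d by rewrite -lee_fin (le_trans lower)// AB.
have {}h : eps * K + cc * d <= P / 4 + P / 4 by exact: lerD.
have half (p : R) : 0 < p -> p <= p / 4 + p / 4 -> False by clear; lra.
by move=> /le_trans/(_ h); exact: half.
Qed.

End Harmonic_zero.

(** * Maximum principle and uniqueness of the exterior solution *)

Section Uniqueness.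
Context {R : realType}.
Implicit Types (x y : R3 R).

(** The shell formula for a sphere enclosing the support: there the potential is the constant 1 / s
    wherever the Laplacian is nonzero, and eta vanishes on the sphere. *)
Lemma integral_laplacian_eq0 M (eta : R3 R -> R) : smooth eta -> vanish M eta ->
  (\int[leb3]_x (laplacian eta x)%:E = 0)%E.
Proof.
move=> sE eM; pose s := `|M| + 2.
have s0 : 0 < s by rewrite ltr_wpDl.
have Ms : M + 1 + 1 <= s by rewrite /s -addrA lerD// ler_norm.
have lM := vanish_laplacian eM; have cl := continuous_laplacian sE.
have il := continuous_vanish_integrable cl lM.
have := integral_shell_pot_laplacian s0 sE eM.
have -> : (\int[leb3]_x (shell_pot s x * laplacian eta x)%:E =
    (s^-1)%:E * \int[leb3]_x (laplacian eta x)%:E)%E.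
  rewrite -(integralZl measurableT il); apply: eq_integral => x _; rewrite -EFinM.
  have [xs|sx] := leP (enorm x) s; first by rewrite /shell_pot max_r.
  by rewrite lM ?mulr0// (le_trans Ms)// ltW.
rewrite (_ : \int[leb3]_(y in pball) _ = 0)%E.
  rewrite mule0 => /eqP; rewrite mule_eq0 => /orP[|/eqP//].
  by rewrite eqe invr_eq0 gt_eqF.
apply: integral0_eq => y /= /andP[y0 _]; rewrite eM ?oppr0//.
rewrite enormZ gtr0_norm; last exact: divr_gt0.
rewrite divfK ?gt_eqF//.
by apply: le_trans Ms; rewrite -addrA lerDl.
Qed.

Lemma weak_maximum_principle (w : R3 R -> R) (r : R) : 0 < r -> continuous w ->
  vanishes_at_infinity w -> (forall x, oball r x -> w x = 0) ->
  (forall zeta : R3 R -> R, test_function (~` cball r) zeta ->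
    (\int[leb3]_y (w y * laplacian zeta y)%:E = 0)%E) ->
  forall x, w x <= 0.
Proof.
move=> r0 cw w_oo w0 Hw x1; rewrite leNgt; apply/negP => wx1.
have [N HN] := w_oo _ wx1.
have wN y : w x1 <= w y -> enorm y <= N.
  move=> wy; rewrite leNgt; apply/negP => /HN; apply/negP; rewrite -leNgt.
  by rewrite (le_trans wy)// ler_norm.
pose K : set (R3 R) := (`[- N, N] `*` `[- N, N]) `*` `[- N, N].
have cK : compact K.
  by apply: compact_setX; first apply: compact_setX; exact: segment_compact.
have KN y : enorm y <= N -> K y.
  move=> yN; have [a b c] := coord_le_enorm y.
  by split; [split|]; rewrite /= in_itv/= -ler_norml; apply: le_trans yN.
have K0 : K !=set0 by exists x1; apply/KN/wN.
have [xm xmK xmax] := @compact_EVT_max _ R w K K0 cK (continuous_subspaceT cw).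
pose M := w xm.
have wM y : w y <= M.
  have [yN|Ny] := leP (enorm y) N; first by apply: xmax; rewrite inE; exact: KN.
  have wx1M : w x1 <= M by apply: xmax; rewrite inE; apply/KN/wN.
  apply: le_trans wx1M; rewrite leNgt; apply/negP => /ltW/wN.
  by rewrite leNgt Ny.
have M0 : 0 < M by rewrite (lt_le_trans wx1).
pose S := K `&` (w @^-1` [set M]).
have cS : compact S.
  apply: (@subclosed_compact _ _ K) => //; last exact: subIsetl.
  apply: closedI; first exact: (compact_closed (@norm_hausdorff _ _) cK).
  by apply: closed_comp => [y _|]; [exact: cw|exact: closed_eq].
have S0 : S !=set0 by exists xm; split => //; move: xmK; rewrite inE.
have [x0 x0S far] := @compact_EVT_max _ R (@enorm R) S S0 cS (continuous_subspaceT (@continuous_enorm R)).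
have wx0 : w x0 = M by move: x0S; rewrite inE => -[].
(* Inside the ball w is 0; a maximum point with |x0| = r is excluded by continuity along the segment
   from the origin to x0. *)
have rx0 : r < enorm x0.
  rewrite ltNge; apply/negP => xr.
  have wt : (fun t : R => w (t *: x0)) t @[t --> 1^'-] --> w x0.
    rewrite -[in w x0](scale1r x0).
    apply: cvg_at_left_filter.
    apply: (@continuous_comp _ _ _ (fun t : R => t *: x0) w); last exact: cw.
    exact: scalel_continuous.
  have wt0 : (fun t : R => w (t *: x0)) t @[t --> 1^'-] --> (0 : R).
    apply: (@cvg_trans _ ((fun=> 0 : R) @ 1^'-)); last exact: cvg_cst.
    apply: near_eq_cvg; near=> t.
    rewrite w0// /oball/= enormZ.
    have t1 : t < 1 by near: t; exact: nbhs_left_lt.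
    have t0 : 0 < t by near: t; exact: nbhs_left_gt.
    rewrite gtr0_norm//; apply: (@le_lt_trans _ _ (t * r)); first by rewrite ler_pM2l.
    by rewrite -[ltRHS]mul1r ltr_pM2r.
  have : w x0 = 0.
    apply: (@cvg_unique _ _ (w (t *: x0) @[t --> 1^'-])); [exact: norm_hausdorff|exact: wt|exact: wt0].
  by rewrite wx0; apply/eqP; rewrite gt_eqF.
(* Half the distance from x0 to the ball, so that the closed ball of radius rho around x0 avoids the
   closed ball of radius r and supports admissible test functions. *)
pose rho := (enorm x0 - r) / 2.
have rho0 : 0 < rho by rewrite divr_gt0// subr_gt0.
have x00 : 0 < enorm x0 by rewrite (lt_trans r0).
pose g y := M - w y.
have cg : continuous g by move=> y; apply: cvgB; [exact: cvg_cst|exact: cw].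
have g0 y : 0 <= g y by rewrite subr_ge0.
have gx0 : g x0 = 0 by rewrite /g wx0 subrr.
have Hg zeta : smooth zeta -> (forall y, rho <= enorm (y - x0) -> zeta y = 0) ->
    (\int[leb3]_y (g y * laplacian zeta y)%:E = 0)%E.
  move=> sz z0.
  have vz : vanish (enorm x0 + rho) zeta.
    move=> y yM; apply: z0; have := enormD (y - x0) x0; rewrite subrK => H.
    by rewrite -(lerD2r (enorm x0)) addrC (le_trans yM).
  have sub : supp zeta `<=` [set y | enorm (y - x0) <= rho].
    rewrite /supp (closure_id [set y | enorm (y - x0) <= rho]).1.
      by apply: closure_subset => y /= zy; rewrite leNgt; apply/negP => /ltW/z0.
    apply: (@closed_comp _ _ (fun y => enorm (y - x0)) [set t | t <= rho]); last exact: closed_le.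
    move=> y _; apply: (@continuous_comp _ _ _ (fun y => y - x0) (@enorm R)).
      by apply: cvgB; [exact: cvg_id|exact: cvg_cst].
    exact: continuous_enorm.
  have tz : test_function (~` cball r) zeta.
    split => //.
      pose B : set (R3 R) := (`[- (enorm x0 + rho), enorm x0 + rho] `*` `[- (enorm x0 + rho), enorm x0 + rho]) `*` `[- (enorm x0 + rho), enorm x0 + rho].
      apply: (@subclosed_compact _ _ B); first exact: closed_closure.
        by apply: compact_setX; first apply: compact_setX; exact: segment_compact.
      move=> y /sub/= yr; have yN : enorm y <= enorm x0 + rho.
        by have := enormD (y - x0) x0; rewrite subrK addrC => /le_trans; apply; rewrite lerD2l.
      have [a b c] := coord_le_enorm y.
      by split; [split|]; rewrite /= in_itv/= -ler_norml; apply: le_trans yN.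
    move=> y /sub/= yr; rewrite /cball/= => yr'.
    have := enormD (x0 - y) y; rewrite subrK -(enormN (x0 - y)) opprB /= => h.
    have := le_trans h (lerD yr yr'); rewrite leNgt => /negP; apply.
    by rewrite -ltrBrDr /rho ltr_pdivrMr// mulr_natr mulr2n ltrDl subr_gt0.
  have cl := continuous_laplacian sz; have vl := vanish_laplacian vz.
  have il := continuous_vanish_integrable cl vl.
  have iw : leb3.-integrable setT (fun y : borel3 R => (w y * laplacian zeta y)%:E).
    apply: (@continuous_vanish_integrable _ (enorm x0 + rho + 1 + 1)).
      by move=> y; apply: cvgM; [exact: cw|exact: cl].
    by move=> y /vl ->; rewrite mulr0.
  transitivity (\int[leb3]_y (M%:E * (laplacian zeta y)%:E - (w y * laplacian zeta y)%:E))%E.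
    by apply: eq_integral => y _; rewrite -EFinM -EFinB /g mulrBl.
  rewrite (integralB measurableT (integrableZl measurableT M il) iw).
  by rewrite (integralZl measurableT il) (integral_laplacian_eq0 sz vz) (Hw _ tz) mule0 sube0.
(* The point x0 moved outwards by rho / 2: the zero of M - w spreads to it, against the choice of x0
   as farthest maximum point. *)
pose y1 := (1 + rho / 2 / enorm x0) *: x0.
have q0 : 0 < rho / 2 / enorm x0 by apply: divr_gt0 => //; apply: divr_gt0.
have gy1 : g y1 = 0.
  apply: (superharmonic_zero rho0 cg g0 gx0 Hg).
  rewrite /y1 scalerDl scale1r addrAC subrr add0r enormZ gtr0_norm//.
  rewrite divfK ?gt_eqF// ltr_pdivrMr//.
  by rewrite mulr_natr mulr2n ltrDl.
have wy1 : w y1 = M by move/eqP: gy1; rewrite subr_eq0 => /eqP.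
have : enorm y1 <= enorm x0.
  apply: far; rewrite inE; split => //; apply/KN/wN.
  by rewrite wy1; exact: wM.
rewrite leNgt => /negP; apply; rewrite /y1 enormZ gtr0_norm ?addr_gt0//.
by rewrite mulrDl mul1r ltrDl mulr_gt0.
Unshelve. all: by end_near. Qed.

Lemma exterior_solution_unique (om : R3 R -> R) (r : R) (U1 U2 : R3 R -> R) : 0 < r ->
  exterior_solution om r U1 -> exterior_solution om r U2 -> U1 = U2.
Proof.
move=> r0.
suff le12 V1 V2 : exterior_solution om r V1 -> exterior_solution om r V2 ->
    forall x, V1 x - V2 x <= 0.
  move=> s1 s2; apply/funext => x; apply/eqP; rewrite eq_le.
  have := le12 _ _ s1 s2 x; have := le12 _ _ s2 s1 x; rewrite !subr_le0 => -> ->.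
  by [].
move=> [c1 d1 z1 i1] [c2 d2 z2 i2].
apply: (@weak_maximum_principle (fun x => V1 x - V2 x) r r0).
- by move=> x; apply: cvgB; [exact: c1|exact: c2].
- move=> e e0; have e20 : 0 < e / 2 by rewrite divr_gt0.
  have [M1 H1] := i1 _ e20; have [M2 H2] := i2 _ e20.
  exists (Num.max M1 M2) => x; rewrite gt_max => /andP[/H1 h1 /H2 h2].
  rewrite (splitr e); apply: le_lt_trans (ltrD h1 h2); exact: ler_normB.
- by move=> x xr; rewrite z1// z2// subrr.
move=> zeta tz; have [sz cz _] := tz.
have [M M0 vz] := compact_supp_vanish cz.
have iV (V : R3 R -> R) : continuous V -> leb3.-integrable setT (fun y : borel3 R => (V y * laplacian zeta y)%:E).
  move=> cV; apply: (@continuous_vanish_integrable _ (M + 1 + 1)).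
    by move=> y; apply: cvgM; [exact: cV|exact: (continuous_laplacian sz)].
  by move=> y /(vanish_laplacian vz) ->; rewrite mulr0.
have E : \int[leb3]_x (V1 x * laplacian zeta x) = \int[leb3]_x (V2 x * laplacian zeta x).
  by have := d1 _ tz; have := d2 _ tz; rewrite /distr_laplacian /distr_fun => <-.
have [f1 f2] := (integrable_fin_num measurableT (iV _ c1), integrable_fin_num measurableT (iV _ c2)).
transitivity (\int[leb3]_y ((V1 y * laplacian zeta y)%:E - (V2 y * laplacian zeta y)%:E))%E.
  by apply: eq_integral => y _; rewrite -EFinB mulrBl.
rewrite (integralB measurableT (iV _ c1) (iV _ c2)).
move: E; rewrite /Rintegral => E.
by rewrite -(fineK f1) -(fineK f2) E subee.
Qed.

End Uniqueness.

(** * The superposed potential of the annulus and the sphere *)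

Section Potential.
Context {R : realType}.
Notation mR := (measurableTypeR R).
Notation mu := (@lebesgue_measure R).
Implicit Types (x y : R3 R).

Lemma is_derive_continuous (F f : R -> R) :
  (forall t, is_derive t (1:R) F (f t)) -> continuous F.
Proof.
by move=> dF t; have [d _] := dF t; exact/differentiable_continuous/derivable1_diffP.
Qed.

Lemma integral_is_derive (F f : R -> R) (a b : R) : a <= b -> continuous f ->
  (forall t, is_derive t (1:R) F (f t)) ->
  (\int[mu]_(t in `[a, b]) (f t)%:E = (F b - F a)%:E)%E.
Proof.
rewrite le_eqVlt => /predU1P[->|ab] cf dF.
  by rewrite set_itv1 integral_set1 subrr.
have cF := is_derive_continuous dF.
rewrite EFinB (@continuous_FTC2 _ f F a b ab) //.
- exact: continuous_subspaceT.
- split=> [t _||]; first by have [] := dF t.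
    exact: cvg_at_right_filter (cF a).
  exact: cvg_at_left_filter (cF b).
- by move=> t _; rewrite derive1E; have [_] := dF t.
Qed.

Lemma continuous_enorm_vanish_integrable (f : R3 R -> R) (M : R) (g : borel3 R -> R) :
  measurable_fun setT g -> (forall x, 0 <= g x <= 1) -> continuous f -> vanish M f ->
  leb3.-integrable setT (fun x : borel3 R => (g x * f x)%:E).
Proof.
move=> mg g01 cf fM; have [C C0 fC] := vanish_bounded cf fM.
apply: (@integrable_bounded_support _ (fun x => g x * f x) C M).
- by apply: measurable_funM => //; exact: continuous_measurable_R3.
- move=> x; rewrite normrM; have /andP[g0 g1] := g01 x.
  by rewrite (ger0_norm g0) (le_trans _ (fC x))// ler_piMl.
- by move=> x /fM ->; rewrite mulr0.
Qed.

Lemma integrable_pball (h : borel3 R -> R) (C : R) :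
  measurable_fun setT h -> (forall y, `|h y| <= C) ->
  leb3.-integrable (@pball R) (EFin \o h).
Proof.
move=> mh hC; apply: measurable_bounded_integrable.
- exact: measurable_pball.
- exact: leb3_pball_lty.
- exact: measurable_funTS.
- exists C; split; first exact: num_real.
  by move=> M CM y _; rewrite /= (le_trans (hC y))// ltW.
Qed.

Variable r : R.
Hypothesis r02 : 0 < r <= 2.
Let r0 : 0 < r. Proof. by case/andP: r02. Qed.
Let r2 : r <= 2. Proof. by case/andP: r02. Qed.

(** |x| clamped to [r, 2]: the radius separating the shells that enclose x from those that do
    not. *)
Definition annulus_cut x : R := Num.min (Num.max (enorm x) r) 2.

Definition annulus_pot x : R :=
  (annulus_cut x ^+ 3 - r ^+ 3) / 3 * shell_pot r x + (4 - annulus_cut x ^+ 2) / 2.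

Lemma measurable_shell_weight x :
  measurable_fun setT (fun s : mR => s ^+ 2 * shell_pot s x).
Proof.
apply: measurable_funM; first by meas.
rewrite /shell_pot; apply: measurable_inv.
by apply: (@measurable_maxr _ mR R setT (cst (enorm x)) id).
Qed.

(** Splitting at q = [annulus_cut x]: for r <= s <= q the maximum of |x| and s equals that of |x|
    and r, and for q < s <= 2 it equals s. *)
Lemma annulus_pot_integral x :
  (\int[mu]_(s in `[r, 2%R[) (s ^+ 2 * shell_pot s x)%:E = (annulus_pot x)%:E)%E.
Proof.
pose q := annulus_cut x.
have rq : r <= q by rewrite /q /annulus_cut le_min r2 le_max lexx orbT.
have q2 : q <= 2 by rewrite /q /annulus_cut ge_min lexx orbT.
have m3E (D : set mR) : measurable_fun D (fun s => (s ^+ 2 * shell_pot s x)%:E).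
  by apply/measurable_EFinP; apply: measurable_funTS; exact: measurable_shell_weight.
rewrite integral_itv_bndo_bndc//.
have -> : (`[r, 2] = `[r, q] `|` `]q, 2] :> set mR)%classic.
  by rewrite -itv_bndbnd_setU// bnd_simp.
rewrite (@integral_setU _ _ _ mu _ _ _ (measurable_itv _) (measurable_itv _) (m3E _)); last first.
  rewrite disj_set2E; apply/eqP; apply/seteqP; split => s //=; rewrite !in_itv/=.
  by move=> [/andP[_ sq] /andP[qs _]]; move: (lt_le_trans qs sq); rewrite ltxx.
have -> : (\int[mu]_(s in `[r, q]) (s ^+ 2 * shell_pot s x)%:E =
    ((q ^+ 3 - r ^+ 3) / 3 * shell_pot r x)%:E)%E.
  transitivity (\int[mu]_(s in `[r, q]) (s ^+ 2 * shell_pot r x)%:E)%E.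
    apply: eq_integral => s; rewrite inE/= in_itv/= => /andP[rs sq].
    congr (_ * _)%:E; rewrite /shell_pot; congr _^-1.
    have : s <= Num.max (enorm x) r by rewrite (le_trans sq)// /q /annulus_cut ge_min lexx.
    rewrite le_max => /orP[sx|sr]; first by rewrite !max_l// (le_trans rs).
    by rewrite (@le_anti _ _ s r) ?sr.
  have dF (t : R) : is_derive t (1:R) (fun t => t ^+ 3 / 3 * shell_pot r x) (t ^+ 2 * shell_pot r x).
    by apply: is_derive_eq; rewrite /GRing.scale/=; field.
  rewrite (integral_is_derive rq _ dF); first by congr EFin; rewrite -mulrBl -mulrBl.
  move=> t; apply: cvgMl; exact: exprn_continuous.
have -> : (\int[mu]_(s in `]q, 2%R]) (s ^+ 2 * shell_pot s x)%:E = ((4 - q ^+ 2) / 2)%:E)%E.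
  transitivity (\int[mu]_(s in `]q, 2%R]) s%:E)%E.
    apply: eq_integral => s; rewrite inE/= in_itv/= => /andP[qs s2].
    have s0 : 0 < s by rewrite (lt_trans _ qs)// (lt_le_trans r0).
    rewrite /shell_pot max_r; first by rewrite expr2 mulfK// gt_eqF.
    apply: le_trans (ltW qs); rewrite /q /annulus_cut le_min le_max lexx/=.
    rewrite leNgt; apply/negP => x2; move: qs; rewrite /q /annulus_cut min_r ?ltNge ?s2//.
    by rewrite le_max ltW.
  have mid (D : set mR) : measurable_fun D (fun s : mR => s%:E).
    by apply/measurable_EFinP.
  rewrite integral_itv_obnd_cbnd//.
  have dF (t : R) : is_derive t (1:R) (fun t => t ^+ 2 / 2) t.
    by apply: is_derive_eq; rewrite /GRing.scale/=; field.
  rewrite (integral_is_derive q2 _ dF); last by move=> ?; exact: cvg_id.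
  by congr EFin; rewrite -/q; field.
  by rewrite -EFinD.
exact: m3E.
Qed.

Lemma continuous_annulus_pot : continuous annulus_pot.
Proof.
have cq : continuous annulus_cut.
  move=> x; apply: (@continuous_min _ _ (fun x => Num.max (enorm x) r) (fun=> 2)); last exact: cvg_cst.
  by apply: continuous_max; [exact: continuous_enorm|exact: cvg_cst].
have cqn n : continuous (fun x => annulus_cut x ^+ n).
  by move=> x; apply: (@continuous_comp _ _ _ annulus_cut (fun t : R => t ^+ n)); [exact: cq|exact: exprn_continuous].
move=> x; apply: cvgD.
  apply: cvgM; last exact: (continuous_shell_pot r0).
  by apply: cvgMl; apply: cvgB; [exact: cqn|exact: cvg_cst].
by apply: cvgMl; apply: cvgB; [exact: cvg_cst|exact: cqn].
Qed.

(* [2 * r - r ^+ 3 / 2] is the shell density [2 / r - r / 2] times [r ^+ 2]. *)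
Definition exterior_pot x : R := (2 * r - r ^+ 3 / 2) * shell_pot r x - annulus_pot x.

Lemma continuous_exterior_pot : continuous exterior_pot.
Proof.
move=> x; apply: cvgB; last exact: continuous_annulus_pot.
by apply: cvgMr; exact: (continuous_shell_pot r0).
Qed.

Lemma exterior_pot_eq0 x : enorm x <= r -> exterior_pot x = 0.
Proof.
move=> xr; rewrite /exterior_pot /annulus_pot /annulus_cut /shell_pot max_r// min_l//.
by field; rewrite gt_eqF.
Qed.

Lemma exterior_pot_vanishes : vanishes_at_infinity exterior_pot.
Proof.
(* Beyond radius 2 the potential is A / |x|, with A the net charge of the sphere minus the annulus,
   up to the constant 4 pi. *)
move=> eps e0; pose A := 2 * r - r ^+ 3 / 2 - (8 - r ^+ 3) / 3.
exists (Num.max 2 (`|A| / eps)) => x; rewrite gt_max => /andP[x2 xA].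
have x0 : 0 < enorm x by rewrite (lt_trans _ x2).
have -> : exterior_pot x = A / enorm x.
  rewrite /exterior_pot /annulus_pot /annulus_cut /shell_pot max_l; last first.
    by rewrite (le_trans r2)// ltW.
  by rewrite min_r ?ltW// /A; field; rewrite gt_eqF.
rewrite normrM normfV (gtr0_norm x0) ltr_pdivrMr// mulrC.
by move: xA; rewrite ltr_pdivrMr.
Qed.

Definition annulus_ind (s : R) : R := ((r <= s) && (s < 2))%R%:R.

Lemma annulus_indE s : annulus_ind s = \1_(`[r, 2[ : set mR) s.
Proof.
by rewrite indicE /annulus_ind; congr (nat_of_bool _)%:R; apply/idP/idP; rewrite inE/= in_itv/=.
Qed.

Lemma measurable_annulus_ind : measurable_fun setT (annulus_ind : mR -> R).
Proof.
rewrite (_ : annulus_ind = \1_(`[r, 2[ : set mR)); last by apply/funext => s; exact: annulus_indE.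
by apply: measurable_indic; exact: measurable_itv.
Qed.

Lemma annulus_ind01 s : 0 <= annulus_ind s <= 1.
Proof. by rewrite /annulus_ind ler0n lern1 leq_b1. Qed.

(** Fubini exchanges the superposition over s with the space integral; the shell formula applies for
    each s, and polar coordinates reassemble the shells into the annulus. *)
Lemma integral_annulus_pot_laplacian (eta : R3 R -> R) (M : R) :
  smooth eta -> vanish M eta ->
  (\int[leb3]_x (annulus_pot x * laplacian eta x)%:E =
   - \int[leb3]_x (annulus_ind (enorm x) * eta x)%:E)%E.
Proof.
move=> se vE; have cl := continuous_laplacian se; have vl := vanish_laplacian vE.
have il := continuous_vanish_integrable cl vl.
have ml := continuous_measurable_R3 cl.
pose F (p : borel3 R * mR) : R := annulus_ind p.2 * (p.2 ^+ 2 * shell_pot p.2 p.1) * laplacian eta p.1.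
have mF : measurable_fun setT F.
  apply: measurable_funM; last exact: (measurableT_comp ml measurable_fst).
  apply: measurable_funM; first exact: (measurableT_comp measurable_annulus_ind measurable_snd).
  apply: measurable_funM; first by meas.
  rewrite /shell_pot; apply: measurable_inv.
  apply: (@measurable_maxr _ _ R setT (fun p : borel3 R * mR => enorm p.1) snd); last by meas.
  by apply: measurable_enorm; exact: measurable_fst.
have Fle p : `|F p| <= 2 * annulus_ind p.2 * `|laplacian eta p.1|.
  rewrite /F /annulus_ind; have [/andP[rs s2]|_] := boolP ((r <= p.2) && (p.2 < 2)); last first.
    by rewrite !mul0r normr0 mulr0 mul0r.
  have s0 : 0 < p.2 by rewrite (lt_le_trans r0).
  rewrite mul1r mulr1 normrM ler_wpM2r// ger0_norm; last first.
    by apply: mulr_ge0; [exact: sqr_ge0|exact: (shell_pot_ge0 s0)].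
  apply: (@le_trans _ _ (p.2 ^+ 2 * p.2^-1)).
    by rewrite ler_wpM2l ?sqr_ge0// (shell_pot_le s0).
  by rewrite expr2 mulfK ?gt_eqF// ltW.
have iF : (leb3sf \x mu)%E.-integrable setT (EFin \o F).
  apply/integrableP; split; first exact/measurable_EFinP.
  pose G (p : borel3 R * mR) : \bar R := (2 * annulus_ind p.2 * `|laplacian eta p.1|)%:E.
  have G0 p : (0 <= G p)%E.
    rewrite /G lee_fin; apply: mulr_ge0; last exact: normr_ge0.
    by apply: mulr_ge0; [exact: ler0n|have /andP[] := annulus_ind01 p.2].
  have mG : measurable_fun setT G.
    apply/measurable_EFinP; apply: measurable_funM.
      apply: measurable_funM; first exact: measurable_cst.
      exact: (measurableT_comp measurable_annulus_ind measurable_snd).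
    apply: (measurableT_comp (@normr_measurable R setT)).
    exact: (measurableT_comp ml measurable_fst).
  apply: (@le_lt_trans _ _ (\int[leb3sf \x mu]_p G p)%E).
    apply: ge0_le_integral => //; last by move=> p _; rewrite /= lee_fin.
    by apply: measurableT_comp => //; exact/measurable_EFinP.
  rewrite (fubini_tonelli1 (m1 := leb3sf) (m2 := mu) _ mG G0) /fubini_F.
  have E x : (\int[mu]_s G (x, s) = (2 * (2 - r))%:E * `|(laplacian eta x)%:E|)%E.
    under eq_integral => s _ do rewrite /G /= (mulrC (2 : R)) -mulrA EFinM annulus_indE.
    rewrite -integral_indic_mul integral_cst; last exact: measurable_itv.
    have muI : (mu (`[r, 2%R[ : set mR) = (2 - r)%:E)%E.
      rewrite lebesgue_measure_itv/= lte_fin; have [//|r2'] := ltP r 2.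
      by rewrite (@le_anti _ _ r 2) ?r2// subrr.
    transitivity ((2 * `|laplacian eta x|)%:E * (2 - r)%:E)%E; first by congr (_ * _)%E; exact: muI.
    by rewrite /= -!EFinM mulrAC.
  under eq_integral => x _ do rewrite E.
  rewrite ge0_integralZl//; last 2 first.
  - by apply: measurableT_comp => //; exact/measurable_EFinP.
  - by rewrite lee_fin mulr_ge0// subr_ge0.
  have /integrableP[_ ilt] := il.
  by apply: lte_mul_pinfty ilt => //; rewrite lee_fin mulr_ge0// subr_ge0.
have E12 := integral12_prod_meas1 iF; have E21 := integral21_prod_meas1 iF.
have -> : (\int[leb3]_x (annulus_pot x * laplacian eta x)%:E = \int[leb3]_x fubini_F mu (EFin \o F) x)%E.
  apply: eq_integral => x _; rewrite /fubini_F /= EFinM -annulus_pot_integral.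
  rewrite -integralZr; last 2 first.
  - exact: measurable_itv.
  - apply/integrableP; split.
      apply/measurable_EFinP; apply: measurable_funTS; exact: measurable_shell_weight.
    apply: (@le_lt_trans _ _ (annulus_pot x)%:E); last exact: ltry.
    rewrite -annulus_pot_integral le_eqVlt; apply/orP; left; apply/eqP.
    apply: eq_integral => s; rewrite inE/= in_itv/= => /andP[rs _].
    have s0 : 0 < s by rewrite (lt_le_trans r0).
    congr EFin; apply: ger0_norm; apply: mulr_ge0; [exact: sqr_ge0|exact: (shell_pot_ge0 s0)].
  rewrite integral_indic_mul; apply: eq_integral => s _.
  by rewrite -annulus_indE -!EFinM /F/= !mulrA.
rewrite [LHS]E12 -[LHS]E21.
have mF' : measurable_fun setT (EFin \o F) by exact/measurable_EFinP.
have iG : mu.-integrable setT (fubini_G leb3sf (EFin \o F)).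
  have maF : measurable_fun setT (abse \o (EFin \o F)) by exact: measurableT_comp.
  apply/integrableP; split; first exact: (measurable_fubini_G iF).
  apply: le_lt_trans ((integrable21ltyP leb3sf mu mF').1 iF).
  apply: ge0_le_integral; [exact: measurableT|by move=> s _; exact: abse_ge0| | |].
  - by apply: measurableT_comp => //; exact: (measurable_fubini_G iF).
  - apply: (measurable_fun_fubini_tonelli_G (m1 := leb3sf) _ maF) => p; exact: abse_ge0.
  move=> s _; apply: (@le_abse_integral _ _ _ leb3sf setT (fun x => (EFin \o F) (x, s)) measurableT).
  exact: (measurableT_comp mF' (@measurable_pair2 _ _ _ _ s)).
(* By the shell formula the slice of F at radius s integrates to - 3 H s, while 3 times the integral
   of H is the integral of eta over the annulus. *)
pose H s := ((annulus_ind s)%:E * \int[leb3]_(y in pball) (s ^+ 2 * eta ((s / enorm y) *: (y : R3 R)))%:E)%E.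
have GE s : (fubini_G leb3sf (EFin \o F) s = (- 3)%:E * H s)%E.
  have -> : (fubini_G leb3sf (EFin \o F) s = \int[leb3]_x (F (x, s))%:E)%E by [].
  rewrite /H; have [rs|rs] := boolP ((r <= s) && (s < 2)); last first.
    have a0 : annulus_ind s = 0 by rewrite /annulus_ind (negbTE rs).
    by rewrite a0 mul0e mule0; apply: integral0_eq => x _; rewrite /F /= a0 !mul0r.
  have a1 : annulus_ind s = 1 by rewrite /annulus_ind rs.
  have s0 : 0 < s by case/andP: rs => rs _; rewrite (lt_le_trans r0).
  have [C C0 eC] := vanish_bounded (smooth_continuous se) vE.
  have ib : leb3.-integrable pball (fun y : borel3 R => (eta ((s / enorm y) *: (y : R3 R)))%:E).
    apply: (@integrable_pball (fun y => eta ((s / enorm y) *: (y : R3 R))) C) => //.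
    apply: (measurableT_comp (continuous_measurable_R3 (smooth_continuous se))).
    by meas3.
  transitivity ((s ^+ 2)%:E * \int[leb3]_x (shell_pot s x * laplacian eta x)%:E)%E.
    have iS : leb3.-integrable setT (fun x : borel3 R => (shell_pot s x * laplacian eta x)%:E).
      apply: (@continuous_vanish_integrable _ (M + 1 + 1)).
        by move=> x; apply: cvgM; [exact: (continuous_shell_pot s0)|exact: cl].
      by move=> x /vl ->; rewrite mulr0.
    rewrite -(integralZl measurableT iS).
    by apply: eq_integral => x _; rewrite /F /= a1 mul1r -EFinM mulrA.
  rewrite (integral_shell_pot_laplacian s0 se vE) a1 mul1e.
  under [in RHS]eq_integral => y _ do rewrite EFinM.
  rewrite (integralZl (measurable_pball) ib).
  have -> : (\int[leb3]_(y in pball) (- eta ((s / enorm y) *: (y : R3 R)))%:E =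
      - \int[leb3]_(y in pball) (eta ((s / enorm y) *: (y : R3 R)))%:E)%E.
    transitivity ((- 1)%:E * \int[leb3]_(y in pball) (eta ((s / enorm y) *: (y : R3 R)))%:E)%E.
      rewrite -(integralZl measurable_pball ib); apply: eq_integral => y _.
      by rewrite -EFinM mulN1r.
    by rewrite EFinN mulNe mul1e.
  by rewrite !muleN EFinN mulNe; congr (- _)%E; rewrite !muleA (muleC 3%:E).
have -> : (\int[leb3]_x (annulus_ind (enorm x) * eta x)%:E = 3%:E * \int[mu]_s H s)%E.
  rewrite (@polar21 _ (fun x => annulus_ind (enorm x) * eta x)).
    congr (_ * _)%E; rewrite [LHS]integral_indic_mul; apply: eq_integral => s _; rewrite /H.
    have [s0|s0] := ltP 0 s; last first.
      have sI : (s \in (`]0%R, +oo[%classic : set mR)) = false.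
        by apply/negbTE; rewrite notin_setE/= in_itv/= andbT; apply/negP; rewrite -leNgt.
      rewrite indicE sI.
      by rewrite mul0e /annulus_ind leNgt (le_lt_trans s0)// mul0e.
    have sI : s \in (`]0%R, +oo[%classic : set mR) by rewrite inE/= in_itv/= s0.
    rewrite indicE sI.
    rewrite mul1e; transitivity (\int[leb3]_(y in pball) ((s ^+ 2 * (annulus_ind s * eta ((s / enorm y) *: (y : R3 R))))%:E))%E.
      apply: eq_integral => y; rewrite inE => /andP[y0 _].
      by rewrite enormZ gtr0_norm ?divr_gt0// divfK ?gt_eqF.
    rewrite /annulus_ind; case: (_ && _); first by rewrite mul1e; under eq_integral => y _ do rewrite mul1r.
    by rewrite mul0e; apply: integral0_eq => y _; rewrite mul0r mulr0.
  apply: continuous_enorm_vanish_integrable vE; last exact: (smooth_continuous se).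
    by apply: (measurableT_comp measurable_annulus_ind); apply: measurable_enorm; exact: measurable_id.
  by move=> x; exact: annulus_ind01.
under eq_integral => s _ do rewrite GE.
have iH : mu.-integrable setT H.
  rewrite (_ : H = fun s => ((- 3)^-1%:E * fubini_G leb3sf (EFin \o F) s)%E).
    exact: integrableZl.
  by apply/funext => s; rewrite GE muleA -EFinM mulVf ?mul1e// oppr_eq0.
by rewrite integralZl// EFinN mulNe.
Qed.

End Potential.

(** * Distributional Laplacian of the exterior potential *)

Section Green.
Context {R : realType}.
Notation mR := (measurableTypeR R).
Implicit Types (x y : R3 R).

Variable r : R.
Hypothesis r02 : 0 < r <= 2.
Let r0 : 0 < r. Proof. by case/andP: r02. Qed.
Let r2 : r <= 2. Proof. by case/andP: r02. Qed.

(** Not a normalised average: 3 times this is the integral of f (r n) over unit vectors n. *)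
Definition shell_mean (f : R3 R -> R) : R :=
  \int[leb3]_(y in (pball : set (borel3 R))) f ((r / enorm y) *: (y : R3 R)).

Lemma integrable_shell_mean (f : R3 R -> R) (M : R) : continuous f -> vanish M f ->
  leb3.-integrable pball (fun y : borel3 R => (f ((r / enorm y) *: (y : R3 R)))%:E).
Proof.
move=> cf vf; have [C C0 fC] := vanish_bounded cf vf.
apply: (@integrable_pball _ (fun y => f ((r / enorm y) *: (y : R3 R))) C) => //.
by apply: (measurableT_comp (continuous_measurable_R3 cf)); meas3.
Qed.

Lemma exterior_pot_green (eta : R3 R -> R) (M : R) : smooth eta -> vanish M eta ->
  \int[leb3]_x (exterior_pot r x * laplacian eta x) =
  \int[leb3]_x (annulus_ind r (enorm x) * eta x) -
  3 * (2 * r - r ^+ 3 / 2) * shell_mean eta.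
Proof.
move=> se vE; have cl := continuous_laplacian se; have vl := vanish_laplacian vE.
have ce := smooth_continuous se.
have iV (V : R3 R -> R) : continuous V ->
    leb3.-integrable setT (fun x : borel3 R => (V x * laplacian eta x)%:E).
  move=> cV; apply: (@continuous_vanish_integrable _ (M + 1 + 1)).
    by move=> y; apply: cvgM; [exact: cV|exact: cl].
  by move=> y /vl ->; rewrite mulr0.
have iS := iV _ (continuous_shell_pot r0).
have iA := iV _ (continuous_annulus_pot r02).
pose K := 2 * r - r ^+ 3 / 2.
have iI : leb3.-integrable setT (fun x : borel3 R => (annulus_ind r (enorm x) * eta x)%:E).
  apply: continuous_enorm_vanish_integrable vE; last exact: ce.
    by apply: (measurableT_comp (measurable_annulus_ind r)); apply: measurable_enorm; exact: measurable_id.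
  by move=> x; exact: annulus_ind01.
have iM := integrable_shell_mean ce vE.
have fI := integrable_fin_num measurableT iI.
have fM := integrable_fin_num measurable_pball iM.
have H : (\int[leb3]_x (exterior_pot r x * laplacian eta x)%:E =
    \int[leb3]_x (annulus_ind r (enorm x) * eta x)%:E -
    (3 * K)%:E * \int[leb3]_(y in pball) (eta ((r / enorm y) *: (y : R3 R)))%:E)%E.
  transitivity (\int[leb3]_x (K%:E * (shell_pot r x * laplacian eta x)%:E -
      (annulus_pot r x * laplacian eta x)%:E))%E.
    apply: eq_integral => x _; rewrite -EFinM -EFinB; congr EFin.
    by rewrite /exterior_pot -/K mulrBl mulrA.
  rewrite (integralB measurableT (integrableZl measurableT K iS) iA) (integralZl measurableT iS).
  rewrite (integral_annulus_pot_laplacian r02 se vE) oppeK addeC; congr (_ + _)%E.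
  rewrite (integral_shell_pot_laplacian r0 se vE).
  have -> : (\int[leb3]_(y in pball) (- eta ((r / enorm y) *: (y : R3 R)))%:E =
      - \int[leb3]_(y in pball) (eta ((r / enorm y) *: (y : R3 R)))%:E)%E.
    transitivity ((- 1)%:E * \int[leb3]_(y in pball) (eta ((r / enorm y) *: (y : R3 R)))%:E)%E.
      rewrite -(integralZl measurable_pball iM); apply: eq_integral => y _.
      by rewrite -EFinM mulN1r.
    by rewrite EFinN mulNe mul1e.
  by rewrite !muleN EFinM; congr (- _)%E; rewrite muleA (muleC 3%:E).
rewrite /Rintegral [in LHS]H /shell_mean /Rintegral -/K.
by rewrite -(fineK fI) -(fineK fM) -EFinM -EFinB.
Qed.

(** The ball of radius 2 minus the annulus is the ball of radius r. The right-hand side is therefore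
    phi tested against eta, with the sphere still written through directions. *)
Lemma integral_omega (m : R) (eta : R3 R -> R) (M : R) : smooth eta -> vanish M eta ->
  \int[leb3]_x (omega_ m x * eta x) -
  \int[leb3]_x (c_ m * exterior_pot r x * laplacian eta x) =
  c_ m * (\int[leb3]_(x in (oball r : set (borel3 R))) eta x) +
  3 * c_ m * (2 * r - r ^+ 3 / 2) * shell_mean eta.
Proof.
move=> se vE; have ce := smooth_continuous se.
have -> : \int[leb3]_x (c_ m * exterior_pot r x * laplacian eta x) =
    c_ m * \int[leb3]_x (exterior_pot r x * laplacian eta x).
  rewrite -RintegralZl//; last first.
    apply: (@continuous_vanish_integrable _ (M + 1 + 1)).
      by move=> y; apply: cvgM; [exact: (continuous_exterior_pot r02)|exact: (continuous_laplacian se)].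
    by move=> y /(vanish_laplacian vE) ->; rewrite mulr0.
  by apply: eq_Rintegral => x _; rewrite mulrA.
rewrite (exterior_pot_green se vE).
have iB (s : R) : leb3.-integrable setT (fun x : borel3 R => (\1_(oball s) x * eta x)%:E).
  apply: continuous_enorm_vanish_integrable vE => //.
    by apply: measurable_indic; exact: measurable_oball.
  by move=> x; rewrite indicE ler0n lern1 leq_b1.
have iI : leb3.-integrable setT (fun x : borel3 R => (annulus_ind r (enorm x) * eta x)%:E).
  apply: continuous_enorm_vanish_integrable vE; last exact: ce.
    by apply: (measurableT_comp (measurable_annulus_ind r)); apply: measurable_enorm; exact: measurable_id.
  by move=> x; exact: annulus_ind01.
have -> : \int[leb3]_x (omega_ m x * eta x) = c_ m * \int[leb3]_x (\1_(oball 2) x * eta x).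
  rewrite -(RintegralZl (c_ m) measurableT (iB 2)); apply: eq_Rintegral => x _.
  by rewrite mulrA.
have -> : \int[leb3]_x (\1_(oball 2) x * eta x) =
    \int[leb3]_(x in (oball r : set (borel3 R))) eta x +
    \int[leb3]_x (annulus_ind r (enorm x) * eta x).
  rewrite [in RHS]/Rintegral (integral_indic_mul _ (oball r : set (borel3 R))) -/(Rintegral _ _ _).
  rewrite -[X in fine X + _]/(\int[leb3]_x (\1_(oball r) x * eta x)%:E)%E -/(Rintegral _ _ _).
  rewrite -(RintegralD measurableT (iB r) iI); apply: eq_Rintegral => x _.
  rewrite -mulrDl; congr (_ * _); rewrite !indicE /annulus_ind.
  have E (s : R) : (x \in (oball s : set (borel3 R))) = (enorm x < s).
    by apply/idP/idP; rewrite inE.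
  rewrite !E; have [xr|rx] := ltP (enorm x) r.
    by rewrite (lt_le_trans xr r2) addr0.
  by rewrite add0r.
by move: (Rintegral _ _ _) (Rintegral _ _ _) (shell_mean _) => a b d; ring.
Qed.

(** A test function supported outside the closed ball kills both terms carried by that ball, and
    [integral_omega] becomes the equation. *)
Lemma exterior_pot_solution (m : R) :
  exterior_solution (omega_ m) r (fun x => c_ m * exterior_pot r x).
Proof.
split.
- by move=> x; apply: cvgMr; exact: (continuous_exterior_pot r02).
- move=> eta [se cs es]; have [M M0 vE] := compact_supp_vanish cs.
  have eta0 x : enorm x <= r -> eta x = 0.
    move=> xr; apply: contrapT => ex; have /es := @subset_closure _ [set x | eta x <> 0] x ex.
    by rewrite /cball /=.
  have := integral_omega m se vE.
  have -> : shell_mean eta = 0.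
    rewrite /shell_mean /Rintegral integral0_eq// => y /andP[y0 _].
    by rewrite eta0// enormZ gtr0_norm ?divr_gt0// divfK ?gt_eqF.
  have -> : \int[leb3]_(x in (oball r : set (borel3 R))) eta x = 0.
    by rewrite /Rintegral integral0_eq// => x xr; rewrite eta0// ltW.
  by rewrite !mulr0 addr0 => /eqP; rewrite subr_eq0 => /eqP.
- by move=> x xr; rewrite exterior_pot_eq0 ?mulr0//; exact: ltW.
move=> e e0; have c1 : 0 < `|c_ m| + 1 by rewrite ltr_wpDl.
have [M HM] := exterior_pot_vanishes r02 (divr_gt0 e0 c1).
exists M => x /HM h; rewrite normrM.
apply: (@le_lt_trans _ _ ((`|c_ m| + 1) * `|exterior_pot r x|)).
  by rewrite ler_wpM2r// lerDl.
by rewrite mulrC -ltr_pdivlMr.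
Qed.

End Green.

(** * Integration against a restricted measure *)

Section Restricted_measure.
Context d (T : measurableType d) (R : realType) (m : {measure set T -> \bar R}).
Local Open Scope ereal_scope.

Lemma integral_mrestr (D : set T) (mD : measurable D) (f : T -> \bar R) :
  measurable_fun setT f ->
  \int[mrestr m mD]_x f x = \int[m]_(x in D) f x.
Proof.
move=> mf.
transitivity (\int[mrestr m mD]_x (f \_ D) x).
  apply: ae_eq_integral => //.
    by apply/(measurable_restrictT f mD); exact: measurable_funTS.
  exists (~` D); split.
  - exact: measurableC.
  - transitivity (m (~` D `&` D)); first by [].
    by rewrite setICl; exact: measure0.
  - move=> x /= nH Dx; apply: nH => _; rewrite /patch.
    by rewrite mem_set.
rewrite -integral_mkcond; apply: eq_measure_integral => A mA AD.
by rewrite [LHS]/(m (A `&` D)) setIidl.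
Qed.

End Restricted_measure.

(** * Substitution by the cotangent *)

Section Cotangent.
Context {R : realType}.
Notation mR := (measurableTypeR R).
Notation mu := (@lebesgue_measure R).

Lemma measurable_sin : measurable_fun setT (@sin R : mR -> R).
Proof. by apply: continuous_measurable_fun; exact: continuous_sin. Qed.

Lemma measurable_cos : measurable_fun setT (@cos R : mR -> R).
Proof. by apply: continuous_measurable_fun; exact: continuous_cos. Qed.

(** Parametrises the directions of the open upper half-plane: (u, 1) points in the direction of
    angle t exactly when u = cot t. *)
Definition cot (t : R) : R := cos t / sin t.

Lemma measurable_cot : measurable_fun setT (cot : mR -> R).
Proof.
by apply: measurable_funM; [exact: measurable_cos|apply: measurable_inv; exact: measurable_sin].
Qed.

Definition acot (u : R) : R := pi / 2 - atan u.

Lemma acot_itv u : 0 < acot u < pi.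
Proof.
have := atan_gtNpi2 u; have := atan_ltpi2 u; rewrite /acot.
move: (atan u) (pi : R) => a p; lra.
Qed.

Lemma cot_tan t : cot t = tan (pi / 2 - t).
Proof.
have -> : pi / 2 - t = - (t - pi / 2) by rewrite opprB.
by rewrite tanN /tan sinBpihalf cosBpihalf mulNr opprK.
Qed.

Lemma acotK u : cot (acot u) = u.
Proof. by rewrite cot_tan /acot subKr atanK. Qed.

Lemma cot_lt (a b : R) : 0 < a < pi -> 0 < b < pi -> (cot a < cot b) = (b < a).
Proof.
move=> a0 b0; rewrite !cot_tan ltr_tan; last 2 first.
- by rewrite in_itv/=; move: a0; move: (pi : R) => p; lra.
- by rewrite in_itv/=; move: b0; move: (pi : R) => p; lra.
by rewrite ltrD2l ltrN2.
Qed.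

Lemma is_derive_cot (t : R) : sin t != 0 -> is_derive t (1:R) cot (- (sin t ^- 2)).
Proof.
move=> s0; have D := @is_deriveM R _ cos (fun t => (sin t)^-1) t 1 _ _
  (is_derive_cos t) (@is_deriveV R sin t _ 1 s0 (is_derive_sin t)).
apply: (is_derive_eq D); rewrite /GRing.scale/=.
have E : cos t * (- (sin t ^- 2) * cos t) + (sin t)^-1 * - sin t =
    - ((cos t ^+ 2 + sin t ^+ 2) * sin t ^- 2) by field.
by rewrite E cos2Dsin2 mul1r.
Qed.

(** The region under the graph of 1 / sin^2 over ]0, pi[. Restricting planar measure to it realises
    the density 1 / sin^2, so that the substitution becomes a statement about a pushforward. *)
Let W : set (mR * mR) := [set p | (0 < p.1) && (p.1 < pi) && ((0 < p.2) && (p.2 < sin p.1 ^- 2))].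

Let mW : measurable W.
Proof.
have -> : W = ([set p | 0 < p.1] `&` [set p | p.1 < pi]) `&` ([set p | 0 < p.2] `&` [set p | p.2 < sin p.1 ^- 2]).
  by apply/seteqP; split => p /=; rewrite /W/=; [move=> /andP[/andP[-> ->] /andP[-> ->]]|
    move=> [[-> ->] [-> ->]]].
have mf : measurable_fun setT (fst : mR * mR -> R) by exact: measurable_fst.
have ms : measurable_fun setT (snd : mR * mR -> R) by exact: measurable_snd.
have mc (k : R) : measurable_fun setT (cst k : mR * mR -> R) by exact: measurable_cst.
apply: measurableI; apply: measurableI.
- exact: (measurable_lt (mc 0) mf).
- exact: (measurable_lt mf (mc pi)).
- exact: (measurable_lt (mc 0) ms).
- apply: (measurable_lt ms); apply: measurable_inv; apply: measurable_funX.
  exact: (measurableT_comp measurable_sin measurable_fst).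
Qed.

Let mC : measurable_fun setT (fun p : mR * mR => cot p.1 : mR).
Proof. exact: (measurableT_comp measurable_cot measurable_fst). Qed.

Lemma cot_region_fiber (G : R -> \bar R) (t : R) : (0 <= G (cot t))%E ->
  (\int[mu]_v ((\1_W (t, v))%:E * G (cot t)) =
   (\1_(`]0%R, pi[%classic : set mR) t)%:E * ((sin t ^- 2)%:E * G (cot t)))%E.
Proof.
move=> G0; rewrite indicE.
have -> : (t \in (`]0%R, pi[%classic : set mR)) = (0 < t) && (t < pi).
  by apply/idP/idP; rewrite inE/= in_itv/=.
have [/andP[t0 tp]|tI] := boolP ((0 < t) && (t < pi)); last first.
  rewrite mul0e; apply: integral0_eq => v _; rewrite indicE.
  have -> : ((t, v) \in W) = false by apply/negbTE; rewrite notin_setE /W/= (negbTE tI).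
  by rewrite mul0e.
rewrite mul1e; have s0 : 0 < sin t ^- 2 by rewrite invr_gt0 exprn_gt0// sin_gt0_pi// t0.
transitivity (\int[mu]_(v in (`]0%R, (sin t ^- 2)[%classic : set mR)) (cst (G (cot t)) v))%E.
  rewrite [RHS]integral_indic_mul; apply: eq_integral => v _; congr (_%:E * _)%E.
  rewrite !indicE; congr (nat_of_bool _)%:R.
  by apply/idP/idP; rewrite !inE/= in_itv/= /W/= t0 tp.
rewrite integral_cst; last exact: measurable_itv.
have muI : (mu (`]0%R, (sin t ^- 2)[ : set mR) = (sin t ^- 2)%:E)%E.
  by rewrite lebesgue_measure_itv/= lte_fin s0 -EFinB subr0.
by rewrite muleC; congr (_ * _)%E; exact: muI.
Qed.

(** By uniqueness of Lebesgue measure it is enough to treat ]a, b]. As cot decreases, the preimage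
    is [acot b, acot a[, over which 1 / sin^2 integrates to b - a. *)
Lemma cot_pushforward (A : set mR) : measurable A ->
  mu A = leb2 ((fun p : mR * mR => cot p.1 : mR) @^-1` A `&` W).
Proof.
pose m' := measure_function_pushforward__canonical__measure_function_Measure
  (measure_function_mrestr__canonical__measure_function_Measure leb2 mW) mC.
move=> mA; rewrite -[RHS]/(m' A).
apply: lebesgue_measure_unique => // _ [[a b]] _ <-.
rewrite -[RHS]/(leb2 ((fun p : mR * mR => cot p.1 : mR) @^-1` `]a, b]%classic `&` W)).
have [ab|ba] := ltP a b; last first.
  rewrite set_itv_ge ?bnd_simp -?leNgt// measure0 preimage_set0 set0I measure0//.
have [/andP[a0 ap] /andP[b0 bp]] := (acot_itv a, acot_itv b).
have ba : acot b < acot a.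
  by rewrite -cot_lt ?acotK// ?a0 ?b0.
have mI : measurable ((fun p : mR * mR => cot p.1 : mR) @^-1` `]a, b]%classic).
  by rewrite -[X in measurable X]setTI; exact: mC.
have mIW := measurableI _ _ mI mW.
pose f (p : mR * mR) : \bar R := (\1_((fun p : mR * mR => cot p.1 : mR) @^-1` `]a, b]%classic `&` W) p)%:E.
have mf : measurable_fun setT f by apply/measurable_EFinP; exact: measurable_indic.
have f0 p : (0 <= f p)%E by rewrite lee_fin.
transitivity (\int[leb2]_p f p)%E; last first.
  by rewrite /f (integral_indic leb2 measurableT mIW) setIT.
rewrite lebesgue_measure_itv/= lte_fin ab.
rewrite (fubini_tonelli1 (m1 := mu) (m2 := mu) _ mf f0).
pose G (u : R) : \bar R := (\1_(`]a, b]%classic : set mR) u)%:E.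
have -> : (\int[mu]_t fubini_F mu f t =
   \int[mu]_(t in (`[acot b, acot a[%classic : set mR)) (sin t ^- 2)%:E)%E.
  rewrite [RHS]integral_indic_mul; apply: eq_integral => t _; rewrite /fubini_F /f.
  transitivity (\int[mu]_v ((\1_W (t, v))%:E * G (cot t)))%E.
    by apply: eq_integral => v _; rewrite setIC indicI EFinM; congr (_ * _)%E.
  rewrite cot_region_fiber; last by rewrite lee_fin.
  rewrite muleCA muleC; congr (_ * _)%E; rewrite /G -EFinM !indicE -natrM mulnb.
  congr (nat_of_bool _)%:R%:E.
  have -> : (t \in (`]0%R, pi[%classic : set mR)) = (0 < t) && (t < pi).
    by apply/idP/idP; rewrite inE/= in_itv/=.
  have -> : (cot t \in (`]a, b]%classic : set mR)) = (a < cot t) && (cot t <= b).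
    by apply/idP/idP; rewrite inE/= in_itv/=.
  have -> : (t \in (`[acot b, acot a[%classic : set mR)) = (acot b <= t) && (t < acot a).
    by apply/idP/idP; rewrite inE/= in_itv/=.
  have [t0p|] := boolP ((0 < t) && (t < pi)).
    rewrite -{1}(acotK a) -{1}(acotK b) cot_lt ?a0// leNgt cot_lt ?b0// -leNgt.
    by rewrite /= andbC.
  move=> nt; rewrite /=; apply/esym/negbTE; apply: contra nt => /andP[bt ta].
  by rewrite (lt_le_trans b0)//= (lt_trans ta).
have sn (t : R) : acot b <= t <= acot a -> sin t != 0.
  move=> /andP[bt ta]; rewrite gt_eqF// sin_gt0_pi//.
  by rewrite (lt_le_trans b0)//= (le_lt_trans ta).
have ms (D : set mR) : measurable_fun D (fun t : mR => (sin t ^- 2)%:E).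
  apply/measurable_EFinP; apply: measurable_funTS; apply: measurable_inv.
  by apply: measurable_funX; exact: measurable_sin.
rewrite integral_itv_bndo_bndc; last exact: ms.
have dc (t : R) : acot b <= t <= acot a -> is_derive t (1:R) (fun t => - cot t) (sin t ^- 2).
  by move=> /sn/is_derive_cot/is_deriveN D; apply: (is_derive_eq D); rewrite opprK.
have cc (t : R) : acot b <= t <= acot a -> {for t, continuous (fun t => - cot t)}.
  by move=> /dc[D _]; exact/differentiable_continuous/derivable1_diffP.
rewrite (@continuous_FTC2 _ (fun t => sin t ^- 2) (fun t => - cot t) _ _ ba).
- by rewrite !acotK -!EFinB opprK addrC.
- apply: continuous_in_subspaceT => t; rewrite inE/= in_itv/= => /sn tn.
  apply: (@continuous_comp _ _ _ (fun t => sin t ^+ 2) GRing.inv).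
    apply: (@continuous_comp _ _ _ sin (fun t : R => t ^+ 2)); first exact: continuous_sin.
    exact: exprn_continuous.
  by apply: inv_continuous; rewrite sqrf_eq0.
- split=> [t||].
  + by rewrite in_itv/= => /andP[/ltW bt /ltW ta]; have [|] := dc t; rewrite ?bt.
  + by apply: cvg_at_right_filter; apply: cc; rewrite lexx ltW.
  + by apply: cvg_at_left_filter; apply: cc; rewrite lexx ltW.
- move=> t; rewrite in_itv/= => /andP[/ltW bt /ltW ta].
  by rewrite derive1E; have [|_] := dc t; rewrite ?bt.
Qed.

Lemma cot_substitution (G : mR -> \bar R) :
  measurable_fun setT G -> (forall u, 0 <= G u)%E ->
  (\int[mu]_u G u = \int[mu]_(t in `]0%R, pi[) ((sin t ^- 2)%:E * G (cot t)))%E.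
Proof.
move=> mG G0.
have mGc : measurable_fun setT (fun p : mR * mR => G (cot p.1)) by exact: (measurableT_comp mG mC).
have := @integral_pushforward_preserving _ _ _ _ _
  (measure_function_mrestr__canonical__measure_function_Measure leb2 mW) mu _ mC
  (fun A mA => esym (cot_pushforward mA)) G mG.
move=> <-; rewrite integral_mrestr// [LHS]integral_indic_mul.
have mf : measurable_fun setT (fun p : mR * mR => ((\1_W p)%:E * G (cot p.1))%E).
  by apply: emeasurable_funM => //; apply/measurable_EFinP; exact: measurable_indic.
have f0 (p : mR * mR) : (0 <= (\1_W p)%:E * G (cot p.1))%E by apply: mule_ge0 => //; rewrite lee_fin.
rewrite (fubini_tonelli1 (m1 := mu) (m2 := mu) _ mf f0).
rewrite [RHS]integral_indic_mul; apply: eq_integral => t _; rewrite /fubini_F.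
by rewrite cot_region_fiber.
Qed.

End Cotangent.

(** * Polar coordinates in the plane *)

Section Half_plane.
Context {R : realType}.
Notation mR := (measurableTypeR R).
Notation mu := (@lebesgue_measure R).

Lemma measurable_sin_comp d (X : measurableType d) (f : X -> R) :
  measurable_fun setT f -> measurable_fun setT (fun x => sin (f x) : R).
Proof. move=> mf; exact: (measurableT_comp measurable_sin mf). Qed.

Lemma measurable_cos_comp d (X : measurableType d) (f : X -> R) :
  measurable_fun setT f -> measurable_fun setT (fun x => cos (f x) : R).
Proof. move=> mf; exact: (measurableT_comp measurable_cos mf). Qed.

Lemma measurable_weighted d d' (X : measurableType d) (Y : measurableType d')
    (w : X -> R) (k : X -> Y) (h : Y -> \bar R) :
  measurable_fun setT w -> measurable_fun setT k -> measurable_fun setT h ->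
  measurable_fun setT (fun x => (w x)%:E * h (k x))%E.
Proof.
move=> mw mk mh; apply: emeasurable_funM; first exact/measurable_EFinP.
exact: (measurableT_comp mh mk).
Qed.

Definition pos_ind (y : R) : R := (0 < y)%R%:R.

Lemma measurable_pos_ind d (X : measurableType d) (f : X -> R) :
  measurable_fun setT f -> measurable_fun setT (fun x => pos_ind (f x) : R).
Proof. move=> mf; by apply: (@measurable_lt_indic _ _ _ (cst 0)). Qed.

Lemma pos_ind_ge0 y : 0 <= pos_ind y.
Proof. exact: ler0n. Qed.

Lemma pos_ind1 y : 0 < y -> pos_ind y = 1.
Proof. by rewrite /pos_ind => ->. Qed.

Lemma pos_ind0 y : y <= 0 -> pos_ind y = 0.
Proof. by rewrite /pos_ind leNgt => /negbTE ->. Qed.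

Lemma pos_ind_mul_ge0 y : 0 <= pos_ind y * y.
Proof.
by have [y0|y0] := ltP 0 y; [rewrite pos_ind1// mul1r ltW|rewrite pos_ind0// mul0r].
Qed.

Lemma pos_indM (s y : R) : 0 < s -> pos_ind (s * y) = pos_ind y.
Proof. by move=> s0; rewrite /pos_ind pmulr_rgt0. Qed.

Definition arc_ind (t : R) : R := ((0 < t) && (t < pi))%R%:R.

Lemma arc_ind_ge0 t : 0 <= arc_ind t.
Proof. exact: ler0n. Qed.

Lemma arc_indE t : arc_ind t = \1_(`]0%R, pi[%classic : set mR) t.
Proof.
by rewrite indicE /arc_ind; congr (nat_of_bool _)%:R; apply/idP/idP; rewrite inE/= in_itv/=.
Qed.

Lemma measurable_arc_ind d (X : measurableType d) (f : X -> R) :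
  measurable_fun setT f -> measurable_fun setT (fun x => arc_ind (f x) : R).
Proof.
move=> mf; apply: (@measurableT_comp _ _ _ _ _ _ (arc_ind : mR -> R)) mf.
rewrite (_ : arc_ind = \1_(`]0%R, pi[%classic : set mR)); last by apply/funext => t; rewrite arc_indE.
by apply: measurable_indic; exact: measurable_itv.
Qed.

Local Open Scope ereal_scope.

(** Three one-dimensional substitutions: x = y u at fixed height y, then u = cot t, then y = s sin
    t. The factors y, sin^-2 and sin multiply to s. *)
Lemma half_plane_polar (h : mR * mR -> \bar R) :
  measurable_fun setT h -> (forall p, 0 <= h p) ->
  \int[mu]_x \int[mu]_y ((pos_ind y)%:E * h (x, y)) =
  \int[mu]_t ((arc_ind t)%:E *
    \int[mu]_s ((pos_ind s * s)%:E * h ((s * cos t)%R, (s * sin t)%R))).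
Proof.
move=> mh h0.
have mh1 : measurable_fun setT (fun p : mR * mR => (pos_ind p.2)%:E * h p).
  by apply: (measurable_weighted _ (@measurable_id _ _ _) mh); apply: measurable_pos_ind; exact: measurable_snd.
have h10 (p : mR * mR) : 0 <= (pos_ind p.2)%:E * h p.
  by apply: mule_ge0; [rewrite lee_fin; exact: pos_ind_ge0|exact: h0].
rewrite (@fubini_tonelli _ _ _ _ _ mu mu _ mh1 h10).
pose h2 (p : mR * mR) := (pos_ind p.2 * p.2)%:E * h ((p.2 * p.1)%R, p.2).
have mh2 : measurable_fun setT h2.
  apply: (measurable_weighted _ _ mh); last by meas.
  by apply: measurable_funM; [apply: measurable_pos_ind|]; exact: measurable_snd.
have h20 p : 0 <= h2 p.
  by apply: mule_ge0; [rewrite lee_fin; exact: pos_ind_mul_ge0|exact: h0].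
have mhy y : measurable_fun setT (fun x : mR => h (x, y)).
  exact: (measurableT_comp mh (@pair2_measurable _ _ _ _ y)).
transitivity (\int[mu]_y \int[mu]_u h2 (u, y)).
  apply: eq_integral => y _; have [y0|y0] := ltP 0%R y; last first.
    by rewrite !integral0_eq// => x _; rewrite /h2/= pos_ind0// ?mul0r mul0e.
  under eq_integral => x _ do rewrite /= pos_ind1// mul1e.
  have mk : measurable_fun setT (fun u : mR => h ((y * u)%R, y)).
    by apply: (measurableT_comp mh); meas.
  under [RHS]eq_integral => u _ do rewrite /h2/= pos_ind1// mul1r.
  rewrite ge0_integralZl// ?lee_fin ?ltW//.
  rewrite (@integral_scale1 _ (PosNum y0) (fun x => h (x, y)))//= muleA -EFinM.
  by rewrite divff ?gt_eqF// mul1e.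
rewrite -(@fubini_tonelli _ _ _ _ _ mu mu _ mh2 h20).
have mG := measurable_fun_fubini_tonelli_F (m2 := mu) _ mh2 h20.
rewrite (cot_substitution mG); last by move=> u; apply: integral_ge0 => y _; exact: h20.
rewrite [LHS]integral_indic_mul; apply: eq_integral => t _; rewrite -arc_indE.
have [/andP[t0 tp]|tn] := boolP ((0 < t) && (t < pi))%R; last by rewrite /arc_ind (negbTE tn) !mul0e.
congr (_ * _); have s0 : (0 < sin t)%R by rewrite sin_gt0_pi// t0.
have sn : sin t != 0%R by rewrite gt_eqF.
pose H (y : mR) := h2 (cot t, y).
have mH : measurable_fun setT H by exact: (measurableT_comp mh2 (@pair1_measurable _ _ _ _ (cot t))).
have HE : \int[mu]_y H y = (sin t)%:E * \int[mu]_s H (sin t * s)%R.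
  by rewrite (@integral_scale1 _ (PosNum s0) H mH)/= muleA -EFinM divff// mul1e.
rewrite (_ : fubini_F mu h2 (cot t) = \int[mu]_y H y)// HE.
have -> : \int[mu]_s H (sin t * s)%R =
    (sin t)%:E * \int[mu]_s ((pos_ind s * s)%:E * h ((s * cos t)%R, (s * sin t)%R)).
  rewrite -ge0_integralZl//; last 3 first.
  - by apply: (measurable_weighted _ _ mh); [apply: measurable_funM; [apply: measurable_pos_ind|]|meas].
  - by move=> s _; apply: mule_ge0; [rewrite lee_fin; exact: pos_ind_mul_ge0|exact: h0].
  - by rewrite lee_fin ltW.
  apply: eq_integral => s _; rewrite /H /h2 /= pos_indM// muleA -EFinM.
  congr (_%:E * h (_, _)); [by rewrite mulrCA|by rewrite /cot; field|by rewrite mulrC].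
rewrite muleA muleA -!EFinM.
have -> : (sin t ^- 2 * sin t * sin t = 1)%R by field.
by rewrite mul1e.
Qed.

End Half_plane.

Ltac meas_trig := repeat first [ progress meas3 | match goal with
  | |- measurable_fun _ (fun x => cos _) => apply: measurable_cos_comp
  | |- measurable_fun _ cos => apply: measurable_cos_comp
  | |- measurable_fun _ (fun x => sin _) => apply: measurable_sin_comp
  | |- measurable_fun _ sin => apply: measurable_sin_comp
  | |- measurable_fun _ (fun x => pos_ind _) => apply: measurable_pos_ind
  | |- measurable_fun _ pos_ind => apply: measurable_pos_ind
  | |- measurable_fun _ (fun x => arc_ind _) => apply: measurable_arc_ind
  | |- measurable_fun _ arc_ind => apply: measurable_arc_ind
  end ].

Section Spherical_coordinates.
Context {R : realType}.
Notation mR := (measurableTypeR R).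
Notation mu := (@lebesgue_measure R).

Lemma mu_null_ae (N : set mR) (P : mR -> Prop) : measurable N -> mu N = 0%E ->
  (forall x, ~ N x -> P x) -> {ae mu, forall x, P x}.
Proof.
move=> mN N0 NP; exists N; split => // x /= nP; apply: contrapT => nN.
by apply: nP; exact: NP.
Qed.

Lemma lebesgue_measure_opp (A : set mR) : measurable A -> mu (-%R @^-1` A) = mu A.
Proof.
move=> mA; rewrite -[RHS]lebesgue_measureN//; congr (mu _).
Qed.

(** The closed interval matches the parameter domain in [sphere_measure]. *)
Definition full_arc_ind (t : R) : R := \1_(`[0%R, 2 * pi]%classic : set mR) t.

Lemma measurable_full_arc_ind d (X : measurableType d) (f : X -> R) :
  measurable_fun setT f -> measurable_fun setT (fun x => full_arc_ind (f x) : R).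
Proof.
move=> mf; apply: (@measurableT_comp _ _ _ _ _ _ (full_arc_ind : mR -> R)) mf.
by apply: measurable_indic; exact: measurable_itv.
Qed.

Lemma full_arc_ind_ge0 t : 0 <= full_arc_ind t.
Proof. exact: ler0n. Qed.

Local Open Scope ereal_scope.

(** The lower half-plane is carried to the upper one by x |-> - x, which shifts the angle by pi. The
    angles 0, pi and 2 pi and the line y = 0 are lost on null sets only. *)
Lemma plane_polar (h : mR * mR -> \bar R) :
  measurable_fun setT h -> (forall p, 0 <= h p) ->
  \int[mu]_x \int[mu]_y h (x, y) =
  \int[mu]_t ((full_arc_ind t)%:E *
    \int[mu]_s ((pos_ind s * s)%:E * h ((s * cos t)%R, (s * sin t)%R))).
Proof.
move=> mh h0.
pose K (t : R) := \int[mu]_s ((pos_ind s * s)%:E * h ((s * cos t)%R, (s * sin t)%R)).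
have K0 t : 0 <= K t.
  by apply: integral_ge0 => s _; apply: mule_ge0; [rewrite lee_fin; exact: pos_ind_mul_ge0|exact: h0].
have mKf : measurable_fun setT (fun p : mR * mR => (pos_ind p.2 * p.2)%:E * h ((p.2 * cos p.1)%R, (p.2 * sin p.1)%R)).
  apply: (measurable_weighted _ _ mh).
    by apply: measurable_funM; [apply: measurable_pos_ind|]; exact: measurable_snd.
  by meas_trig.
have mK : measurable_fun setT (K : mR -> \bar R).
  apply: (measurable_fun_fubini_tonelli_F (m2 := mu) _ mKf) => p.
  by apply: mule_ge0; [rewrite lee_fin; exact: pos_ind_mul_ge0|exact: h0].
pose hm (p : mR * mR) := h ((- p.1)%R, (- p.2)%R).
have mhm : measurable_fun setT hm by apply: (measurableT_comp mh); meas.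
pose g1 (p : mR * mR) := (pos_ind p.2)%:E * h p.
have mg1 : measurable_fun setT g1.
  by apply: (measurable_weighted _ (@measurable_id _ _ _) mh); apply: measurable_pos_ind; exact: measurable_snd.
have g10 p : 0 <= g1 p by apply: mule_ge0 => //; rewrite lee_fin; exact: pos_ind_ge0.
pose g2 (p : mR * mR) := (pos_ind p.2)%:E * h (p.1, - p.2)%R.
have mg2 : measurable_fun setT g2.
  by apply: (measurable_weighted _ _ mh); [apply: measurable_pos_ind; exact: measurable_snd|meas].
have g20 p : 0 <= g2 p by apply: mule_ge0 => //; rewrite lee_fin; exact: pos_ind_ge0.
have hx x : measurable_fun setT (fun y : mR => h (x, y)).
  exact: (measurableT_comp mh (@pair1_measurable _ _ _ _ x)).
have mpos (e : bool) : measurable_fun setT (fun y : mR => (pos_ind ((-1) ^+ e * y))%:E).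
  by apply/measurable_EFinP; apply: measurable_pos_ind; meas.
have mph x (e : bool) : measurable_fun setT (fun y : mR => (pos_ind ((-1) ^+ e * y))%:E * h (x, y)).
  by apply: emeasurable_funM; [exact: mpos|exact: hx].
have split1 x : \int[mu]_y h (x, y) =
    \int[mu]_y ((pos_ind y)%:E * h (x, y)) + \int[mu]_y ((pos_ind y)%:E * h (x, - y)%R).
  transitivity (\int[mu]_y ((pos_ind y)%:E * h (x, y) + (pos_ind (- y)%R)%:E * h (x, y))).
    apply: ae_eq_integral => //.
      apply: emeasurable_funD.
        by have := mph x false; under eq_fun do rewrite expr0 mul1r.
      by have := mph x true; under eq_fun do rewrite expr1 mulN1r.
    apply: (@mu_null_ae [set 0%R]); [exact: measurable_set1|exact: lebesgue_measure_set1|].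
    move=> y yn _; have [y0|y0|y0] := ltgtP y 0%R; last by case: yn.
      by rewrite pos_ind0 ?ltW// pos_ind1 ?oppr_gt0// mul0e add0e mul1e.
    by rewrite pos_ind1// pos_ind0 ?oppr_le0 ?ltW// mul0e adde0 mul1e.
  rewrite ge0_integralD; last 5 first.
  - exact: measurableT.
  - by move=> y _; apply: mule_ge0 => //; rewrite lee_fin; exact: pos_ind_ge0.
  - by have := mph x false; under eq_fun do rewrite expr0 mul1r.
  - by move=> y _; apply: mule_ge0 => //; rewrite lee_fin; exact: pos_ind_ge0.
  - by have := mph x true; under eq_fun do rewrite expr1 mulN1r.
  congr (_ + _).
  rewrite -(@integral_pushforward_preserving _ _ _ _ _ mu mu (-%R : mR -> mR) _ lebesgue_measure_opp
    (fun y => (pos_ind (- y)%R)%:E * h (x, y))); last 2 first.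
  - exact: oppr_measurable.
  - by have := mph x true; under eq_fun do rewrite expr1 mulN1r.
  by apply: eq_integral => y _; rewrite opprK.
under eq_integral => x _ do rewrite split1.
rewrite ge0_integralD; last 5 first.
- exact: measurableT.
- by move=> x _; apply: integral_ge0 => y _; apply: mule_ge0 => //; rewrite lee_fin; exact: pos_ind_ge0.
- exact: (measurable_fun_fubini_tonelli_F (m2 := mu) _ mg1 g10).
- by move=> x _; apply: integral_ge0 => y _; apply: mule_ge0 => //; rewrite lee_fin; exact: pos_ind_ge0.
- exact: (measurable_fun_fubini_tonelli_F (m2 := mu) _ mg2 g20).
have -> : \int[mu]_x \int[mu]_y ((pos_ind y)%:E * h (x, - y)%R) = \int[mu]_x \int[mu]_y ((pos_ind y)%:E * hm (x, y)).
  rewrite -[LHS](@integral_pushforward_preserving _ _ _ _ _ mu mu (-%R : mR -> mR) _ lebesgue_measure_opp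
    (fun x => \int[mu]_y ((pos_ind y)%:E * h (x, - y)%R))) //.
  exact: (measurable_fun_fubini_tonelli_F (m2 := mu) _ mg2 g20).
have hm0 p : 0 <= hm p by exact: h0.
rewrite [X in X + _](half_plane_polar mh h0) [X in _ + X](half_plane_polar mhm hm0).
have -> : \int[mu]_t ((arc_ind t)%:E * \int[mu]_s ((pos_ind s * s)%:E * hm ((s * cos t)%R, (s * sin t)%R))) =
    \int[mu]_t ((arc_ind (t - pi))%:E * K t).
  rewrite -[RHS](@integral_pushforward_preserving _ _ _ _ _ mu mu (fun t : mR => (t + pi)%R : mR) _ (lebesgue_measure_translate pi)
    (fun t => (arc_ind (t - pi))%:E * K t)).
  - apply: eq_integral => t _; rewrite addrK /K /hm /=; congr (_ * _); apply: eq_integral => s _.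
    by rewrite cosDpi sinDpi !mulrN.
  - exact: measurable_translate1.
  - by apply: emeasurable_funM => //; apply/measurable_EFinP; apply: measurable_arc_ind; meas.
rewrite -ge0_integralD; last 5 first.
- exact: measurableT.
- by move=> t _; apply: mule_ge0; [rewrite lee_fin; exact: arc_ind_ge0|exact: K0].
- by apply: emeasurable_funM => //; apply/measurable_EFinP; apply: measurable_arc_ind; meas.
- by move=> t _; apply: mule_ge0; [rewrite lee_fin; exact: arc_ind_ge0|exact: K0].
- by apply: emeasurable_funM => //; apply/measurable_EFinP; apply: measurable_arc_ind; meas.
apply: ae_eq_integral.
- exact: measurableT.
- apply: emeasurable_funD.
  by apply: emeasurable_funM => //; apply/measurable_EFinP; apply: measurable_arc_ind; meas.
  by apply: emeasurable_funM => //; apply/measurable_EFinP; apply: measurable_arc_ind; meas.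
- by apply: emeasurable_funM => //; apply/measurable_EFinP; apply: measurable_full_arc_ind; meas.
have p0 := pi_gt0 R.
pose N : set mR := [set 0%R; pi; (2 * pi)%R].
have fN : finite_set N by rewrite /N !finite_setU; do ?split; exact: finite_set1.
apply: (@mu_null_ae N).
- by apply: measurableU => //; apply: measurableU.
- exact/countable_lebesgue_measure0/finite_set_countable.
move=> t tN _; rewrite -ge0_muleDl ?lee_fin ?arc_ind_ge0// -EFinD; congr (_%:E * _).
have t0 : t != 0%R by apply/eqP => E; apply: tN; left; left.
have tp : t != pi by apply/eqP => E; apply: tN; left; right.
have t2p : t != (2 * pi)%R by apply/eqP => E; apply: tN; right.
have -> : full_arc_ind t = ((0 <= t) && (t <= 2 * pi))%R%:R.
  by rewrite /full_arc_ind indicE; congr (nat_of_bool _)%:R; apply/idP/idP; rewrite inE/= in_itv/=.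
rewrite /arc_ind (le_eqVlt 0%R) eq_sym (negbTE t0)/= (le_eqVlt t) (negbTE t2p)/=.
have E2 : (2 * pi = pi + pi :> R)%R by rewrite mulr_natl mulr2n.
rewrite subr_gt0 ltrBlDr -E2.
have [tlp|plt|//] := ltgtP t pi; last by move=> E; move: tp; rewrite E eqxx.
  have -> : (t < 2 * pi)%R by rewrite (lt_trans tlp)// E2 ltrDl.
  by rewrite !andbT /= addr0.
by rewrite (lt_trans p0 plt) /= add0r.
Qed.

End Spherical_coordinates.

(** * Spherical coordinates *)

Section Spherical_angles.
Context {R : realType}.
Notation mR := (measurableTypeR R).
Notation mu := (@lebesgue_measure R).
Local Open Scope ereal_scope.

Lemma sphericalE (r : R) (t : R * R) : spherical r t = (r *: spherical 1 t)%R.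
Proof.
by apply: R3_ext; rewrite /spherical /=; [rewrite -[RHS]/(r * _)%R|rewrite -[RHS]/(r * _)%R|rewrite -[RHS]/(r * _)%R];
  rewrite mul1r ?mulrA.
Qed.

Lemma enorm_spherical1 (t : R * R) : enorm (spherical (1 : R) t) = 1%R.
Proof.
rewrite /enorm (_ : dot _ _ = 1%R) ?sqrtr1//.
rewrite -[LHS]/((1 * sin t.1 * cos t.2) * (1 * sin t.1 * cos t.2) +
  (1 * sin t.1 * sin t.2) * (1 * sin t.1 * sin t.2) + (1 * cos t.1) * (1 * cos t.1))%R.
transitivity (sin t.1 ^+ 2 * (cos t.2 ^+ 2 + sin t.2 ^+ 2) + cos t.1 ^+ 2)%R; first by ring.
by rewrite cos2Dsin2 mulr1 addrC cos2Dsin2.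
Qed.

Lemma measurable_spherical (r : R) : measurable_fun setT (spherical r : mR * mR -> borel3 R).
Proof. by rewrite /spherical; meas_trig. Qed.

(** Cylindrical coordinates around the vertical axis, followed by polar coordinates in the
    half-plane of height and distance to the axis. That distance s sin t appears as the additional
    Jacobian. *)
Lemma sphere_polar (g : borel3 R -> \bar R) :
  measurable_fun setT g -> (forall x, 0 <= g x) ->
  \int[leb3]_x g x =
  \int[mu]_f ((full_arc_ind f)%:E * \int[mu]_t ((arc_ind t)%:E *
    \int[mu]_s ((pos_ind s * s ^+ 2 * sin t)%:E * g (s *: spherical 1 (t, f) : R3 R)%R))).
Proof.
move=> mg g0.
have g0' (k : R) x : (0 <= k)%R -> 0 <= k%:E * g x by move=> k0; apply: mule_ge0.
pose h z (p : mR * mR) := g (p, z).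
have mh z : measurable_fun setT (h z).
  exact: (measurableT_comp mg (@pair2_measurable _ _ _ _ z)).
have -> : \int[leb3]_x g x = \int[mu]_z \int[mu]_a \int[mu]_b h z (a, b).
  transitivity (\int[mu]_z \int[leb2]_p g (p, z)).
    exact: (fubini_tonelli2 (m1 := leb2sf) (m2 := mu) _ mg g0).
  apply: eq_integral => z _.
  exact: (fubini_tonelli1 (m1 := mu) (m2 := mu) _ (mh z) (fun p => g0 (p, z))).
pose k (q : (mR * mR) * mR) :=
  (full_arc_ind q.1.2 * (pos_ind q.2 * q.2))%:E * g ((q.2 * cos q.1.2, q.2 * sin q.1.2), q.1.1)%R.
have mk : measurable_fun setT k.
  apply: (measurable_weighted _ _ mg); last by meas_trig.
  by apply: measurable_funM; [apply: measurable_full_arc_ind; meas|meas_trig].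
have k0 q : 0 <= k q.
  by apply: g0'; apply: mulr_ge0; [exact: full_arc_ind_ge0|exact: pos_ind_mul_ge0].
pose K (p : mR * mR) := \int[mu]_s k (p, s).
have mK : measurable_fun setT K by exact: (measurable_fun_fubini_tonelli_F (m2 := mu) _ mk k0).
have K0 p : 0 <= K p by apply: integral_ge0.
transitivity (\int[mu]_z \int[mu]_f K (z, f)).
  apply: eq_integral => z _; rewrite (plane_polar (mh z) (fun p => g0 (p, z))).
  apply: eq_integral => f _; rewrite /K -ge0_integralZl//; last 3 first.
  - by apply: (measurable_weighted _ _ (mh z)); meas_trig.
  - by move=> s _; apply: g0'; exact: pos_ind_mul_ge0.
  - by rewrite lee_fin; exact: full_arc_ind_ge0.
  by apply: eq_integral => s _; rewrite /k /h /= muleA -EFinM.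
rewrite (@fubini_tonelli _ _ _ _ _ mu mu _ mK K0).
apply: eq_integral => f _.
pose w (p : mR * mR) := (pos_ind p.2 * p.2)%:E * g ((p.2 * cos f, p.2 * sin f), p.1)%R.
have mw : measurable_fun setT w by apply: (measurable_weighted _ _ mg); meas_trig.
have w0 p : 0 <= w p by apply: g0'; exact: pos_ind_mul_ge0.
have pp (s : R) : (pos_ind s * pos_ind s = pos_ind s)%R.
  by rewrite /pos_ind; case: (0 < s)%R; rewrite /= ?mul1r ?mul0r.
transitivity ((full_arc_ind f)%:E * \int[mu]_z \int[mu]_s ((pos_ind s)%:E * w (z, s))).
  have mpw : measurable_fun setT (fun p : mR * mR => (pos_ind p.2)%:E * w p).
    by apply: (measurable_weighted _ (@measurable_id _ _ _) mw); meas_trig.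
  have pw0 (p : mR * mR) : 0 <= (pos_ind p.2)%:E * w p.
    by apply: mule_ge0 => //; rewrite lee_fin; exact: pos_ind_ge0.
  have f0 : 0 <= (full_arc_ind f)%:E by rewrite lee_fin; exact: full_arc_ind_ge0.
  rewrite -ge0_integralZl//; last 2 first.
  - exact: (measurable_fun_fubini_tonelli_F (m2 := mu) _ mpw pw0).
  - by move=> z _; apply: integral_ge0 => s _; exact: (pw0 (z, s)).
  apply: eq_integral => z _; rewrite /K -ge0_integralZl//; last 2 first.
  - exact: (measurableT_comp mpw (@pair1_measurable _ _ _ _ z)).
  - by move=> s _; exact: (pw0 (z, s)).
  apply: eq_integral => s _; rewrite /k /w /= !muleA -!EFinM.
  by rewrite -[in RHS]mulrA [(pos_ind s * (_ * s))%R]mulrA pp.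
congr (_ * _); rewrite (half_plane_polar mw w0); apply: eq_integral => t _.
have [/andP[t0 tp]|tn] := boolP ((0 < t) && (t < pi))%R; last by rewrite /arc_ind (negbTE tn) !mul0e.
have st : (0 < sin t)%R by rewrite sin_gt0_pi// t0.
congr (_ * _); apply: eq_integral => s _; rewrite /w /= muleA -EFinM.
rewrite (mulrC s (sin t)) pos_indM// (mulrC (sin t) s).
congr (_%:E * g _).
  transitivity (pos_ind s * pos_ind s * s ^+ 2 * sin t)%R; first by ring.
  by rewrite pp.
apply: R3_ext; rewrite /spherical /=.
- by rewrite -[RHS]/(s * (1 * sin t * cos f))%R mul1r mulrA.
- by rewrite -[RHS]/(s * (1 * sin t * sin f))%R mul1r mulrA.
- by rewrite -[RHS]/(s * (1 * cos t))%R mul1r.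
Qed.

Lemma integral_sqr01 : \int[mu]_s (pos_ind s * s ^+ 2 * (s < 1)%R%:R)%:E = (3^-1)%:E.
Proof.
have -> : \int[mu]_s (pos_ind s * s ^+ 2 * (s < 1)%R%:R)%:E = \int[mu]_(s in `]0%R, 1%R[) (s ^+ 2)%:E.
  rewrite [RHS]integral_indic_mul; apply: eq_integral => s _; rewrite -EFinM; congr EFin.
  rewrite mulrAC; congr (_ * _)%R; rewrite /pos_ind -natrM mulnb indicE; congr (nat_of_bool _)%:R.
  by apply/idP/idP; rewrite inE/= in_itv/=.
have ms (D : set mR) : measurable_fun D (fun s : mR => (s ^+ 2)%:E).
  by apply/measurable_EFinP; apply: measurable_funTS; meas.
rewrite -(@integral_itv_bndoo _ 0%R 1%R (fun s : R => (s ^+ 2)%:E) true false (ms _)).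
have dF (t : R) : is_derive t (1:R)%R (fun t => t ^+ 3 / 3)%R (t ^+ 2)%R.
  by apply: is_derive_eq; rewrite /GRing.scale/=; field.
rewrite (integral_is_derive ler01 _ dF); last by move=> ?; exact: exprn_continuous.
by congr EFin; rewrite expr1n expr0n /= mul0r subr0 mul1r.
Qed.

(** The bridge between directions of points of the ball and angles: the integrand depends only on
    the direction, so the radial integral splits off as 1/3 and cancels the factor 3. *)
Lemma sphere_angles (F : borel3 R -> \bar R) :
  measurable_fun setT F -> (forall x, 0 <= F x) ->
  3%:E * \int[leb3]_(y in pball) F ((enorm y)^-1 *: (y : R3 R))%R =
  \int[mu]_f ((full_arc_ind f)%:E * \int[mu]_t ((arc_ind t * sin t)%:E *
     F (spherical 1 (t, f)))).
Proof.
move=> mF F0.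
pose g (x : borel3 R) := (\1_pball x)%:E * F ((enorm x)^-1 *: (x : R3 R))%R.
have mg : measurable_fun setT g.
  apply: (measurable_weighted _ _ mF); last by meas3.
  by apply: measurable_indic; exact: measurable_pball.
have g0 x : 0 <= g x by apply: mule_ge0 => //; rewrite lee_fin.
rewrite [in LHS]integral_indic_mul -/(\int[leb3]_x g x) (sphere_polar mg g0).
have as0 (t : R) : (0 <= arc_ind t * sin t)%R.
  rewrite /arc_ind; have [/andP[t0 tp]|_] := boolP ((0 < t) && (t < pi))%R; last by rewrite mul0r.
  by rewrite mul1r ltW// sin_gt0_pi// t0.
have mFs : measurable_fun setT (fun p : mR * mR => F (spherical 1 (p.2, p.1))).
  by apply: (measurableT_comp mF); apply: (measurableT_comp (measurable_spherical 1)); meas.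
have mA : measurable_fun setT (fun p : mR * mR => (arc_ind p.2 * sin p.2)%:E * F (spherical 1 (p.2, p.1))).
  by apply: (measurable_weighted (k := fun p : mR * mR => spherical 1 (p.2, p.1) : borel3 R) _ _ mF);
    [meas_trig|apply: (measurableT_comp (measurable_spherical 1)); meas].
have A0 (p : mR * mR) : 0 <= (arc_ind p.2 * sin p.2)%:E * F (spherical 1 (p.2, p.1)).
  by apply: mule_ge0; [rewrite lee_fin; exact: as0|exact: F0].
have mAt f : measurable_fun setT (fun t : mR => (arc_ind t * sin t)%:E * F (spherical 1 (t, f))).
  exact: (measurableT_comp mA (@pair1_measurable _ _ _ _ f)).
have inner f t : (arc_ind t)%:E * \int[mu]_s ((pos_ind s * s ^+ 2 * sin t)%:E * g (s *: spherical 1 (t, f) : R3 R)%R)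
    = (3^-1)%:E * ((arc_ind t * sin t)%:E * F (spherical 1 (t, f))).
  have [/andP[t0 tp]|tn] := boolP ((0 < t) && (t < pi))%R; last first.
    by rewrite /arc_ind (negbTE tn) mul0r !mul0e mule0.
  have st : (0 < sin t)%R by rewrite sin_gt0_pi// t0.
  have -> : arc_ind t = 1%R by rewrite /arc_ind t0 tp.
  rewrite mul1e mul1r.
  transitivity (\int[mu]_s ((sin t)%:E * F (spherical 1 (t, f)) * (pos_ind s * s ^+ 2 * (s < 1)%R%:R)%:E)).
    apply: eq_integral => s _; have [s0|s0] := ltP 0%R s; last first.
      by rewrite pos_ind0// !mul0r mul0e mule0.
    rewrite pos_ind1// !mul1r /g enormZ enorm_spherical1 mulr1 gtr0_norm// scalerA mulVf ?gt_eqF//.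
    rewrite scale1r.
    have -> : (\1_pball (s *: spherical 1 (t, f) : R3 R) = (s < 1)%R%:R :> R)%R.
      rewrite indicE; congr (nat_of_bool _)%:R; apply/idP/idP.
        by rewrite inE/pball/= enormZ enorm_spherical1 mulr1 gtr0_norm// => /andP[].
      by move=> s1; rewrite inE /pball/= enormZ enorm_spherical1 mulr1 gtr0_norm// s0.
    by rewrite muleA -EFinM muleAC -EFinM; congr (_%:E * _); ring.
  rewrite ge0_integralZl//; last 3 first.
  - by apply/measurable_EFinP; meas_trig.
  - move=> s _; rewrite lee_fin; apply: mulr_ge0; last exact: ler0n.
    by apply: mulr_ge0; [exact: pos_ind_ge0|exact: sqr_ge0].
  - by apply: mule_ge0 => //; rewrite lee_fin ltW.
  by rewrite integral_sqr01 muleC.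
pose A f := \int[mu]_t ((arc_ind t * sin t)%:E * F (spherical 1 (t, f))).
have A0' f : 0 <= A f by apply: integral_ge0 => t _; exact: (A0 (f, t)).
have mA' : measurable_fun setT (A : mR -> \bar R).
  exact: (measurable_fun_fubini_tonelli_F (m2 := mu) _ mA A0).
transitivity (3%:E * \int[mu]_f ((full_arc_ind f)%:E * ((3^-1)%:E * A f))).
  congr (_ * _); apply: eq_integral => f _; congr (_ * _).
  rewrite /A -ge0_integralZl//; last by move=> t _; exact: (A0 (f, t)).
  by apply: eq_integral => t _; rewrite inner.
rewrite -ge0_integralZl//; last 2 first.
- apply: emeasurable_funM; first by apply/measurable_EFinP; exact: measurable_full_arc_ind.
  by apply: emeasurable_funM.
- move=> f _; apply: mule_ge0; first by rewrite lee_fin; exact: full_arc_ind_ge0.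
  by apply: mule_ge0; [rewrite lee_fin invr_ge0|exact: A0'].
by apply: eq_integral => f _; rewrite muleCA; congr (_ * _); rewrite muleA -EFinM mulfV// mul1e.
Qed.

End Spherical_angles.

(** * Identification of the surface measure of the sphere *)

Section Sphere_measure.
Context {R : realType}.
Notation mR := (measurableTypeR R).
Notation mu := (@lebesgue_measure R).
Implicit Types (t v : R * R).

Lemma is_derive_pair {U V W : normedModType R} (f : U -> V) (g : U -> W) (x v : U) df dg :
  is_derive x v f df -> is_derive x v g dg -> is_derive x v (fun y => (f y, g y)) (df, dg).
Proof.
move=> [df1 <-] [dg1 <-].
have H : (fun h : R => h^-1 *: ((f (h *: v + x), g (h *: v + x)) - (f x, g x))) @ 0^' -->
    ('D_v f x, 'D_v g x).
  exact: (cvg_pair df1 dg1).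
split; first by apply/cvg_ex; eexists; exact: H.
exact: (cvg_lim (@norm_hausdorff _ _) H).
Qed.

Lemma is_derive_spherical_line (r : R) t v : is_derive t v (spherical r)
  (v.1 * (r * cos t.1 * cos t.2) - v.2 * (r * sin t.1 * sin t.2),
   v.1 * (r * cos t.1 * sin t.2) + v.2 * (r * sin t.1 * cos t.2),
   - (v.1 * (r * sin t.1))).
Proof.
apply: line_is_derive.
pose a (h : R) := t.1 + h * v.1; pose b (h : R) := t.2 + h * v.2.
have aE : a 0 = t.1 by rewrite /a mul0r addr0.
have bE : b 0 = t.2 by rewrite /b mul0r addr0.
have da : is_derive (0:R) (1:R) a v.1 by apply: is_derive_eq; rewrite /GRing.scale/=; ring.
have db : is_derive (0:R) (1:R) b v.2 by apply: is_derive_eq; rewrite /GRing.scale/=; ring.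
have dsa := @is_derive1_comp R sin a 0 _ _ (is_derive_sin (a 0)) da.
have dca := @is_derive1_comp R cos a 0 _ _ (is_derive_cos (a 0)) da.
have dsb := @is_derive1_comp R sin b 0 _ _ (is_derive_sin (b 0)) db.
have dcb := @is_derive1_comp R cos b 0 _ _ (is_derive_cos (b 0)) db.
have dr := is_derive_cst r (0:R) (1:R).
rewrite (_ : (fun h => _) = (fun h => (r * (sin (a h) * cos (b h)), r * (sin (a h) * sin (b h)), r * cos (a h)))); last first.
  by apply/funext => h; rewrite /spherical /= !mulrA.
apply: is_derive_pair; first apply: is_derive_pair.
- apply: (is_derive_eq (is_deriveM dr (is_deriveM dsa dcb))).
  rewrite /GRing.scale/= aE bE.
  by move: (sin t.1) (cos t.1) (sin t.2) (cos t.2) => s1 c1 s2 c2; ring.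
- apply: (is_derive_eq (is_deriveM dr (is_deriveM dsa dsb))).
  rewrite /GRing.scale/= aE bE.
  by move: (sin t.1) (cos t.1) (sin t.2) (cos t.2) => s1 c1 s2 c2; ring.
- apply: (is_derive_eq (is_deriveM dr dca)).
  rewrite /GRing.scale/= aE.
  by move: (sin t.1) (cos t.1) => s1 c1; ring.
Qed.

(** The cross product of the two tangent vectors is r^2 sin t.1 times the outward unit normal. *)
Lemma spherical_area (r : R) t :
  enorm (cross ('D_(1, 0) (spherical r) t) ('D_(0, 1) (spherical r) t)) = r ^+ 2 * `|sin t.1|.
Proof.
have [_ ->] := is_derive_spherical_line r t (1, 0).
have [_ ->] := is_derive_spherical_line r t (0, 1).
rewrite /= !mul0r !mul1r !subr0 oppr0 !addr0 sub0r add0r.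
rewrite (_ : cross _ _ = (r ^+ 2 * sin t.1) *: spherical 1 t); last first.
  apply: R3_ext; rewrite /cross /spherical /=.
  - rewrite -[RHS]/(r ^+ 2 * sin t.1 * (1 * sin t.1 * cos t.2)); ring.
  - rewrite -[RHS]/(r ^+ 2 * sin t.1 * (1 * sin t.1 * sin t.2)); ring.
  rewrite -[RHS]/(r ^+ 2 * sin t.1 * (1 * cos t.1)).
  transitivity (r ^+ 2 * sin t.1 * cos t.1 * (cos t.2 ^+ 2 + sin t.2 ^+ 2)); first by ring.
  by rewrite cos2Dsin2 mulr1 mul1r.
by rewrite enormZ enorm_spherical1 mulr1 normrM (ger0_norm (sqr_ge0 r)).
Qed.

Local Open Scope ereal_scope.

Lemma measurable_radial (r : R) :
  measurable_fun setT (fun y : borel3 R => (r / enorm y)%R *: (y : R3 R) : borel3 R).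
Proof. by meas3. Qed.

(** Both sides reduce to the same integral over angles. The closed parameter interval [0, pi] and
    the open one used here differ only at the poles, where the area element vanishes. *)
Lemma sphere_measureE (r : R) (A : set (borel3 R)) : measurable A ->
  sphere_measure r A =
  (3 * r ^+ 2)%:E * leb3 (pball `&` (fun y : borel3 R => (r / enorm y)%R *: (y : R3 R) : borel3 R) @^-1` A).
Proof.
move=> mA; pose F (x : borel3 R) : \bar R := (\1_A (r *: (x : R3 R) : R3 R))%:E.
have mF : measurable_fun setT F.
  apply/measurable_EFinP; apply: (measurableT_comp (measurable_indic mA)).
  apply: measurable_scale3; [exact: measurable_cst|exact: measurable_id].
have F0 x : 0 <= F x by rewrite lee_fin.
have mS : measurable (pball `&` (fun y : borel3 R => (r / enorm y)%R *: (y : R3 R) : borel3 R) @^-1` A).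
  apply: measurableI; first exact: measurable_pball.
  by rewrite -[X in measurable X]setTI; exact: measurable_radial.
transitivity ((r ^+ 2)%:E * (3%:E * \int[leb3]_(y in pball) F ((enorm y)^-1 *: (y : R3 R))%R)); last first.
  rewrite muleA -EFinM (mulrC (r ^+ 2)%R); congr (_ * _).
  transitivity (\int[leb3]_y (\1_(pball `&` (fun y : borel3 R => (r / enorm y)%R *: (y : R3 R) : borel3 R) @^-1` A) y)%:E); last first.
    by rewrite (integral_indic leb3 measurableT mS) setIT.
  rewrite [LHS]integral_indic_mul; apply: eq_integral => y _.
  by rewrite indicI EFinM; congr (_ * _); rewrite /F scalerA.
rewrite (sphere_angles mF F0).
pose k (t : mR * mR) : \bar R := (full_arc_ind t.2 * (arc_ind t.1 * sin t.1))%:E * F (spherical 1 t).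
have as0 (t : R) : (0 <= arc_ind t * sin t)%R.
  rewrite /arc_ind; have [/andP[t0 tp]|_] := boolP ((0 < t) && (t < pi))%R; last by rewrite mul0r.
  by rewrite mul1r ltW// sin_gt0_pi// t0.
have k0 t : 0 <= k t.
  apply: mule_ge0; last exact: F0.
  by rewrite lee_fin; apply: mulr_ge0; [exact: full_arc_ind_ge0|exact: as0].
have mk : measurable_fun setT k.
  apply: (measurable_weighted _ (measurable_spherical 1) mF).
  by apply: measurable_funM; [apply: measurable_full_arc_ind; exact: measurable_snd|meas_trig].
have mks f : measurable_fun setT (fun t : mR => (arc_ind t * sin t)%:E * F (spherical 1 (t, f))).
  apply: (measurable_weighted (k := fun t : mR => spherical 1 (t, f) : borel3 R) _ _ mF); first by meas_trig.
  by apply: (measurableT_comp (measurable_spherical 1)); meas.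
transitivity ((r ^+ 2)%:E * \int[leb2]_t k t); last first.
  congr (_ * _); rewrite (fubini_tonelli2 (m1 := mu) (m2 := mu) _ mk k0).
  apply: eq_integral => f _; rewrite /fubini_G -ge0_integralZl//; last 2 first.
  - by move=> t _; apply: mule_ge0; [rewrite lee_fin; exact: as0|exact: F0].
  - by rewrite lee_fin; exact: full_arc_ind_ge0.
  by apply: eq_integral => t _; rewrite /k /= EFinM muleA.
rewrite -ge0_integralZl//; last by rewrite lee_fin sqr_ge0.
rewrite /sphere_measure /surface_measure [LHS]integral_indic_mul.
apply: eq_integral => -[t f] _; rewrite spherical_area /k /F -sphericalE /=.
have [tb|tb] := boolP ((0 < t) && (t < pi))%R; last first.
  rewrite /arc_ind (negbTE tb) mul0r mulr0 mul0e mule0.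
  have [tI|tI] := boolP ((t, f) \in (`[0%R, pi]%classic `*` `[0%R, (2 * pi)%R]%classic : set (mR * mR))); last by rewrite indicE (negbTE tI) mul0e.
  rewrite (_ : sin t = 0%R) ?normr0 ?mulr0 ?mule0//.
  move: tI; rewrite inE => -[/=]; rewrite in_itv/= => /andP[t0 tp] _.
  move: tb; rewrite (lt_neqAle 0%R) t0 andbT (lt_neqAle t) tp andbT negb_and !negbK.
  by move=> /orP[/eqP <-|/eqP ->]; [exact: sin0|exact: sinpi].
have [t0 tp] := andP tb; have st : (0 < sin t)%R by rewrite sin_gt0_pi.
rewrite gtr0_norm//.
have -> : \1_(`[0%R, pi]%classic `*` `[0%R, (2 * pi)%R]%classic : set (mR * mR)) (t, f) = full_arc_ind f.
  rewrite /full_arc_ind !indicE; congr (nat_of_bool _)%:R; apply/idP/idP; rewrite !inE/=.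
    by move=> [].
  by move=> fI; split => //=; rewrite in_itv/= !ltW.
rewrite /arc_ind tb mul1r -!EFinM; congr EFin; ring.
Qed.

End Sphere_measure.

(** * Symmetries of the field of a shell *)

Section Shell_field.
Context {R : realType}.
Notation mR := (measurableTypeR R).
Notation mu := (@lebesgue_measure R).
Implicit Types (x y v w : R3 R).

(** At the origin the scalar multiple is 0 whatever the inverse is, so the case distinction
    disappears. *)
Lemma K0E x : K0 x = (enorm x)^-1 *: x.
Proof. by rewrite /K0; case: eqP => [->|//]; rewrite scaler0. Qed.

Lemma dot_K0_le v x : `|dot v (K0 x)| <= enorm v.
Proof.
apply: le_trans (cauchy_schwarz _ _) _; rewrite K0E enormZ.
have [->|x0] := eqVneq (enorm x) 0; first by rewrite !mulr0 enorm_ge0.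
by rewrite ger0_norm ?invr_ge0 ?enorm_ge0// mulVf// mulr1.
Qed.

Lemma measurable_dot_K0 d (X : measurableType d) (f : X -> borel3 R) v :
  measurable_fun setT f -> measurable_fun setT (fun t => dot v (K0 (f t)) : R).
Proof.
move=> mf; under eq_fun do rewrite K0E.
apply: (@measurable_dot _ _ _ (cst (v : borel3 R))); first exact: measurable_cst.
by apply: measurable_scale3 => //; meas3.
Qed.

Variable s : R.

Lemma measurable_shell_kernel v x :
  measurable_fun setT (fun y : borel3 R => dot v (K0 (x - (s / enorm y) *: (y : R3 R))) : R).
Proof.
apply: (@measurable_dot_K0 _ _ (fun y : borel3 R => x - (s / enorm y) *: (y : R3 R) : borel3 R)).
rewrite (_ : (fun y => _) = (fun y : borel3 R => (x : R3 R) + (- (s / enorm y)) *: (y : R3 R))); last first.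
  by apply/funext => y; rewrite scaleNr.
by apply: measurable_add3; [exact: measurable_cst|meas3].
Qed.

Lemma integrable_shell_kernel v x : leb3.-integrable pball
  (fun y : borel3 R => (dot v (K0 (x - (s / enorm y) *: (y : R3 R))))%:E).
Proof.
apply: (@integrable_pball _ (fun y => dot v (K0 (x - (s / enorm y) *: (y : R3 R)))) (enorm v)).
  exact: measurable_shell_kernel.
by move=> y; exact: dot_K0_le.
Qed.

(** One third of the integral over unit vectors n of v . K0 (x - s n). Working with the component
    along v lets an orthogonal map be moved from x to v through its adjoint. *)
Definition shell_field v x : R :=
  \int[leb3]_(y in (pball : set (borel3 R))) dot v (K0 (x - (s / enorm y) *: (y : R3 R))).

Definition orthogonal_map (Q Q' : R3 R -> R3 R) : Prop :=
  [/\ preserving leb3 (Q : borel3 R -> borel3 R),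
      forall x (k : R) y, Q (x + k *: y) = Q x + k *: Q y,
      forall v w, dot v (Q w) = dot (Q' v) w
    & forall w, Q' (Q w) = w].

(** The substitution y |-> Q y preserves volume and the punctured ball, and K0 commutes with Q
    because Q preserves the norm. *)
Lemma shell_field_orthogonal Q Q' v x : orthogonal_map Q Q' ->
  shell_field v (Q x) = shell_field (Q' v) x.
Proof.
move=> [pQ linQ adjQ QK].
have nQ y : enorm (Q y) = enorm y by rewrite /enorm adjQ QK.
have Q0 : Q 0 = 0.
  have := linQ 0 (-1) 0; rewrite scaler0 addr0 scaleN1r subrr.
  exact.
have KQ y : K0 (Q y) = Q (K0 y).
  by rewrite !K0E nQ; have := linQ 0 (enorm y)^-1 y; rewrite Q0 !add0r => ->.
pose f (y : borel3 R) : \bar R := ((\1_pball y)%:E * (dot v (K0 (Q x - (s / enorm y) *: (y : R3 R))))%:E)%E.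
have mf : measurable_fun setT f.
  apply: emeasurable_funM; apply/measurable_EFinP.
    by apply: measurable_indic; exact: measurable_pball.
  exact: measurable_shell_kernel.
rewrite /shell_field /Rintegral [X in fine X = _]integral_indic_mul [X in _ = fine X]integral_indic_mul.
congr fine; rewrite -[LHS](preserving_integral pQ mf); apply: eq_integral => y _.
rewrite /f nQ -scaleNr -linQ KQ adjQ scaleNr; congr (_%:E * _)%E.
rewrite !indicE; congr (nat_of_bool _)%:R.
by apply/idP/idP; rewrite !inE /pball/= nQ.
Qed.

Lemma shell_fieldDl v w x : shell_field (v + w) x = shell_field v x + shell_field w x.
Proof.
rewrite /shell_field -RintegralD; last 3 first.
- exact: measurable_pball.
- exact: integrable_shell_kernel.
- exact: integrable_shell_kernel.
by apply: eq_Rintegral => y _; rewrite dotDl.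
Qed.

Lemma shell_fieldZl (k : R) v x : shell_field (k *: v) x = k * shell_field v x.
Proof.
rewrite /shell_field -RintegralZl; last 2 first.
- exact: measurable_pball.
- exact: integrable_shell_kernel.
by apply: eq_Rintegral => y _; rewrite dotZl.
Qed.

Lemma R3_coords v : v = v.1.1 *: e1 + v.1.2 *: e2 + v.2 *: e3.
Proof.
case: v => -[a b] c; apply: R3_ext; rewrite /=.
- by rewrite -[RHS]/(a * 1 + b * 0 + c * 0) !mulr0 mulr1 !addr0.
- by rewrite -[RHS]/(a * 0 + b * 1 + c * 0) !mulr0 mulr1 addr0 add0r.
- by rewrite -[RHS]/(a * 0 + b * 0 + c * 1) !mulr0 mulr1 !add0r.
Qed.

Definition flip (a b c : bool) x : R3 R :=
  (((-1) ^+ a * x.1.1, (-1) ^+ b * x.1.2), (-1) ^+ c * x.2).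

Lemma flip_orthogonal a b c : orthogonal_map (flip a b c) (flip a b c).
Proof.
have sE (e : bool) : (-1) ^+ e * (-1) ^+ e = 1 :> R by rewrite -signr_addb addbb.
split.
- exact: leb3_flip.
- by move=> x k y; apply: R3_ext; rewrite /flip /=; rewrite -[LHS]/(_ * (_ + k * _)) mulrDr;
    congr (_ + _); rewrite mulrCA.
- move=> v w; rewrite /dot /flip /=.
  by congr (_ + _ + _); rewrite mulrCA mulrA.
- by move=> w; apply: R3_ext; rewrite /flip /= mulrA sE mul1r.
Qed.

Lemma rot12_orthogonal (c t : R) : c ^+ 2 + t ^+ 2 = 1 -> 1 + c != 0 ->
  orthogonal_map (rot12 c t) (rot12 c (- t)).
Proof.
move=> ct c1; split.
- exact: preserving_rot12.
- move=> x k y; apply: R3_ext => //.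
    rewrite -[LHS]/(c * (x.1.1 + k * y.1.1) - t * (x.1.2 + k * y.1.2)).
    by rewrite -[RHS]/(c * x.1.1 - t * x.1.2 + k * (c * y.1.1 - t * y.1.2)); ring.
  rewrite -[LHS]/(t * (x.1.1 + k * y.1.1) + c * (x.1.2 + k * y.1.2)).
  by rewrite -[RHS]/(t * x.1.1 + c * x.1.2 + k * (t * y.1.1 + c * y.1.2)); ring.
- by move=> v w; rewrite /dot /rot12 /=; ring.
move=> w; apply: R3_ext => //; rewrite /rot12 /=.
  transitivity ((c ^+ 2 + t ^+ 2) * w.1.1); first by ring.
  by rewrite ct mul1r.
transitivity ((c ^+ 2 + t ^+ 2) * w.1.2); first by ring.
by rewrite ct mul1r.
Qed.

Lemma rot23_orthogonal (c t : R) : c ^+ 2 + t ^+ 2 = 1 -> 1 + c != 0 ->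
  orthogonal_map (rot23 c t) (rot23 c (- t)).
Proof.
move=> ct c1; split.
- exact: preserving_rot23.
- move=> x k y; apply: R3_ext => //.
    rewrite -[LHS]/(c * (x.1.2 + k * y.1.2) - t * (x.2 + k * y.2)).
    by rewrite -[RHS]/(c * x.1.2 - t * x.2 + k * (c * y.1.2 - t * y.2)); ring.
  rewrite -[LHS]/(t * (x.1.2 + k * y.1.2) + c * (x.2 + k * y.2)).
  by rewrite -[RHS]/(t * x.1.2 + c * x.2 + k * (t * y.1.2 + c * y.2)); ring.
- by move=> v w; rewrite /dot /rot23 /=; ring.
move=> w; apply: R3_ext => //; rewrite /rot23 /=.
  transitivity ((c ^+ 2 + t ^+ 2) * w.1.2); first by ring.
  by rewrite ct mul1r.
transitivity ((c ^+ 2 + t ^+ 2) * w.2); first by ring.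
by rewrite ct mul1r.
Qed.

(** A reflection that fixes x and reverses v shows that the component equals its own opposite. *)
Lemma shell_field_flip_eq0 a b c v x : flip a b c x = x -> flip a b c v = - v ->
  shell_field v x = 0.
Proof.
move=> fx fv; have := shell_field_orthogonal v x (flip_orthogonal a b c).
rewrite fx fv -scaleN1r shell_fieldZl mulN1r => /eqP.
by rewrite -addr_eq0 -mulr2n mulrn_eq0/= => /eqP.
Qed.

Lemma shell_field_axis v (z : R) : shell_field v (0, 0, z) = v.2 * shell_field e3 (0, 0, z).
Proof.
rewrite {1}(R3_coords v) !shell_fieldDl !shell_fieldZl.
rewrite (@shell_field_flip_eq0 true false false e1); last 2 first.
- by apply: R3_ext; rewrite /flip /= ?mulr0 ?expr0 ?mul1r.
- by apply: R3_ext; rewrite /flip /= ?expr1 ?expr0 ?mulr0 ?oppr0 ?mulN1r.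
rewrite (@shell_field_flip_eq0 false true false e2) ?mulr0 ?add0r//.
- by apply: R3_ext; rewrite /flip /= ?mulr0 ?expr0 ?mul1r.
- by apply: R3_ext; rewrite /flip /= ?expr1 ?expr0 ?mulr0 ?oppr0 ?mulN1r.
Qed.

Lemma shell_field0 v : shell_field v 0 = 0.
Proof.
rewrite (shell_field_axis v 0) (@shell_field_flip_eq0 false false true e3) ?mulr0//.
- by apply: R3_ext; rewrite /flip /= ?mulr0.
- by apply: R3_ext; rewrite /flip /= ?expr1 ?expr0 ?mulr0 ?oppr0 ?mulN1r.
Qed.

(* Every x is the image of (0, 0, |x|) under flips and two plane rotations. *)
Lemma shell_field_radial (kap : R) x :
  shell_field e3 (0, 0, enorm x) = kap * enorm x ->
  forall v, shell_field v x = kap * dot v x.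
Proof.
set z := enorm x => Hz.
have base v : shell_field v (0, 0, z) = kap * dot v (0, 0, z).
  by rewrite shell_field_axis Hz /dot /= !mulr0 !add0r mulrCA.
have step Q Q' y : orthogonal_map Q Q' -> (forall v, shell_field v y = kap * dot v y) ->
    forall v, shell_field v (Q y) = kap * dot v (Q y).
  by move=> oQ H v; rewrite (shell_field_orthogonal v y oQ) H; have [_ _ ->] := oQ.
have [z0|z0] := eqVneq z 0.
  move=> v; have -> : x = 0 by apply/eqP; rewrite -enorm_eq0 -/z z0.
  by rewrite shell_field0 /dot /= !mulr0 !addr0 mulr0.
pose rho := Num.sqrt (x.1.1 ^+ 2 + x.1.2 ^+ 2).
have zE : z ^+ 2 = x.1.1 ^+ 2 + x.1.2 ^+ 2 + x.2 ^+ 2 by rewrite /z sqr_enorm /dot !expr2.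
have rE : rho ^+ 2 = x.1.1 ^+ 2 + x.1.2 ^+ 2 by rewrite sqr_sqrtr// addr_ge0 ?sqr_ge0.
have zp : 0 < z by rewrite lt_def z0 enorm_ge0.
(* Absolute values keep the cosines nonnegative, away from the excluded half-turn; the signs of the
   coordinates are restored by the final flip. *)
pose c2 := `|x.2| / z; pose t2 := rho / z.
have c20 : 0 <= c2 by rewrite divr_ge0// ltW.
have ct2 : c2 ^+ 2 + t2 ^+ 2 = 1.
  rewrite /c2 /t2 !expr_div_n rE real_normK ?num_real// -mulrDl addrC -zE divff//.
  by rewrite sqrf_eq0.
have h2 : 1 + c2 != 0 by rewrite gt_eqF// ltr_wpDr.
have H2 := step _ _ _ (rot23_orthogonal ct2 h2) base.
have E2 : rot23 c2 t2 (0, 0, z) = (0, - rho, `|x.2|).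
  apply: R3_ext => //; rewrite /rot23 /= mulr0 ?add0r ?sub0r /c2 /t2.
    by rewrite divfK.
  by rewrite divfK.
rewrite E2 in H2.
(* When rho = 0 the point lies on the vertical axis and the identity rotation is used. *)
pose c1 := if rho == 0 then 1 else `|x.1.2| / rho.
pose t1 := if rho == 0 then 0 else `|x.1.1| / rho.
have rho0 : 0 <= rho by rewrite sqrtr_ge0.
have ct1 : c1 ^+ 2 + t1 ^+ 2 = 1.
  rewrite /c1 /t1; case: eqP => [_|/eqP r0]; first by rewrite expr1n expr0n/= addr0.
  by rewrite !expr_div_n !real_normK ?num_real// -mulrDl addrC -rE divff// sqrf_eq0.
have h1 : 1 + c1 != 0.
  by rewrite gt_eqF// ltr_wpDr//; rewrite /c1; case: ifP => // _; rewrite divr_ge0.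
have H1 := step _ _ _ (rot12_orthogonal ct1 h1) H2.
have E1 : rot12 c1 t1 (0, - rho, `|x.2|) = (`|x.1.1|, - `|x.1.2|, `|x.2|).
  rewrite /rot12 /= !mulr0 !add0r mulrN opprK mulrN /c1 /t1.
  case: eqP => [r0|/eqP r0]; last by rewrite !divfK.
  move: rE; rewrite r0 expr0n/= => /esym/eqP.
  rewrite paddr_eq0 ?sqr_ge0// !sqrf_eq0 => /andP[/eqP -> /eqP ->].
  by rewrite !mulr0 !normr0.
rewrite E1 in H1.
have H0 := step _ _ _ (flip_orthogonal (x.1.1 < 0) (0 <= x.1.2) (x.2 < 0)) H1.
suff -> : x = flip (x.1.1 < 0) (0 <= x.1.2) (x.2 < 0) (`|x.1.1|, - `|x.1.2|, `|x.2|) by exact: H0.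
have sg (u : R) : (-1) ^+ (u < 0)%R * `|u| = u.
  have [u0|u0] := boolP (u < 0); first by rewrite expr1 mulN1r ltr0_norm// opprK.
  by rewrite expr0 mul1r ger0_norm// leNgt.
apply: R3_ext; rewrite /flip /= ?sg//.
have [u0|u0] := boolP (0 <= x.1.2); first by rewrite expr1 mulN1r opprK ger0_norm.
by rewrite expr0 mul1r ltr0_norm ?opprK// ltNge.
Qed.

End Shell_field.

(** * The field inside a shell *)

Section Shell_theorem.
Context {R : realType}.
Notation mR := (measurableTypeR R).
Notation mu := (@lebesgue_measure R).
Implicit Types (x y v w : R3 R).

(** The angular formula is available for nonnegative functions, so the bound C is added to f and
    subtracted again. The term 2 C comes from the integral of sin over ]0, pi[. *)
Lemma integral_pball_real (f : borel3 R -> R) (C I : R) :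
  measurable_fun setT f -> (forall y, `|f y| <= C) -> 0 <= C ->
  (forall k, \int[mu]_t ((arc_ind t * sin t)%:E * (f (spherical 1 (t, k)) + C)%:E) = (I + 2 * C)%:E)%E ->
  (\int[mu]_t ((arc_ind t * sin t)%:E) = 2%:E)%E ->
  3 * \int[leb3]_(y in (pball : set (borel3 R))) f ((enorm y)^-1 *: (y : R3 R)) = 2 * pi * I.
Proof.
move=> mf fC C0 HI H2.
have ifull (c : R) : 0 <= c -> (\int[mu]_k ((full_arc_ind k)%:E * c%:E) = (2 * pi * c)%:E)%E.
  move=> c0; have p0 := pi_gt0 R.
  have muI : (mu (`[0%R, (2 * pi)%R]%classic : set mR) = (2 * pi)%:E)%E.
    by rewrite lebesgue_measure_itv/= lte_fin mulr_gt0// -EFinB subr0.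
  transitivity (\int[mu]_(k in (`[0%R, (2 * pi)%R]%classic : set mR)) (cst c%:E k))%E.
    by rewrite [RHS]integral_indic_mul.
  rewrite integral_cst; last exact: measurable_itv.
  by rewrite muleC EFinM; congr (_ * _)%E; exact: muI.
have mpb := @measurable_pball R.
have mN : measurable_fun setT (fun y : borel3 R => (enorm y)^-1 *: (y : R3 R) : borel3 R) by meas3.
have ifE : leb3.-integrable pball (fun y : borel3 R => (f ((enorm y)^-1 *: (y : R3 R)))%:E).
  apply: (@integrable_pball _ (fun y => f ((enorm y)^-1 *: (y : R3 R))) C) => //.
  exact: (measurableT_comp mf mN).
have ic : leb3.-integrable pball (fun y : borel3 R => C%:E).
  apply: (@integrable_pball _ (cst C) C); first exact: measurable_cst.
  by move=> y; rewrite ger0_norm.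
have E1 : (3%:E * \int[leb3]_(y in pball) (f ((enorm y)^-1 *: (y : R3 R)) + C)%:E = (2 * pi * (I + 2 * C))%:E)%E.
  have IC : 0 <= I + 2 * C.
    rewrite -lee_fin -(HI 0); apply: integral_ge0 => t _; rewrite -EFinM lee_fin.
    apply: mulr_ge0.
      rewrite /arc_ind; have [/andP[t0 tp]|_] := boolP ((0 < t) && (t < pi))%R; last by rewrite mul0r.
      by rewrite mul1r ltW// sin_gt0_pi// t0.
    by have := fC (spherical 1 (t, 0)); rewrite ler_norml -lerBlDr sub0r => /andP[].
  rewrite -ifull// (@sphere_angles _ (fun y => (f y + C)%:E)); last 2 first.
  - by apply/measurable_EFinP; apply: measurable_funD.
  - by move=> y; rewrite lee_fin; have := fC y; rewrite ler_norml -lerBlDr sub0r => /andP[].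
  by apply: eq_integral => k _; rewrite HI.
have E2 : (3%:E * \int[leb3]_(y in pball) C%:E = (2 * pi * (2 * C))%:E)%E.
  rewrite -ifull ?mulr_ge0// (@sphere_angles _ (cst C%:E)); last 2 first.
  - exact: measurable_cst.
  - by move=> y; rewrite lee_fin.
  apply: eq_integral => k _; congr (_ * _)%E; rewrite EFinM -H2 muleC -ge0_integralZl//.
  - by apply: eq_integral => t _; rewrite muleC.
  - by apply/measurable_EFinP; meas_trig.
  - move=> t _; rewrite lee_fin /arc_ind.
    have [/andP[t0 tp]|_] := boolP ((0 < t) && (t < pi))%R; last by rewrite mul0r.
    by rewrite mul1r ltW// sin_gt0_pi// t0.
have : (3%:E * \int[leb3]_(y in pball) (f ((enorm y)^-1 *: (y : R3 R)))%:E = (2 * pi * I)%:E)%E.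
  have f1 := integrable_fin_num mpb ifE; have f2 := integrable_fin_num mpb ic.
  move: E1 E2; rewrite (_ : (\int[leb3]_(y in pball) (f ((enorm y)^-1 *: (y : R3 R)) + C)%:E =
    \int[leb3]_(y in pball) (f ((enorm y)^-1 *: (y : R3 R)))%:E + \int[leb3]_(y in pball) C%:E)%E); last first.
    by rewrite -(integralD mpb ifE ic); apply: eq_integral => y _; rewrite EFinD.
  rewrite -(fineK f1) -(fineK f2) -!EFinD -!EFinM => -[e1] [e2]; congr EFin; lra.
move=> E; rewrite /Rintegral; have f1 := integrable_fin_num mpb ifE.
by move: E; rewrite -(fineK f1) -EFinM => -[].
Qed.

Lemma integral_arc_sin : (\int[mu]_t ((arc_ind t * sin t)%:E) = 2%:E)%E.
Proof.
have ms (D : set mR) : measurable_fun D (fun t : mR => (sin t)%:E).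
  by apply/measurable_EFinP; apply: measurable_funTS; exact: measurable_sin.
transitivity (\int[mu]_(t in `]0%R, pi[) (sin t)%:E)%E.
  by rewrite [RHS]integral_indic_mul; apply: eq_integral => t _; rewrite arc_indE EFinM.
rewrite -(@integral_itv_bndoo _ 0%R pi (fun t : R => (sin t)%:E) true false (ms _)).
have dF (t : R) : is_derive t (1:R) (fun t => - cos t) (sin t).
  by have D := is_deriveN (is_derive_cos t); apply: (is_derive_eq D); rewrite opprK.
rewrite (integral_is_derive (pi_ge0 R) (@continuous_sin R) dF).
by rewrite cospi cos0 opprK.
Qed.

Lemma leb3_pball : (3%:E * leb3 (@pball R) = (4 * pi)%:E)%E.
Proof.
have H : 3 * \int[leb3]_(y in (pball : set (borel3 R))) cst 1 ((enorm y)^-1 *: (y : R3 R)) = 2 * pi * 2 :> R.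
  apply: (@integral_pball_real (cst 1) 1) => //.
  - by move=> y; rewrite normr1.
  - move=> k; transitivity (\int[mu]_t (2%:E * (arc_ind t * sin t)%:E))%E.
      by apply: eq_integral => t _; rewrite muleC.
    rewrite ge0_integralZl//.
    + by rewrite integral_arc_sin -EFinM; congr EFin; ring.
    + by apply/measurable_EFinP; meas_trig.
    + move=> t _; rewrite lee_fin /arc_ind.
      have [/andP[t0 tp]|_] := boolP ((0 < t) && (t < pi))%R; last by rewrite mul0r.
      by rewrite mul1r ltW// sin_gt0_pi// t0.
  - exact: integral_arc_sin.
have I1 : (\int[leb3]_(y in (pball : set (borel3 R))) (1%R)%:E = leb3 (@pball R))%E.
  have -> : (\int[leb3]_(y in (pball : set (borel3 R))) (1%R)%:E = \int[leb3]_(y in (pball : set (borel3 R))) cst 1%:E y)%E by [].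
  by rewrite integral_cst ?mul1e//; exact: measurable_pball.
move: H; rewrite /Rintegral [X in fine X](_ : _ = leb3 (@pball R)); last exact: I1.
have : leb3 (@pball R) \is a fin_num by rewrite ge0_fin_numE//; exact: leb3_pball_lty.
by move=> /fineK <- /= H; rewrite -EFinM H; congr EFin; ring.
Qed.

Section Angular_integral.
Variables (z s : R).
Hypothesis zs : 0 < z <= s.
Let z0 : 0 < z. Proof. by case/andP: zs. Qed.
Let s0 : 0 < s. Proof. by case/andP: zs => _; apply: lt_le_trans. Qed.

Let q (t : R) : R := z ^+ 2 + s ^+ 2 - 2 * z * s * cos t.
Let D (t : R) : R := Num.sqrt (q t).

Let q_gt0 t : 0 < t < pi -> 0 < q t.
Proof.
move=> t0; have c1 : cos t < 1.
  rewrite -cos0 ltr_cos ?in_itv/= ?lexx ?pi_ge0//; first by case/andP: t0.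
  by case/andP: t0 => ? ?; rewrite !ltW.
have : 0 < 2 * z * s * (1 - cos t) by rewrite !mulr_gt0// subr_gt0.
have := sqr_ge0 (z - s); rewrite /q; move: (cos t) => c; nra.
Qed.

Let q_ge0 t : 0 <= q t.
Proof.
have : 0 <= 2 * z * s * (1 - cos t) by rewrite !mulr_ge0// ?subr_ge0 ?cos_le1// ltW.
have := sqr_ge0 (z - s); rewrite /q; move: (cos t) => c; nra.
Qed.

Let cq : continuous q.
Proof.
by move=> t; apply: cvgB; [exact: cvg_cst|apply: cvgMr; exact: continuous_cos].
Qed.

Let cD : continuous D.
Proof.
by move=> t; apply: (@continuous_comp _ _ _ q Num.sqrt); [exact: cq|exact: sqrt_continuous].
Qed.

(* By the law of cosines [z - s cos t = (D^2 + z^2 - s^2) / (2 z)], and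
   [D' = z s sin t / D]. *)
Let F (t : R) : R := (D t ^+ 3 / 3 + (z ^+ 2 - s ^+ 2) * D t) / (2 * z ^+ 2 * s) - cos t.
Let f (t : R) : R := sin t * ((D t + (z ^+ 2 - s ^+ 2) / D t) / (2 * z)) + sin t.

Let dF t : 0 < t < pi -> is_derive t (1:R) F (f t).
Proof.
move=> tp; have D0 : 0 < D t by rewrite sqrtr_gt0 q_gt0.
have dq : is_derive t (1:R) q (2 * z * s * sin t).
  have Dq := is_deriveB (is_derive_cst (z ^+ 2 + s ^+ 2) t (1:R))
    (is_deriveM (is_derive_cst (2 * z * s) t (1:R)) (is_derive_cos t)).
  by apply: (is_derive_eq Dq); rewrite /GRing.scale/=; ring.
have dD : is_derive t (1:R) D (z * s * sin t / D t).
  have DD := @is_derive1_comp R Num.sqrt q t _ _ (is_derive1_sqrt (q_gt0 tp)) dq.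
  apply: (is_derive_eq DD); rewrite -/(D t).
  by move: (sin t) => u; field; rewrite gt_eqF.
rewrite (_ : F = fun t => (D t * (D t * D t) * 3^-1 + (z ^+ 2 - s ^+ 2) * D t) * (2 * z ^+ 2 * s)^-1 - cos t); last first.
  by apply/funext => u; rewrite /F !exprS expr0 mulr1.
have DF := is_deriveB (is_deriveM (is_deriveD
   (is_deriveM (is_deriveM dD (is_deriveM dD dD)) (is_derive_cst (3^-1 : R) t (1:R)))
   (is_deriveM (is_derive_cst (z ^+ 2 - s ^+ 2) t (1:R)) dD))
   (is_derive_cst ((2 * z ^+ 2 * s)^-1) t (1:R))) (is_derive_cos t).
apply: (is_derive_eq DF); rewrite /GRing.scale/= /f.
rewrite -[(D * D) t]/(D t * D t).
move: (D t) D0 (sin t) => d d0 u.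
by field; rewrite !gt_eqF.
Qed.

(** For z = s the quotient (z^2 - s^2) / D is identically 0, which removes the singularity at t = 0
    where D vanishes. For z < s the distance D never vanishes. *)
Let cf : {within `[0, pi], continuous f}.
Proof.
move: zs => /andP[_]; rewrite le_eqVlt => /predU1P[E|lt].
  apply: continuous_subspaceT => t.
  rewrite (_ : f = fun t => sin t * (D t * (2 * z)^-1) + sin t); last first.
    by apply/funext => u; rewrite /f E subrr mul0r addr0.
  apply: cvgD; last exact: continuous_sin.
  by apply: cvgM; [exact: continuous_sin|apply: cvgMl; exact: cD].
apply: continuous_subspaceT => t.
have Dn : D t != 0.
  rewrite gt_eqF// sqrtr_gt0.
  have : 0 <= 2 * z * s * (1 - cos t) by rewrite !mulr_ge0// ?subr_ge0 ?cos_le1// ltW.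
  have : 0 < (s - z) ^+ 2 by rewrite exprn_gt0// subr_gt0.
  by rewrite /q; move: (cos t) => c; nra.
apply: cvgD; last exact: continuous_sin.
apply: cvgM; first exact: continuous_sin.
apply: cvgMl; apply: cvgD; first exact: cD.
apply: cvgMr; apply: (@continuous_comp _ _ _ D GRing.inv); first exact: cD.
exact: inv_continuous.
Qed.

(** The added 1 is the shift that makes the integrand nonnegative. The value is F pi - F 0 with D pi
    = s + z and D 0 = s - z; in the fraction the terms in s^2 z cancel and 8 z^3 / 3 is left. *)
Lemma integral_axis_field :
  (\int[mu]_t ((arc_ind t * sin t)%:E * ((z - s * cos t) / D t + 1)%:E) =
   (4 * z / (3 * s) + 2)%:E)%E.
Proof.
have mf (A : set mR) : measurable_fun A (fun t : mR => (f t)%:E).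
  apply/measurable_EFinP; apply: measurable_funTS.
  by rewrite /f /D /q; meas_trig.
transitivity (\int[mu]_(t in `]0%R, pi[) (f t)%:E)%E.
  rewrite [RHS]integral_indic_mul; apply: eq_integral => t _.
  rewrite -arc_indE /arc_ind; have [tp|_] := boolP ((0 < t) && (t < pi)); last by rewrite !mul0r !mul0e.
  rewrite !mul1r mul1e -EFinM; congr EFin; rewrite /f mulrDr mulr1; congr (_ * _ + _).
  have D0 : 0 < D t by rewrite sqrtr_gt0 q_gt0.
  have DE : D t ^+ 2 = q t by rewrite sqr_sqrtr.
  have -> : z - s * cos t = (D t ^+ 2 + z ^+ 2 - s ^+ 2) / (2 * z).
    by rewrite DE /q; move: (cos t) => c; field; rewrite gt_eqF.
  by move: (D t) D0 => d d0; field; rewrite !gt_eqF.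
rewrite -(@integral_itv_bndoo _ 0%R pi (fun t : R => (f t)%:E) true false (mf _)).
have cF : continuous F.
  move=> t; apply: cvgB; last exact: continuous_cos.
  apply: cvgMl; apply: cvgD; last by apply: cvgMr; exact: cD.
  apply: cvgMl; apply: (@continuous_comp _ _ _ D (fun t : R => t ^+ 3)); first exact: cD.
  exact: exprn_continuous.
rewrite (continuous_FTC2 (pi_gt0 R) cf (F := F)).
- have Dpi : D pi = z + s.
    rewrite /D /q cospi (_ : _ - _ = (z + s) ^+ 2); last by ring.
    by rewrite sqrtr_sqr gtr0_norm// addr_gt0.
  have DO : D 0 = s - z.
    rewrite /D /q cos0 (_ : _ - _ = (s - z) ^+ 2); last by ring.
    by rewrite sqrtr_sqr ger0_norm// subr_ge0; case/andP: zs.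
  rewrite -EFinB /F Dpi DO cospi cos0; congr EFin.
  by field; rewrite !gt_eqF.
- split=> [t||].
  + by rewrite in_itv/= => tp; have [] := dF tp.
  + exact: cvg_at_right_filter (cF 0).
  + exact: cvg_at_left_filter (cF pi).
- by move=> t; rewrite in_itv/= => tp; rewrite derive1E; have [_] := dF tp.
Qed.

End Angular_integral.

(** The constant is 4 pi times the mean 2 / (3 s). By symmetry only the vertical component at (0, 0,
    |x|) is computed. The case |x| = s is included because phi charges the sphere of radius r
    itself. *)
Theorem shell_field_inside (s : R) v x : 0 < s -> enorm x <= s ->
  3 * shell_field s v x = 8 * pi / (3 * s) * dot v x.
Proof.
move=> s0 xs; apply: (mulfI (x := 3^-1)); first by rewrite invr_eq0.
rewrite mulrA mulVf// mul1r mulrA; apply: shell_field_radial.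
set z := enorm x; have [z0|z0] := eqVneq z 0.
  by rewrite z0 mulr0 (shell_field0 s e3).
have zp : 0 < z by rewrite lt_def z0 enorm_ge0.
have zs : 0 < z <= s by rewrite zp.
apply: (mulfI (x := 3)) => //; rewrite !mulrA mulfV// mul1r.
pose f (w : borel3 R) : R := dot e3 (K0 ((0, 0, z) - s *: (w : R3 R))).
transitivity (3 * \int[leb3]_(y in (pball : set (borel3 R))) f ((enorm y)^-1 *: (y : R3 R))).
  by congr (_ * _); apply: eq_Rintegral => y _; rewrite /f scalerA.
rewrite (@integral_pball_real f 1 (4 * z / (3 * s))).
- by field; rewrite gt_eqF.
- apply: (@measurable_dot_K0 _ _ _ (fun w : borel3 R => (0, 0, z) - s *: (w : R3 R) : borel3 R)).
  rewrite (_ : (fun y => _) = (fun y : borel3 R => ((0, 0, z) : R3 R) + (- s) *: (y : R3 R))); last first.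
    by apply/funext => y; rewrite scaleNr.
  by apply: measurable_add3; [exact: measurable_cst|apply: measurable_scale3; [exact: measurable_cst|exact: measurable_id]].
- move=> y; apply: le_trans (dot_K0_le _ _) _.
  by rewrite /enorm /dot /= !mulr0 !add0r mulr1 sqrtr1.
- exact: ler01.
- move=> k; rewrite mulr1 -(integral_axis_field zs); apply: eq_integral => t _.
  congr (_ * (_ + _)%:E)%E; rewrite /f K0E; set w := _ - _.
  have wE : w = (- (s * (sin t * cos k)), - (s * (sin t * sin k)), z - s * cos t).
    rewrite /w /spherical /= !mul1r; apply: R3_ext => //=.
    - by rewrite -[LHS]/(0 - s * (sin t * cos k)) sub0r.
    - by rewrite -[LHS]/(0 - s * (sin t * sin k)) sub0r.
  have -> : enorm w = Num.sqrt (z ^+ 2 + s ^+ 2 - 2 * z * s * cos t).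
    rewrite /enorm; congr Num.sqrt; rewrite wE /dot /=.
    transitivity (s ^+ 2 * (sin t ^+ 2 * (cos k ^+ 2 + sin k ^+ 2) + cos t ^+ 2) + z ^+ 2 - 2 * z * s * cos t).
      by move: (sin t) (cos t) (sin k) (cos k) => a b c d; ring.
    by rewrite cos2Dsin2 mulr1 (addrC (sin t ^+ 2)) cos2Dsin2 mulr1 (addrC (z ^+ 2)).
  rewrite dotC dotZl dotC wE /dot /= !mul0r !add0r mul1r mulrC.
  by [].
- exact: integral_arc_sin.
Qed.

End Shell_theorem.

(** * Equality of the fields of annulus and sphere *)

Section Field_cancellation.
Context {R : realType}.
Notation mR := (measurableTypeR R).
Notation mu := (@lebesgue_measure R).
Implicit Types (x y v w : R3 R).

Variable r : R.
Hypothesis r02 : 0 < r <= 2.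
Let r0 : 0 < r. Proof. by case/andP: r02. Qed.
Let r2 : r <= 2. Proof. by case/andP: r02. Qed.

Lemma measurable_translated_kernel v x :
  measurable_fun setT (fun y : borel3 R => dot v (K0 (x - (y : R3 R))) : R).
Proof.
apply: (@measurable_dot_K0 _ _ _ (fun y : borel3 R => x - (y : R3 R) : borel3 R)).
rewrite (_ : (fun y => _) = (fun y : borel3 R => (x : R3 R) + (-1) *: (y : R3 R))); last first.
  by apply/funext => y; rewrite scaleN1r.
by apply: measurable_add3; [exact: measurable_cst|apply: measurable_scale3; [exact: measurable_cst|exact: measurable_id]].
Qed.

Lemma integrable_weighted_kernel (g : borel3 R -> R) (M : R) v x :
  measurable_fun setT g -> (forall y, 0 <= g y <= 1) -> (forall y, M <= enorm y -> g y = 0) ->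
  leb3.-integrable setT (fun y : borel3 R => (g y * dot v (K0 (x - (y : R3 R))))%:E).
Proof.
move=> mg g01 gM.
apply: (@integrable_bounded_support _ (fun y => g y * dot v (K0 (x - y))) (enorm v) M).
- by apply: measurable_funM => //; exact: measurable_translated_kernel.
- move=> y; rewrite normrM; have /andP[g0 g1] := g01 y.
  by rewrite (ger0_norm g0) (le_trans _ (dot_K0_le v (x - y)))// ler_piMl.
- by move=> y /gM ->; rewrite mul0r.
Qed.

Lemma integrable_annulus_kernel v x :
  leb3.-integrable setT (fun y : borel3 R => (annulus_ind r (enorm y) * dot v (K0 (x - (y : R3 R))))%:E).
Proof.
apply: (@integrable_weighted_kernel (fun y => annulus_ind r (enorm y)) 2).
- by apply: (measurableT_comp (measurable_annulus_ind r)); apply: measurable_enorm; exact: measurable_id.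
- by move=> y; exact: annulus_ind01.
- by move=> y y2; rewrite /annulus_ind (ltNge _ 2) y2 andbF.
Qed.

(** The shells give the integral of s^2 (8 pi / (3 s)) over [r, 2], that is (8 pi / 3) (4 - r^2) /
    2. The sphere gives (2 r - r^3 / 2) (8 pi / (3 r)), which is the same number. *)
Lemma annulus_field v x : enorm x <= r ->
  \int[leb3]_y (annulus_ind r (enorm y) * dot v (K0 (x - (y : R3 R)))) =
  3 * (2 * r - r ^+ 3 / 2) * shell_field r v x.
Proof.
move=> xr; pose k := 8 * pi / 3 * dot v x.
have -> : 3 * (2 * r - r ^+ 3 / 2) * shell_field r v x = (4 - r ^+ 2) / 2 * k.
  rewrite mulrAC (shell_field_inside v r0 xr) /k.
  by move: (dot v x) (pi : R) => d p; field; rewrite gt_eqF.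
rewrite /Rintegral (@polar21 _ (fun y => annulus_ind r (enorm y) * dot v (K0 (x - y)))); last first.
  exact: integrable_annulus_kernel.
have E s : 0 < s -> (3%:E * \int[leb3]_(y in pball) (s ^+ 2 * (annulus_ind r (enorm ((s / enorm y) *: (y : R3 R))) *
    dot v (K0 (x - (s / enorm y) *: (y : R3 R)))))%:E = (annulus_ind r s * (s * k))%:E)%E.
  move=> s0; have ik := integrable_shell_kernel s v x.
  have -> : (\int[leb3]_(y in pball) (s ^+ 2 * (annulus_ind r (enorm ((s / enorm y) *: (y : R3 R))) *
      dot v (K0 (x - (s / enorm y) *: (y : R3 R)))))%:E =
      (s ^+ 2 * annulus_ind r s)%:E * \int[leb3]_(y in pball) (dot v (K0 (x - (s / enorm y) *: (y : R3 R))))%:E)%E.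
    rewrite -(integralZl measurable_pball ik); apply: eq_integral => y; rewrite inE => /andP[y0 _].
    by rewrite enormZ gtr0_norm ?divr_gt0// divfK ?gt_eqF// -EFinM mulrA.
  rewrite -(fineK (integrable_fin_num measurable_pball ik)) -[fine _]/(shell_field s v x) -!EFinM.
  congr EFin; rewrite /annulus_ind; have [/andP[rs _]|_] := boolP ((r <= s) && (s < 2)); last by rewrite !(mulr0, mul0r).
  rewrite mulr1 mul1r mulrCA (shell_field_inside v s0 (le_trans xr rs)) /k.
  by move: (dot v x) (pi : R) => d p; field; rewrite gt_eqF.
have i3 (s : R) : 0 < s -> (\int[leb3]_(y in pball) (s ^+ 2 * (annulus_ind r (enorm ((s / enorm y) *: (y : R3 R))) *
    dot v (K0 (x - (s / enorm y) *: (y : R3 R)))))%:E = (3^-1 * (annulus_ind r s * (s * k)))%:E)%E.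
  move=> s0; rewrite [RHS]EFinM -(E s s0) muleA -EFinM mulVf// mul1e.
  by [].
have -> : (\int[mu]_(s in `]0%R, +oo[) \int[leb3]_(y in pball) (s ^+ 2 * (annulus_ind r (enorm ((s / enorm y) *: (y : R3 R))) *
    dot v (K0 (x - (s / enorm y) *: (y : R3 R)))))%:E = \int[mu]_(s in `[r, 2%R[) ((3^-1) * (s * k))%:E)%E.
  transitivity (\int[mu]_(s in `]0%R, +oo[) (3^-1 * (annulus_ind r s * (s * k)))%:E)%E.
    by apply: eq_integral => s; rewrite inE/= in_itv/= andbT => s0; exact: i3.
  rewrite [LHS]integral_indic_mul [RHS]integral_indic_mul; apply: eq_integral => s _.
  rewrite -annulus_indE -!EFinM; congr EFin.
  rewrite mulrCA mulrA; have [s0|s0] := ltP 0 s.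
    have sI : s \in (`]0%R, +oo[%classic : set mR) by rewrite inE/= in_itv/= s0.
    by rewrite indicE sI mulr1 mulrCA.
  have -> : annulus_ind r s = 0 by rewrite /annulus_ind leNgt (le_lt_trans s0).
  by rewrite !(mul0r, mulr0).
have ik2 : (\int[mu]_(s in `[r, 2%R[) ((3^-1) * (s * k))%:E = (3^-1 * ((4 - r ^+ 2) / 2 * k))%:E)%E.
  have mk : measurable_fun (`[r, 2[%classic : set mR) (fun s : mR => (3^-1 * (s * k))%:E).
    by apply/measurable_EFinP; apply: measurable_funTS; meas.
  rewrite (integral_itv_bndo_bndc mk).
  have dF (t : R) : is_derive t (1:R) (fun t => 3^-1 * (t ^+ 2 / 2 * k)) (3^-1 * (t * k)).
    by apply: is_derive_eq; rewrite /GRing.scale/=; field.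
  rewrite (integral_is_derive r2 _ dF); last by move=> t; apply: cvgMr; apply: cvgMl; exact: cvg_id.
  by congr EFin; field.
by rewrite ik2 -EFinM mulrA mulfV// mul1r.
Qed.

Lemma omega_field (m : R) v x : enorm x <= r ->
  \int[leb3]_y (omega_ m y * dot v (K0 (x - (y : R3 R)))) =
  c_ m * (\int[leb3]_(y in (oball r : set (borel3 R))) dot v (K0 (x - (y : R3 R)))) +
  3 * c_ m * (2 * r - r ^+ 3 / 2) * shell_field r v x.
Proof.
move=> xr.
have iB (s : R) : leb3.-integrable setT (fun y : borel3 R => (\1_(oball s) y * dot v (K0 (x - (y : R3 R))))%:E).
  apply: (@integrable_weighted_kernel (\1_(oball s)) s).
  - by apply: measurable_indic; exact: measurable_oball.
  - by move=> y; rewrite indicE ler0n lern1 leq_b1.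
  - by move=> y sy; rewrite indicE memNset// /oball/=; apply/negP; rewrite -leNgt.
have -> : \int[leb3]_y (omega_ m y * dot v (K0 (x - (y : R3 R)))) =
    c_ m * \int[leb3]_y (\1_(oball 2) y * dot v (K0 (x - (y : R3 R)))).
  rewrite -(RintegralZl (c_ m) measurableT (iB 2)); apply: eq_Rintegral => y _.
  by rewrite mulrA.
have -> : \int[leb3]_y (\1_(oball 2) y * dot v (K0 (x - (y : R3 R)))) =
    \int[leb3]_(y in (oball r : set (borel3 R))) dot v (K0 (x - (y : R3 R))) +
    \int[leb3]_y (annulus_ind r (enorm y) * dot v (K0 (x - (y : R3 R)))).
  rewrite [in RHS]/Rintegral (integral_indic_mul _ (oball r : set (borel3 R))) -/(Rintegral _ _ _).
  rewrite -[X in fine X + _]/(\int[leb3]_y (\1_(oball r) y * dot v (K0 (x - (y : R3 R))))%:E)%E -/(Rintegral _ _ _).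
  rewrite -(RintegralD measurableT (iB r) (integrable_annulus_kernel v x)); apply: eq_Rintegral => y _.
  rewrite -mulrDl; congr (_ * _); rewrite !indicE /annulus_ind.
  have E (s : R) : (y \in (oball s : set (borel3 R))) = (enorm y < s).
    by apply/idP/idP; rewrite inE.
  rewrite !E; have [yr|ry] := ltP (enorm y) r.
    by rewrite (lt_le_trans yr r2) addr0.
  by rewrite add0r.
rewrite (annulus_field v xr).
by move: (Rintegral _ _ _) (shell_field _ _ _) => a b; ring.
Qed.

End Field_cancellation.

(** * Construction of the measure phi *)

Section Restricted_pushforward.
Context d d' (X : measurableType d) (Y : measurableType d') (R : realType).

Lemma integral_push_restr (m : {measure set X -> \bar R}) (D : set X) (mD : measurable D)
    (T : X -> Y) (mT : measurable_fun setT T) (g : Y -> \bar R) : measurable_fun setT g ->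
  (\int[measure_function_pushforward__canonical__measure_function_Measure
      (measure_function_mrestr__canonical__measure_function_Measure m mD) mT]_y g y =
   \int[m]_(x in D) g (T x))%E.
Proof.
move=> mg; have mgT : measurable_fun setT (g \o T) by exact: measurableT_comp.
rewrite -[RHS](integral_mrestr m mD mgT); apply/esym.
exact: (@integral_pushforward_preserving _ _ _ _ _
  (measure_function_mrestr__canonical__measure_function_Measure m mD) _ T mT).
Qed.

End Restricted_pushforward.

Section Equilibrium_measure.
Import HBNNSimple HBSimple.
Context {R : realType}.
Notation mR := (measurableTypeR R).

(** For an arbitrary f the integral is a supremum over simple functions below f, and each of these
    vanishes on D. Applied to the flux, this avoids any discussion of the measurability of the two
    fields. *)
Lemma ge0_integral_off_null d (X : measurableType d) (nu : {measure set X -> \bar R})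
    (D : set X) (f : X -> \bar R) : measurable D -> nu (~` D) = 0%E ->
  (forall x, 0 <= f x)%E -> (forall x, D x -> f x = 0%E) -> (\int[nu]_x f x = 0)%E.
Proof.
move=> mD D0 f0 fD; apply/eqP; rewrite eq_le; apply/andP; split; last exact: integral_ge0.
rewrite ge0_integralTE//; apply: ub_ereal_sup => _ [h /= hf <-]; rewrite -integralT_nnsfun le_eqVlt; apply/orP; left; apply/eqP.
rewrite (ae_eq_integral (cst 0%E))//; first by rewrite integral0.
- by apply/measurable_EFinP; exact: measurable_funPT.
- exists (~` D); split => //; first exact: measurableC.
  move=> x /= nH Dx; apply: nH => _; apply/eqP; rewrite eq_le; apply/andP; split.
    by rewrite -(fD x Dx); exact: hf.
  by rewrite lee_fin.
Qed.

Lemma Rintegral_off_null d (X : measurableType d) (nu : {measure set X -> \bar R})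
    (D : set X) (f : X -> R) : measurable D -> nu (~` D) = 0%E ->
  (forall x, D x -> f x = 0) -> \int[nu]_x f x = 0.
Proof.
move=> mD D0 fD; rewrite /Rintegral integralE.
rewrite (ge0_integral_off_null mD D0); last 2 first.
- by move=> x; exact: funepos_ge0.
- by move=> x /fD fx; rewrite funeposE fx maxxx.
rewrite (ge0_integral_off_null mD D0) ?sube0//.
by move=> x /fD fx; rewrite funenegE fx oppe0 maxxx.
Qed.

Variables (r : R) (a b : {nonneg R}).

Definition radial (y : borel3 R) : borel3 R := (r / enorm y) *: (y : R3 R).

Let mrad : measurable_fun setT radial. Proof. exact: measurable_radial. Qed.

(** The image of volume on the punctured ball is the uniform measure of mass 4 pi / 3 on the sphere,
    so the weight b will carry a factor 3. *)
Definition unit_shell : {measure set (borel3 R) -> \bar R} :=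
  measure_function_pushforward__canonical__measure_function_Measure
    (measure_function_mrestr__canonical__measure_function_Measure leb3 (@measurable_pball R)) mrad.

Definition ball_part : {measure set (borel3 R) -> \bar R} :=
  mscale a (measure_function_mrestr__canonical__measure_function_Measure leb3 (@measurable_oball R r)).

Definition shell_part : {measure set (borel3 R) -> \bar R} := mscale b unit_shell.

Definition equilibrium : {measure set (borel3 R) -> \bar R} := measure_add ball_part shell_part.

Lemma ball_partE A : ball_part A = (a%:num%:E * leb3 (A `&` oball r))%E.
Proof. by []. Qed.

Lemma shell_partE A : shell_part A = (b%:num%:E * leb3 (radial @^-1` A `&` pball))%E.
Proof. by []. Qed.

Lemma equilibriumE A :
  equilibrium A = (a%:num%:E * leb3 (A `&` oball r) + b%:num%:E * leb3 (pball `&` radial @^-1` A))%E.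
Proof.
transitivity (ball_part A + shell_part A)%E; first exact: measure_addE.
by rewrite ball_partE shell_partE (setIC pball).
Qed.

Lemma ball_part_integral (g : borel3 R -> \bar R) : measurable_fun setT g ->
  (\int[ball_part]_x g x = a%:num%:E * \int[leb3]_(x in oball r) g x)%E.
Proof.
move=> mg; rewrite -(integral_mrestr leb3 (@measurable_oball R r) mg).
exact: (@integral_scaled_pushforward _ _ _ _ _ ball_part _ id a).
Qed.

Lemma shell_part_integral (g : borel3 R -> \bar R) : measurable_fun setT g ->
  (\int[shell_part]_x g x = b%:num%:E * \int[leb3]_(y in pball) g (radial y))%E.
Proof.
move=> mg.
have E1 : (\int[shell_part]_x g x = b%:num%:E * \int[unit_shell]_x g x)%E.
  exact: (@integral_scaled_pushforward _ _ _ _ _ shell_part _ id b).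
exact: (etrans E1 (congr1 (fun t => b%:num%:E * t)%E (integral_push_restr leb3 (@measurable_pball R) mrad mg))).
Qed.

Lemma equilibrium_integral (g : borel3 R -> R) (C : R) :
  measurable_fun setT g -> (forall y, `|g y| <= C) ->
  \int[equilibrium]_x g x =
  a%:num * (\int[leb3]_(x in (oball r : set (borel3 R))) g x) +
  b%:num * (\int[leb3]_(y in (pball : set (borel3 R))) g (radial y)).
Proof.
move=> mg gC; have mgE : measurable_fun setT (EFin \o g) by exact/measurable_EFinP.
have bd (D : set (borel3 R)) (h : borel3 R -> R) : (forall y, `|h y| <= C) -> [bounded h x | x in D].
  move=> hC; exists C; split; first exact: num_real.
  by move=> M CM y _; rewrite /= (le_trans (hC y))// ltW.
have fb : (leb3 ((setT : set (borel3 R)) `&` (oball r : set (borel3 R))) < +oo)%E by rewrite setTI; exact: leb3_oball_lty.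
have fp : (leb3 ((setT : set (borel3 R)) `&` (pball : set (borel3 R))) < +oo)%E by rewrite setTI; exact: leb3_pball_lty.
have i1 : ball_part.-integrable setT (EFin \o g).
  apply: measurable_bounded_integrable => //; last exact: bd.
  by rewrite ball_partE; apply: lte_mul_pinfty.
have i2 : shell_part.-integrable setT (EFin \o g).
  apply: measurable_bounded_integrable => //; last exact: bd.
  by rewrite shell_partE; apply: lte_mul_pinfty.
have j1 : leb3.-integrable (oball r) (EFin \o g).
  apply: measurable_bounded_integrable; [exact: measurable_oball|exact: leb3_oball_lty|exact: measurable_funTS|exact: bd].
have j2 : leb3.-integrable pball (EFin \o (g \o radial)).
  apply: measurable_bounded_integrable; [exact: measurable_pball|exact: leb3_pball_lty| |].
  by apply: measurable_funTS; exact: measurableT_comp.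
  by apply: (bd _ (g \o radial)) => y; exact: gC.
rewrite /Rintegral (integral_measure_add measurableT i1 i2) ball_part_integral// shell_part_integral//.
have f1 := integrable_fin_num (@measurable_oball R r) j1.
have f2 := integrable_fin_num (@measurable_pball R) j2.
by rewrite -[in LHS](fineK f1) -[in LHS](fineK f2).
Qed.

End Equilibrium_measure.

(** * The cubic equation for the radius *)

Section Radius.
Context {R : realType}.
Variable m : R.
Hypothesis m1 : 1 <= m.

Let p (t : R) : R := t ^+ 3 - 12 * t + 16 / m.

Let p_decr (s t : R) : 0 < s -> s < t -> t <= 2 -> p t < p s.
Proof.
move=> s0 st t2; rewrite -subr_gt0.
have -> : p s - p t = (t - s) * (12 - (t ^+ 2 + t * s + s ^+ 2)) by rewrite /p; ring.
(* With 0 < s < t <= 2 the sum t^2 + t s + s^2 is below 12. *)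
rewrite mulr_gt0 ?subr_gt0//; nra.
Qed.

(** Here p 0 = 16 / m > 0 and p 2 = 16 / m - 16 <= 0, the latter because m >= 1; strict decrease on
    ]0, 2] gives uniqueness. *)
Lemma radius_exists_unique :
  exists! r : R, 0 < r <= 2 /\ r ^+ 3 - 12 * r + 16 / m = 0.
Proof.
have m0 : 0 < m by rewrite (lt_le_trans ltr01).
have p0 : 0 < p 0 by rewrite /p expr0n mulr0 subr0 add0r divr_gt0.
have p2 : p 2 <= 0.
  have : 16 / m <= 16 by rewrite ler_pdivrMr// ler_peMr.
  rewrite /p; move: (16 / m) => u; lra.
have cp : continuous p.
  move=> t; apply: cvgD; last exact: cvg_cst.
  by apply: cvgB; [exact: exprn_continuous|apply: cvgMr; exact: cvg_id].
have [r] : exists2 r, r \in `[0, 2] & p r = 0.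
  apply: IVT => //; first exact: continuous_subspaceT.
  by rewrite ge_min p2 orbT le_max ltW.
rewrite in_itv/= => /andP[r0 r2] pr.
have rp : 0 < r.
  by rewrite lt_def r0 andbT; apply/eqP => rE; move: p0; rewrite -[X in p X]rE pr ltxx.
exists r; split; first by rewrite rp r2.
move=> t [/andP[t0 t2] pt]; have [tr|rt|//] := ltgtP t r.
  by have := p_decr t0 tr r2; rewrite pr /p pt ltxx.
by have := p_decr rp rt t2; rewrite pr /p pt ltxx.
Qed.

End Radius.

(** * The equilibrium measure: mass, density and vanishing flux *)

Section Equilibrium.
Context {R : realType}.
Variables (m r : R).
Hypotheses (m1 : 1 <= m) (r02 : 0 < r <= 2) (root : r ^+ 3 - 12 * r + 16 / m = 0).
Let r0 : 0 < r. Proof. by case/andP: r02. Qed.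
Let r2 : r <= 2. Proof. by case/andP: r02. Qed.
Let m0 : 0 < m. Proof. by rewrite (lt_le_trans ltr01). Qed.

Lemma c_gt0 : 0 < c_ m.
Proof. by rewrite /c_ divr_gt0// mulr_gt0// pi_gt0. Qed.

Lemma shell_weight_ge0 : 0 <= 3 * c_ m * (2 * r - r ^+ 3 / 2).
Proof.
apply: mulr_ge0; first by rewrite mulr_ge0// ltW// c_gt0.
have -> : 2 * r - r ^+ 3 / 2 = r * (2 - r) * (2 + r) / 2 by field.
by rewrite divr_ge0// mulr_ge0 ?addr_ge0// ?mulr_ge0 ?subr_ge0// ltW.
Qed.

Let phi : {measure set (borel3 R) -> \bar R} :=
  equilibrium r (NngNum (ltW c_gt0)) (NngNum shell_weight_ge0).

Lemma leb3_oball : (leb3 (oball r) = (4 * pi / 3 * r ^+ 3)%:E)%E.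
Proof.
have -> : (leb3 (oball r) = (r ^+ 3)%:E * leb3 (oball 1))%E.
  have E : (leb3 ((fun x : R3 R => r *: x) @^-1` oball r) = (r^-1 ^+ 3)%:E * leb3 (oball r))%E.
    exact: (leb3_scale (PosNum r0) (measurable_oball r)).
  have E1 : (fun x : R3 R => r *: x) @^-1` oball r = oball 1.
    apply/seteqP; split => x; rewrite /oball/= enormZ gtr0_norm//.
      by move=> h; rewrite -(ltr_pM2l r0) mulr1.
    by move=> h; rewrite -[ltRHS]mulr1 ltr_pM2l.
  by rewrite E1 in E; rewrite E muleA -EFinM -exprMn divff ?gt_eqF// expr1n mul1e.
have -> : (leb3 (oball 1) = leb3 (@pball R))%E.
  have -> : oball 1 = pball `|` [set 0] :> set (borel3 R).
    apply/seteqP; split => x; rewrite /oball /pball/=.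
      have [->|x0] := eqVneq x 0; first by right.
      by move=> x1; left; rewrite x1 enorm_gt0 x0.
    by move=> [/andP[]//|->]; rewrite enorm0.
  rewrite measureU//.
  - by rewrite [X in (_ + X)%E](_ : _ = 0%E) ?adde0//; exact: (leb3_set1 0).
  - exact: measurable_pball.
  - exact: measurable_set1_R3.
  - apply/seteqP; split => x //= -[/andP[x0 _] xE].
    by move: x0; rewrite xE enorm0 ltxx.
have := @leb3_pball R; have : leb3 (@pball R) \is a fin_num by rewrite ge0_fin_numE//; exact: leb3_pball_lty.
move=> /fineK <-; rewrite -!EFinM => -[h]; congr EFin.
by move: h; move: (fine _) (pi : R) => u q h; rewrite (_ : 4 * q = 3 * u)//; field.
Qed.

(** The ball and the sphere together have mass (m / 16) (12 r - r^3), and the cubic equation says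
    that this is 1. *)
Lemma equilibrium_setT : phi setT = 1%E.
Proof.
have c0 := c_gt0; rewrite /phi equilibriumE /= setTI preimage_setT setIT leb3_oball.
have -> : (leb3 (@pball R) = (4 * pi / 3)%:E)%E.
  have := @leb3_pball R; have : leb3 (@pball R) \is a fin_num by rewrite ge0_fin_numE//; exact: leb3_pball_lty.
  move=> /fineK <-; rewrite -!EFinM => -[h]; congr EFin.
  by rewrite -h mulrC mulKf.
rewrite -!EFinM -EFinD; congr EFin.
have mn : m != 0 by rewrite gt_eqF.
have pn : (pi : R) != 0 by rewrite gt_eqF// pi_gt0.
transitivity (m / 16 * (12 * r - r ^+ 3)); first by rewrite /c_; move: (pi : R) pn => q qn; field.
have -> : 12 * r - r ^+ 3 = 16 / m by apply/eqP; rewrite -subr_eq0 -oppr_eq0 opprB opprB addrC -root; apply/eqP; ring.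
by field.
Qed.

(** A separately named set function, to which the measure and probability structures are
    attached. *)
Definition equilibrium_fun : set (borel3 R) -> \bar R := fun A => phi A.

HB.instance Definition _ := isMeasure.Build _ _ _ equilibrium_fun
  (measure0 phi) (measure_ge0 phi) (@measure_semi_sigma_additive _ _ _ phi).

HB.instance Definition _ := Measure_isProbability.Build _ _ _ equilibrium_fun equilibrium_setT.

Definition equilibrium_probability : probability (borel3 R) R := equilibrium_fun.

Lemma equilibrium_probabilityE A : equilibrium_probability A = phi A.
Proof. by []. Qed.

Lemma equilibrium_distr (eta : R3 R -> R) (M : R) : smooth eta -> vanish M eta ->
  distr_measure equilibrium_probability eta =
  distr_sub (distr_fun (omega_ m)) (distr_laplacian (distr_fun (fun x => c_ m * exterior_pot r x))) eta.
Proof.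
move=> se vE; rewrite [RHS](integral_omega r02 m se vE).
have [C C0 eC] := vanish_bounded (smooth_continuous se) vE.
rewrite /distr_measure -[LHS]/(\int[phi]_x eta x).
exact: (equilibrium_integral _ _ _ (continuous_measurable_R3 (smooth_continuous se)) eC).
Qed.

Lemma equilibrium_sphere (A : set (borel3 R)) : measurable A ->
  equilibrium_probability A = ((c_ m)%:E * leb3 (A `&` oball r)
    + (c_ m * (2 / r - r / 2))%:E * sphere_measure r A)%E.
Proof.
move=> mA; rewrite equilibrium_probabilityE /phi equilibriumE sphere_measureE//.
(* The weights agree because 3 (2 r - r^3 / 2) = 3 r^2 (2 / r - r / 2). *)
congr (_ + _)%E; rewrite muleA -EFinM; congr (_%:E * _)%E => /=.
by field; rewrite gt_eqF.
Qed.

Lemma equilibrium_off_ball : phi (~` (cball r : set (borel3 R))) = 0%E.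
Proof.
rewrite /phi equilibriumE.
have -> : ~` (cball r : set (borel3 R)) `&` oball r = set0.
  by apply/seteqP; split => x //= -[xr]; rewrite /oball/= => /ltW.
have -> : pball `&` radial r @^-1` (~` (cball r : set (borel3 R))) = set0.
  apply/seteqP; split => x //= -[/andP[x0 _]]; apply.
  by rewrite /cball/= /radial enormZ gtr0_norm ?divr_gt0// divfK ?gt_eqF.
by rewrite !measure0 !mule0 adde0.
Qed.

Lemma equilibrium_field (v x : R3 R) : enorm x <= r ->
  \int[leb3]_y (omega_ m y * dot v (K0 (x - (y : R3 R)))) =
  \int[phi]_y dot v (K0 (x - (y : R3 R))).
Proof.
move=> xr; rewrite (omega_field r02 m v xr).
apply/esym.
have H := @equilibrium_integral R r (NngNum (ltW c_gt0)) (NngNum shell_weight_ge0) _ _ (measurable_translated_kernel v x)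
  (fun y => dot_K0_le v (x - y)).
exact: H.
Qed.

Lemma equilibrium_K0 (x : R3 R) : enorm x <= r ->
  K0_conv_fun (omega_ m) x = K0_conv_measure equilibrium_probability x.
Proof.
move=> xr; have d1 (w : R3 R) : dot e1 w = w.1.1 by rewrite /dot/= mul1r !mul0r !addr0.
have d2 (w : R3 R) : dot e2 w = w.1.2 by rewrite /dot/= mul1r !mul0r addr0 add0r.
have d3 (w : R3 R) : dot e3 w = w.2 by rewrite /dot/= mul1r !mul0r !add0r.
apply: R3_ext; rewrite /K0_conv_fun /K0_conv_measure /vintegral /=.
- transitivity (\int[leb3]_y (omega_ m y * dot e1 (K0 (x - (y : R3 R))))).
    by apply: eq_Rintegral => y _; rewrite d1.
  by rewrite equilibrium_field//; apply: eq_Rintegral => y _; rewrite d1.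
- transitivity (\int[leb3]_y (omega_ m y * dot e2 (K0 (x - (y : R3 R))))).
    by apply: eq_Rintegral => y _; rewrite d2.
  by rewrite equilibrium_field//; apply: eq_Rintegral => y _; rewrite d2.
- transitivity (\int[leb3]_y (omega_ m y * dot e3 (K0 (x - (y : R3 R))))).
    by apply: eq_Rintegral => y _; rewrite d3.
  by rewrite equilibrium_field//; apply: eq_Rintegral => y _; rewrite d3.
Qed.

(** The integrand is 0 at every point of the closed ball, whose complement is null for phi; no
    cancellation between different points is involved. *)
Lemma equilibrium_zero_flux : zero_flux_stationary (omega_ m) equilibrium_probability.
Proof.
move=> xi _; rewrite -[LHS]/(\int[phi]_x dot (xi x) (K0_conv_fun (omega_ m) x -
  K0_conv_measure equilibrium_probability x)).
apply: (@Rintegral_off_null _ _ _ phi (cball r)).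
- have -> : cball r = ~` [set x | r < enorm x] :> set (borel3 R).
    by apply/seteqP; split => x; rewrite /cball/= leNgt => /negP.
  apply: measurableC; apply: (measurable_lt (measurable_cst r)).
  by apply: measurable_enorm; exact: measurable_id.
- exact: equilibrium_off_ball.
by move=> x xr; rewrite (equilibrium_K0 xr) subrr /dot /= !mulr0 !addr0.
Qed.

End Equilibrium.

Theorem proposition7p5 (R : realType) (m : R) (hm : 1 <= m) :
  (exists! r : R, 0 < r <= 2 /\ r ^+ 3 - 12 * r + 16 / m = 0) /\
  forall r : R, 0 < r <= 2 -> r ^+ 3 - 12 * r + 16 / m = 0 ->
    (exists! U : R3 R -> R, exterior_solution (omega_ m) r U) /\
    forall U : R3 R -> R, exterior_solution (omega_ m) r U ->
      exists phi : probability (borel3 R) R,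
        [/\ distr_eq setT (distr_measure phi)
              (distr_sub (distr_fun (omega_ m)) (distr_laplacian (distr_fun U))),
            forall A : set (borel3 R), measurable A ->
              phi A = ((c_ m)%:E * leb3 (A `&` oball r)
                       + (c_ m * (2 / r - r / 2))%:E * sphere_measure r A)%E
          & zero_flux_stationary (omega_ m) phi].
Proof.
split; first exact: radius_exists_unique.
move=> r r02 root; have r0 : 0 < r by case/andP: r02.
have sol := exterior_pot_solution r02 m.
split.
  by exists (fun x => c_ m * exterior_pot r x); split => // U; exact: exterior_solution_unique.
(* Uniqueness replaces the given solution by the explicit potential, so the same measure serves
   every U. *)
move=> U solU; rewrite (exterior_solution_unique r0 solU sol).
exists (equilibrium_probability hm r02 root); split.
- move=> eta [se ce _]; have [M _ vE] := compact_supp_vanish ce.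
  exact: equilibrium_distr vE.
- by move=> A mA; exact: equilibrium_sphere.
- exact: equilibrium_zero_flux.
Qed.
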